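(* Let $d\ge1$, $p\in(0,1)$, $s\in[p,2]$, and $P=\lfloor d(p^{-1}-1)\rfloor$. Let $$\alpha\in\big(\{0,2,\ldots,2P\}\cup(2d(p^{-1}-1),\infty)\big)^d,$$ and let $\{\mathcal{L}_n^\alpha\}_{n\in\mathbb{N}^d}$ be the standard Laguerre functions on $\mathbb{R}^d_+$. Put $E=d+sd(p^{-1}-1)$. Then there is a constant $C$ such that $$\sum_{n\in\mathbb{N}^d}\frac{|\langle f,\mathcal{L}_n^\alpha\rangle|^s}{(|n|+1)^E}\le C\,\|f\|^s_{H^p(\mathbb{R}^d_+)},\qquad f\in H^p(\mathbb{R}^d_+),$$ and the exponent $E$ is sharp, i.e. it is the smallest exponent for which such an inequality holds (for every $E'<E$ the inequality with $E'$ in place of $E$ fails for every constant).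
   Context: $\mathbb{N}=\{0,1,2,\ldots\}$, $\mathbb{R}_+=(0,\infty)$, $\mathbb{R}_+^d=(0,\infty)^d$ with Lebesgue measure, $|n|=n_1+\ldots+n_d$. For $\alpha>-1$ the one-dimensional standard Laguerre functions are $\mathcal{L}_k^\alpha(u)=\big(\frac{\Gamma(k+1)}{\Gamma(k+\alpha+1)}\big)^{1/2}L_k^\alpha(u)e^{-u/2}u^{\alpha/2}$, $u>0$, $k\in\mathbb{N}$, where $L_k^\alpha$ is the Laguerre polynomial of degree $k$ and order $\alpha$. For $\alpha\in(-1,\infty)^d$, $n\in\mathbb{N}^d$: $\mathcal{L}_n^\alpha(x)=\prod_{i=1}^d\mathcal{L}_{n_i}^{\alpha_i}(x_i)$. They form an orthonormal basis of $L^2(\mathbb{R}_+^d)$. Hardy spaces. For $p\in(0,1]$, $H^p(\mathbb{R}^d)$ is the real Hardy space of distributions. For $q\in[1,\infty]$, $q>p$, a $(p,q)$-atom is a measurable function $a$ supported in a Euclidean ball $B$ with $\|a\|_{L^q}\le|B|^{1/q-1/p}$ and $\int_Ba(x)x^n\,dx=0$ for all $|n|\le\lfloor d(p^{-1}-1)\rfloor$. For $X=\mathbb{R}^d_+$, $H^p(X)$ is the set of $f=F|_X$ with $F\in H^p(\mathbb{R}^d)$, $\mathrm{supp}\,F\subset\overline X$; each such $f$ can be written $f=\sum_j\lambda_ja_j$ with atoms $a_j$ supported in $X$, $\sum_j|\lambda_j|^p<\infty$, and $\|f\|_{H^p(X)}=\inf(\sum_j|\lambda_j|^p)^{1/p}$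 over such decompositions (different $q$ give equivalent quantities). Pairing. For the given $\alpha$ the functions $\mathcal{L}_n^\alpha$ are restrictions to $\mathbb{R}_+^d$ of functions in the Lipschitz space $\Lambda_{d(1/p-1)}(\mathbb{R}^d)$ (dual-type space to $H^p(\mathbb{R}^d)$), and $\langle f,\mathcal{L}_n^\alpha\rangle$ is the value at $f$ of the resulting bounded functional on $H^p(\mathbb{R}_+^d)$, i.e. $\langle f,\mathcal{L}_n^\alpha\rangle=\sum_j\lambda_j\int_{\mathbb{R}_+^d}a_j\mathcal{L}_n^\alpha\,dx$ for an atomic decomposition $f=\sum_j\lambda_ja_j$ with atoms supported in $\mathbb{R}_+^d$ (it equals $\int f\mathcal{L}_n^\alpha$ when $f\in L^1$). *)

(* Defs.v *)
From HB Require Import structures.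
From mathcomp Require Import all_boot all_order all_algebra.
From mathcomp Require Import all_classical all_reals all_analysis.

Set Implicit Arguments.
Unset Strict Implicit.
Unset Printing Implicit Defensive.

Import Order.TTheory GRing.Theory Num.Theory.
Import numFieldNormedType.Exports.

Local Open Scope classical_set_scope.
Local Open Scope ring_scope.

(** [R^d] is ['rV[R]_d], with the sigma-algebra generated by the coordinates
    and the [d]-fold product of the one-dimensional Lebesgue measure. *)

Definition rV_display : measure_display.
Proof. exact. Qed.

Section measurable_rV.
Context {R : realType} {n : nat}.

Let coors : 'I_n -> 'rV[R]_n -> R := fun i x => x ord0 i.

Let rV_set0 : g_sigma_preimage coors set0.
Proof. exact: sigma_algebra0. Qed.

Let rV_setC A : g_sigma_preimage coors A -> g_sigma_preimage coors (~` A).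
Proof. exact: sigma_algebraC. Qed.

Let rV_bigcup (F : (set 'rV[R]_n)^nat) :
  (forall i, g_sigma_preimage coors (F i)) ->
  g_sigma_preimage coors (\bigcup_i F i).
Proof. exact: sigma_algebra_bigcup. Qed.

HB.instance Definition _ := @isMeasurable.Build rV_display
  'rV[R]_n (g_sigma_preimage coors) rV_set0 rV_setC rV_bigcup.

End measurable_rV.

Section measurable_rV_theory.
Context {R : realType}.

Lemma measurable_coord n (i : 'I_n) :
  measurable_fun [set: 'rV[R]_n] (fun x : 'rV[R]_n => x ord0 i).
Proof.
move=> _ Y mY; rewrite setTI; apply: sub_sigma_algebra => /=.
rewrite -bigcup_seq/=; exists i => /=; first by rewrite mem_index_enum.
by exists Y => //; rewrite setTI.
Qed.

Lemma measurable_fun_rV d (T : measurableType d) n (f : T -> 'rV[R]_n) :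
  (forall i, measurable_fun [set: T] (fun t => f t ord0 i)) ->
  measurable_fun [set: T] f.
Proof.
move=> mf _ Y; rewrite setTI.
suff : measurable `<=` [set B : set 'rV[R]_n | measurable (f @^-1` B)].
  exact.
apply: smallest_sub; last first.
  move=> A; rewrite /= -bigcup_seq/= => -[i _ [B mB <-]].
  by rewrite setTI /=; have := mf i measurableT B mB; rewrite setTI.
split=> /=.
- by rewrite preimage_set0.
- by move=> A mA; rewrite setTD -preimage_setC; apply: measurableC.
- by move=> F mF; rewrite preimage_bigcup; apply: bigcup_measurable => k _.
Qed.

Definition rV_cons n (p : R * 'rV[R]_n) : 'rV[R]_n.+1 :=
  \row_(i < n.+1) oapp (fun j => p.2 ord0 j) p.1 (unlift ord0 i).

Definition rV_uncons n (x : 'rV[R]_n.+1) : R * 'rV[R]_n :=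
  (x ord0 ord0, \row_(j < n) x ord0 (lift ord0 j)).

Lemma rV_consK n : cancel (@rV_cons n) (@rV_uncons n).
Proof.
case=> t x; congr pair; first by rewrite mxE unlift_none.
by apply/rowP => j; rewrite !mxE liftK.
Qed.

Lemma rV_unconsK n : cancel (@rV_uncons n) (@rV_cons n).
Proof.
move=> x; apply/rowP => i; rewrite mxE.
by case: unliftP => [j|] ->; rewrite /= ?mxE.
Qed.

Lemma measurable_rV_cons n : measurable_fun setT (@rV_cons n).
Proof.
apply: measurable_fun_rV => i.
under eq_fun do rewrite mxE.
case: (unlift ord0 i) => [j|] /=; last exact: measurable_fst.
exact: (measurableT_comp (measurable_coord j) measurable_snd).
Qed.

Lemma measurable_rV_uncons n : measurable_fun setT (@rV_uncons n).
Proof.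
apply/measurable_fun_pair; first exact: measurable_coord.
apply: measurable_fun_rV => i; under eq_fun do rewrite mxE.
exact: measurable_coord.
Qed.

End measurable_rV_theory.

(* The sigma-finiteness instance of the product measure is not inferred by the
   library (only its measure instance is). *)
Lemma product_sigma_finite (R : realType) d1 d2
    (T1 : measurableType d1) (T2 : measurableType d2)
    (m1 : {sigma_finite_measure set T1 -> \bar R})
    (m2 : {sigma_finite_measure set T2 -> \bar R}) :
  sigma_finite setT (m1 \x m2)%E.
Proof.
have /sigma_finiteP[F [TF ndF Foo]] := sigma_finiteT m1.
have /sigma_finiteP[G [TG ndG Goo]] := sigma_finiteT m2.
exists (fun n => F n `*` G n).
  rewrite -setXTT TF TG predeqE => -[x y]; split.
    move=> [/= [n _ Fnx] [k _ Gky]]; exists (maxn n k) => //; split.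
    - by move: x Fnx; exact/subsetPset/ndF/leq_maxl.
    - by move: y Gky; exact/subsetPset/ndG/leq_maxr.
  by move=> [n _ []/= ? ?]; split; exists n.
move=> k; have [? ?] := Foo k; have [? ?] := Goo k.
split; first exact: measurableX.
by rewrite product_measure1E// lte_mul_pinfty// ge0_fin_numE.
Qed.

Section lebesgue_rV_step.
Local Open Scope ereal_scope.
Context {R : realType} {n : nat}.
Variable mu : {sigma_finite_measure set 'rV[R]_n -> \bar R}.

Definition lebesgue_rV_step : set 'rV[R]_n.+1 -> \bar R :=
  pushforward (@lebesgue_measure R \x mu) (@rV_cons R n).

Let step0 : lebesgue_rV_step set0 = 0.
Proof. by rewrite /lebesgue_rV_step /pushforward preimage_set0 measure0. Qed.

Let step_ge0 A : 0 <= lebesgue_rV_step A.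
Proof.
by rewrite /lebesgue_rV_step /pushforward measure_ge0.
Qed.

Let step_sigma_additive : semi_sigma_additive lebesgue_rV_step.
Proof.
apply: measure_semi_sigma_additive; exact: measurable_rV_cons.
Qed.

HB.instance Definition _ := isMeasure.Build _ _ _
  lebesgue_rV_step step0 step_ge0 step_sigma_additive.

Let step_sigma_finite : sigma_finite setT lebesgue_rV_step.
Proof.
have [F FT Foo] := product_sigma_finite (@lebesgue_measure R) mu.
exists (fun k => @rV_uncons R n @^-1` F k).
  by rewrite -preimage_bigcup -FT preimage_setT.
move=> k; have [mF Fk] := Foo k; split.
  by rewrite -[X in measurable X]setTI; exact: measurable_rV_uncons.
rewrite /lebesgue_rV_step /pushforward -comp_preimage.
by rewrite (_ : _ \o _ = id) ?preimage_id//; apply/funext => p; exact: rV_consK.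
Qed.

HB.instance Definition _ := Measure_isSigmaFinite.Build _ _ _
  lebesgue_rV_step step_sigma_finite.

End lebesgue_rV_step.

Fixpoint lebesgue_rV {R : realType} (n : nat) :
    {sigma_finite_measure set 'rV[R]_n -> \bar R} :=
  match n with
  | 0 => \d_ (0 : 'rV[R]_0)
  | m.+1 => lebesgue_rV_step (lebesgue_rV m)
  end.

Lemma lebesgue_rV_box (R : realType) n (A : 'I_n -> set R) :
  (forall i, measurable (A i)) ->
  lebesgue_rV n [set x | forall i, A i (x ord0 i)]
  = (\prod_(i < n) lebesgue_measure (A i))%E.
Proof.
elim: n A => [|n IH] A mA.
  by rewrite big_ord0 /= diracE mem_set// => -[].
have mB : measurable [set x : 'rV[R]_n | forall i, A (lift ord0 i) (x ord0 i)].
  rewrite (_ : mkset _ = \bigcap_(i in [set: 'I_n])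
      (fun x : 'rV[R]_n => x ord0 i) @^-1` A (lift ord0 i)); last first.
    by apply/seteqP; split => x /= Ax i; [move=> _|]; exact: Ax.
  apply: fin_bigcap_measurable => // i _.
  by rewrite -[X in measurable X]setTI; exact: measurable_coord.
rewrite big_ord_recl -IH; last by move=> i; exact: mA.
rewrite /= /lebesgue_rV_step /pushforward -product_measure1E//.
congr ((_ \x _)%E _); apply/seteqP; split => -[t x] /=.
  move=> Ax; split; first by have := Ax ord0; rewrite mxE unlift_none.
  by move=> i; have := Ax (lift ord0 i); rewrite mxE liftK.
by move=> [A0 Ax] i; rewrite mxE; case: unliftP => [j|] ->.
exact: mA.
Qed.

Definition orthant (R : realType) (d : nat) : set 'rV[R]_d :=
  [set x | forall i, 0 < x ord0 i].
Arguments orthant R d : clear implicits.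

(** The norm of ['rV[R]_d] is the sup norm, hence an explicit definition of
    Euclidean balls. *)
Definition euclidean_ball (R : realType) (d : nat) (c : 'rV[R]_d) (r : R) :
    set 'rV[R]_d :=
  [set x | Num.sqrt (\sum_(i < d) (x ord0 i - c ord0 i) ^+ 2) < r].

Definition multi_size (d : nat) (n : {ffun 'I_d -> nat}) : nat :=
  \sum_(i < d) n i.

Section distributions.
Context {R : realType} {d : nat}.
Local Notation V := 'rV[R]_d.
Implicit Types (phi psi : V -> R) (T : (V -> R) -> R).

Definition partial (i : 'I_d) (f : V -> R) : V -> R :=
  fun x => 'D_(delta_mx ord0 i) f x.

Definition partials (s : seq 'I_d) (f : V -> R) : V -> R := foldr partial f s.

Definition smooth (f : V -> R) : Prop :=
  forall s x, differentiable (partials s f) x.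

Definition schwartz phi : Prop :=
  smooth phi /\
  forall (k : nat) (s : seq 'I_d), exists M : R,
    forall x, (1 + `|x|) ^+ k * `|partials s phi x| <= M.

(** A distribution is a functional on all functions of which only the values at
    Schwartz functions are ever constrained or used. *)
Definition tempered T : Prop :=
  (forall (a : R) phi psi, schwartz phi -> schwartz psi ->
    T (fun x => a * phi x + psi x) = a * T phi + T psi) /\
  exists (N : nat) (C : R), forall phi (M : R), schwartz phi ->
    (forall (k : nat) (s : seq 'I_d) x, (k <= N)%N -> (size s <= N)%N ->
      (1 + `|x|) ^+ k * `|partials s phi x| <= M) ->
    `|T phi| <= C * M.

(** [(T * phi_t) (x)], where [phi_t (y) = t^-d phi (y / t)]. *)
Definition dilated_convolution T phi (t : R) (x : V) : R :=
  T (fun y => t ^- d * phi (t^-1 *: (x - y))).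

Definition maximal_function T phi (x : V) : \bar R :=
  ereal_sup [set (`|dilated_convolution T phi t x|)%:E | t in [set t | 0 < t]].

(** Fefferman-Stein: the maximal function of [T] with respect to some Schwartz
    function of nonzero integral is in [L^p]. *)
Definition hardy (p : R) T : Prop :=
  tempered T /\
  exists phi, [/\ schwartz phi, \int[lebesgue_rV d]_x phi x != 0
    & ('N[lebesgue_rV d]_(p%:E)[maximal_function T phi] < +oo)%E].

Definition supported_in (K : set V) T : Prop :=
  forall phi, smooth phi -> compact (closure [set x | phi x != 0]) ->
    closure [set x | phi x != 0] `&` K = set0 -> T phi = 0.

(** The elements of [H^p] of the orthant are kept as distributions on [R^d]:
    for [p < 1] and [d >= 2] distributions carried by the boundary, such as
    differences of two Dirac masses, may belong to [H^p(R^d)]; they vanish on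
    the open orthant but not against the Laguerre functions. *)
Definition hardy_orthant (p : R) T : Prop :=
  hardy p T /\ supported_in (closure (orthant R d)) T.

End distributions.

Section atoms.
Context {R : realType} {d : nat}.
Local Notation V := 'rV[R]_d.
Local Notation mu := (lebesgue_rV d).

Definition moment_order (p : R) : nat := Num.truncn (d%:R * (p^-1 - 1)).

(** For [q = +oo], [(fine q)^-1 = 0^-1 = 0], which is the intended [1 / q]. *)
Definition atom (p : R) (q : \bar R) (a : V -> R) : Prop :=
  measurable_fun setT a /\
  exists (c : V) (r : R), let B := euclidean_ball c r in
  [/\ 0 < r,
      forall x, ~ B x -> a x = 0,
      ('N[mu]_q[EFin \o a] <= mu B `^ ((fine q)^-1 - p^-1))%E
    & forall m : {ffun 'I_d -> nat}, (multi_size m <= moment_order p)%N ->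
        \int[mu]_(x in B) (a x * \prod_(i < d) x ord0 i ^+ m i) = 0].

(** [v = sum_j l_j int_X a_j g], with [X] the orthant. *)
Definition atomic_sum (l : R^nat) (a : nat -> V -> R) (g : V -> R) (v : R)
    : Prop :=
  series (fun j => l j * \int[mu]_(x in orthant R d) (a j x * g x)) @ \oo --> v.

Definition coef_mass (p : R) (l : R^nat) : \bar R :=
  (\sum_(0 <= j <oo) (`|l j| `^ p)%:E)%E.

(** [T = sum_j l_j a_j] as tempered distributions on [R^d], with atoms [a_j]
    supported in the orthant. *)
Definition atomic_decomposition (p : R) (q : \bar R) (T : (V -> R) -> R)
    (l : R^nat) (a : nat -> V -> R) : Prop :=
  [/\ forall j, atom p q (a j),
      forall j x, ~ orthant R d x -> a j x = 0,
      (coef_mass p l < +oo)%E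
    & forall phi, schwartz phi -> atomic_sum l a phi (T phi)].

Definition hardy_norm (p : R) (q : \bar R) (T : (V -> R) -> R) : \bar R :=
  ereal_inf [set (coef_mass p la.1 `^ p^-1)%E | la in
    [set la : R^nat * (nat -> V -> R) | atomic_decomposition p q T la.1 la.2]].

(** The value does not depend on the decomposition when [g] is the restriction
    to the orthant of a function in the Lipschitz space of order
    [d (1/p - 1)]. *)
Definition hardy_pairing (p : R) (q : \bar R) (T : (V -> R) -> R) (g : V -> R)
    : R :=
  get [set v | exists l a, atomic_decomposition p q T l a /\
                           atomic_sum l a g v].

End atoms.

Section laguerre.
Context {R : realType}.

Definition gamma_function (x : R) : R :=
  \int[lebesgue_measure]_(t in `]0, +oo[) (t `^ (x - 1) * expR (- t)).

(** [L_k^a (u) = sum_(j <= k) (-1)^j binom(k + a, k - j) u^j / j!], where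
    [binom(k + a, k - j) = (a + j + 1) ... (a + k) / (k - j)!]. *)
Definition laguerre_poly (k : nat) (a : R) : {poly R} :=
  \poly_(j < k.+1)
    ((-1) ^+ j * (\prod_(j <= i < k) (a + i.+1%:R)) / ((k - j)`! * j`!)%:R).

Definition laguerre1 (k : nat) (a u : R) : R :=
  Num.sqrt (gamma_function (k%:R + 1) / gamma_function (k%:R + a + 1))
  * (laguerre_poly k a).[u] * expR (- (u / 2)) * u `^ (a / 2).

Definition laguerre (d : nat) (n : {ffun 'I_d -> nat}) (alpha : 'I_d -> R)
    (x : 'rV[R]_d) : R :=
  \prod_(i < d) laguerre1 (n i) (alpha i) (x ord0 i).

Definition laguerre_sum (d : nat) (p : R) (q : \bar R) (s : R)
    (alpha : 'I_d -> R) (E : R) (f : ('rV[R]_d -> R) -> R) : \bar R :=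
  (\esum_(n in [set: {ffun 'I_d -> nat}])
    (`|hardy_pairing p q f (laguerre n alpha)| `^ s
     / ((multi_size n).+1%:R `^ E))%:E)%E.

End laguerre.

(* Main.v *)
Require Import Defs.
From mathcomp Require Import all_boot all_order all_algebra.
From mathcomp Require Import all_classical all_reals all_analysis.
From mathcomp Require Import measurable_realfun ess_sup_inf.
From mathcomp Require Import ring lra.

Set Implicit Arguments.
Unset Strict Implicit.
Unset Printing Implicit Defensive.

Import Order.TTheory GRing.Theory Num.Theory.
Import numFieldNormedType.Exports.

Local Open Scope classical_set_scope.
Local Open Scope ring_scope.

(** Write [ka = d (1/p - 1)], which is positive because [p < 1].

    Upper bound. Each one-dimensional Laguerre function is [g ((k + 1) u)] with
    [g] bounded in a Hoelder class of order [P + th > ka] uniformly in [k].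
    Subtracting a Taylor polynomial, which an atom [a] of radius [r] does not
    see, gives
      [|<a, L_n>| <= C min (r^-ka, r^(P + th - ka) (|n| + 1)^(P + th))].
    The [s]-th powers of these, divided by [(|n| + 1)^(d + s ka)], have a sum
    bounded independently of [r]: the first bound is summed over
    [|n| > 1/r] and the second one over [|n| < 1/r]. Since [p <= s], sums of
    atoms with [l^p] coefficients inherit the estimate.

    The pairing does not depend on the atomic decomposition: [L_n] multiplied by
    [prod_i exp (- e / x_i)] extends to a Schwartz function, has pairings with
    atoms bounded uniformly in [e], and converges to [L_n] on the orthant as
    [e] tends to [0].

    Sharpness. Let [b] be a high derivative of [(1 - y)^A y^A], cut off outside
    [0 <= y <= 1]; then [prod_i b (x_i / r)] is, up to a factor of size
    [r^(-d/p)], an atom. If [r = delta / (2 m)] and [m <= n_i < 2 m] with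
    [delta] small, the first nonvanishing term of the power series of [L_n]
    dominates, so the pairing is at least [c r^-ka]. These [m^d] indices
    contribute at least [c' m^(d + s ka - E')], which is unbounded in [m] (for
    [E' >= 0], to which the general case reduces). *)

(** * Uniform bounds for Laguerre polynomials *)

(** The condition on [alpha] is smoothness at the origin. In the variable [w = (k + 1) u] a Laguerre
    function is, up to a constant, [w^(a / 2)] times a function smooth up to [0]; the Hoelder bound
    of order [P + th] survives when the powers [w^(a / 2 - i)] end at a constant (even [a <= 2 P])
    or keep an exponent at least [th] up to [i = P]. Differentiation raises the order of the
    polynomial, so uniformity in [k] rests on one estimate for all real orders [b >= 0], [|L_k^b
    (u)| exp (- u / 2) <= C K^b (1 + K u)^(- b / 2)] with [K = k + 1], proved first for integer
    orders and interpolated by summation by parts. The Hoelder order must exceed [ka] strictly: the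
    excess is what bounds the sum over [|n| < 1 / r].

    In the sharpness part the test atom must annihilate polynomials, while [L_n] near [0] may itself
    be a power series. The derivative of order [Q + 1] of a bump annihilates the powers [0, ..., Q]
    and no other nonnegative real power, so some term of [L_n] survives; [Q] is taken beyond the
    moment order to bring the maximal function into [L^p]. *)

Section rising.
Context {R : realType}.
Implicit Types (v w : R) (n k : nat).

(** The coefficient of [x^n] in [(1 - x)^(- v)]. The generating functions of Laguerre polynomials of
    orders [b] and [b + v] differ by this power, so these numbers carry every change of order. *)
Definition rising v n : R := (\prod_(l < n) (v + l%:R)) / n`!%:R.

Lemma factR_neq0 n : n`!%:R != 0 :> R.
Proof. by rewrite pnatr_eq0 -lt0n fact_gt0. Qed.

Lemma rising0 v : rising v 0 = 1.
Proof. by rewrite /rising big_ord0 fact0 divr1. Qed.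

Lemma risingS v n : rising v n.+1 = rising v n * ((v + n%:R) / n.+1%:R).
Proof.
rewrite /rising big_ord_recr /= factS natrM mulrACA; congr (_ * _).
by rewrite -invfM mulrC; congr (_ * _)^-1; rewrite mulrC.
Qed.

Lemma risingSmul v n : n.+1%:R * rising v n.+1 = (v + n%:R) * rising v n.
Proof. by rewrite risingS mulrCA [n.+1%:R * _]mulrC divfK ?pnatr_eq0// mulrC. Qed.

Lemma rising_gt0 v n : 0 < v -> 0 < rising v n.
Proof.
move=> v0; elim: n => [|n IH]; first by rewrite rising0.
rewrite risingS mulr_gt0// divr_gt0// ?ltr0n//.
by rewrite ltr_wpDr.
Qed.

Lemma rising_ge0 v n : 0 <= v -> 0 <= rising v n.
Proof.
move=> v0; elim: n => [|n IH]; first by rewrite rising0.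
by rewrite risingS mulr_ge0// divr_ge0// addr_ge0.
Qed.

Lemma rising1 n : rising 1 n = 1.
Proof.
elim: n => [|n IH]; first by rewrite rising0.
by rewrite risingS IH mul1r nat1r divff.
Qed.

Lemma rising_shift v n : 0 < v -> rising (v + 1) n = rising v n * ((v + n%:R) / v).
Proof.
move=> v0; elim: n => [|n IH].
  by rewrite !rising0 addr0 divff ?gt_eqF// mulr1.
rewrite !risingS IH -natr1; field.
by rewrite natr1 pnatr_eq0 /= gt_eqF.
Qed.

(** Compares coefficients in [(1 - x)^(- v) (1 - x)^(- w)]. The induction splits [n.+1] as
    [i + (n.+1 - i)] and lowers one index in each half by [risingSmul]. *)
Lemma rising_vandermonde v w n :
  rising (v + w) n = \sum_(i < n.+1) rising v i * rising w (n - i).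
Proof.
elim: n => [|n IH]; first by rewrite big_ord1 !rising0 mulr1.
have n0 : n.+1%:R != 0 :> R by rewrite pnatr_eq0.
apply: (mulfI n0); rewrite risingSmul.
transitivity (\sum_(i < n.+2) (i%:R + (n.+1 - i)%:R) *
    (rising v i * rising w (n.+1 - i))); last first.
  rewrite mulr_sumr; apply: eq_bigr => i _; congr (_ * _).
  by rewrite -natrD subnKC// -ltnS.
under eq_bigr do rewrite mulrDl.
rewrite big_split /= [X in _ = X + _]big_ord_recl [X in _ = _ + X]big_ord_recr /=.
rewrite mul0r add0r subnn mul0r addr0 -big_split /= IH mulr_sumr.
apply: eq_bigr => i _; rewrite /bump /= add1n subSS.
have ilen : (i <= n)%N by rewrite -ltnS.
rewrite subSn//.
transitivity ((i.+1%:R * rising v i.+1) * rising w (n - i) +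
  rising v i * ((n - i).+1%:R * rising w (n - i).+1)); last by ring.
rewrite !risingSmul natrB//.
ring.
Qed.

(** Young's inequality for the factors [(1 + x)^v] and [1] with conjugate exponents [v^-1] and
    [(1 - v)^-1]; the endpoints [v = 0, 1] have no such exponents. *)
Lemma bernoulli_powR_le (v x : R) : 0 <= v <= 1 -> -1 <= x ->
  (1 + x) `^ v <= 1 + v * x.
Proof.
move=> /andP[v0 v1] x1.
have [->|vn0] := eqVneq v 0; first by rewrite powRr0 mul0r addr0.
have [->|vn1] := eqVneq v 1; first by rewrite powRr1 ?mul1r//; lra.
have vp : 0 < v by rewrite lt_neqAle eq_sym vn0.
have vl : v < 1 by rewrite lt_neqAle vn1.
have := @conjugate_powR R ((1 + x) `^ v) 1 v^-1 (1 - v)^-1.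
rewrite powR_ge0 ler01 !invrK !invr_gt0 vp subr_gt0 vl powR1 mulr1.
move=> /(_ isT isT isT isT); rewrite addrC subrK => /(_ erefl) /le_trans; apply.
rewrite -powRrM divff ?gt_eqF// powRr1; lra.
Qed.

Lemma rising_asymp01 v : 0 <= v <= 1 -> forall n,
  (n.+1%:R) `^ v <= rising (v + 1) n <= 2 * (n.+1%:R) `^ v.
Proof.
move=> /andP[v0 v1] n; apply/andP; split.
  elim: n => [|n IH]; first by rewrite rising0 powR1.
  rewrite risingS.
  have -> : n.+2%:R = n.+1%:R * (1 + n.+1%:R^-1) :> R.
    by rewrite mulrDr mulr1 divff// natr1.
  rewrite powRM ?addr_ge0//; apply: ler_pM; rewrite ?powR_ge0//.
  apply: le_trans (bernoulli_powR_le _ _) _; rewrite ?v0//.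
    by apply: (@le_trans _ _ 0); [lra|].
  rewrite -addrA nat1r mulrDl divff// addrC//.
(* Relative to [(n + 1)^v] the sequence increases, so the induction is run at index [m + 1] against
   the smaller [(m + 1)^v], where the ratio decreases: the step becomes [(1 + v y) (1 - y)^v <= 1]
   with [y = 1 / (m + 2)]. *)
have H : forall m : nat, rising (v + 1) m.+1 <= 2 * (m.+1%:R) `^ v.
  elim=> [|m IH].
    by rewrite risingS rising0 mul1r divr1 addr0 powR1 mulr1; lra.
  rewrite risingS.
  have E : m.+2%:R = m.+1%:R * (1 - m.+2%:R^-1)^-1 :> R.
    rewrite -(natr1 m.+1); have : 0 < m.+1%:R :> R by rewrite ltr0n.
    move: (m.+1%:R : R) => y y0; field.
    by rewrite -addrA subrr addr0 !gt_eqF//; lra.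
  have h0 : 0 <= 1 - m.+2%:R^-1 :> R by rewrite subr_ge0 invf_le1// ler1n.
  rewrite [X in _ <= 2 * (X `^ v)]E powRM ?invr_ge0// [leRHS]mulrA; apply: ler_pM => //.
  - by apply: rising_ge0; lra.
  - by apply: divr_ge0 => //; apply: addr_ge0 => //; lra.
  rewrite -[(1 - _)^-1]powR_inv1// powRAC powR_inv1 ?powR_ge0//.
  have i0 : 0 < m.+2%:R^-1 :> R by rewrite invr_gt0.
  have i1 : m.+2%:R^-1 <= 2^-1 :> R by rewrite lef_pV2 ?posrE// ler_nat.
  have -> : (v + 1 + m.+1%:R) / m.+2%:R = 1 + v * m.+2%:R^-1.
    rewrite -(natr1 m.+1); have : 0 < m.+1%:R :> R by rewrite ltr0n.
    by move: (m.+1%:R : R) => y y0; field; rewrite gt_eqF//; lra.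
  move: (m.+2%:R^-1 : R) i0 i1 {E h0} => y i0 i1.
  have B : (1 - y) `^ v <= 1 - v * y.
    by rewrite -mulrN; apply: bernoulli_powR_le; [rewrite v0|lra].
  have p0 : 0 < (1 - y) `^ v by apply: powR_gt0; lra.
  rewrite -[leRHS]mul1r ler_pdivlMr//.
  have vy : 0 <= v * y by apply: mulr_ge0 => //; exact: ltW.
  apply: le_trans (ler_wpM2l _ B) _; first by lra.
  have := sqr_ge0 (v * y); lra.
case: n => [|n].
  by rewrite rising0 powR1; lra.
apply: le_trans (H n) _; rewrite ler_pM2l//.
by apply: ge0_ler_powR; rewrite ?nnegrE// ler_nat.
Qed.

(** Induction on the integer part of [v]: [rising_shift] raises the exponent by one at the price of
    the factor [(v + n) / v], which is comparable to [n + 1]. *)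
Lemma rising_asymp v : 0 <= v -> exists c C : R, [/\ 0 < c, 0 < C & forall n,
  c * (n.+1%:R) `^ v <= rising (v + 1) n <= C * (n.+1%:R) `^ v].
Proof.
have [m] := ubnP (Num.truncn v).
elim: m v => // m IH v /ltnSE vm v0.
have [v1|v1] := leP v 1.
  exists 1, 2; split => // n; rewrite mul1r.
  by apply: rising_asymp01; rewrite v0.
have [] := IH (v - 1); last first.
- move=> c [C [c0 C0 H]]; exists (c / v), C; split => // [|n].
    by rewrite divr_gt0//; lra.
  have := H n; rewrite subrK => /andP[H1 H2].
  have vp : 0 < v by lra.
  rewrite rising_shift//.
  have -> : n.+1%:R `^ v = n.+1%:R `^ (v - 1) * n.+1%:R.
    by rewrite mulrC mulr_powRB1.
  rewrite [X in _ && (_ <= X)]mulrA; apply/andP; split.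
    have -> : c / v * (n.+1%:R `^ (v - 1) * n.+1%:R) =
        c * n.+1%:R `^ (v - 1) * (n.+1%:R / v) by ring.
    apply: ler_pM => //; first by rewrite mulr_ge0 ?powR_ge0// ltW.
      by rewrite divr_ge0// ltW.
    by rewrite ler_pM2r ?invr_gt0// -nat1r; lra.
  apply: ler_pM => //.
  - by apply: rising_ge0; lra.
  - by rewrite divr_ge0// ?addr_ge0//; lra.
  rewrite ler_pdivrMr// -nat1r mulrDl mul1r lerD2l ler_peMr//; lra.
- by lra.
- have := truncn_le (v - 1); rewrite subr_ge0 (ltW v1) => a.
  apply: leq_trans vm; rewrite -ltnS -(@ltr_nat R) -natr1.
  apply: le_lt_trans (truncnS_gt v); lra.
Qed.

Lemma rising_le_decay v : 0 < v <= 1 -> forall n,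
  rising v n <= 2 * (n.+1%:R) `^ (v - 1).
Proof.
move=> /andP[v0 v1] n.
have /andP[_ H] := @rising_asymp01 v (introT andP (conj (ltW v0) v1)) n.
have -> : n.+1%:R `^ (v - 1) = n.+1%:R `^ v / n.+1%:R.
  by rewrite powRB ?powRr1//; apply/implyP.
move: H; rewrite rising_shift// => H.
rewrite mulrA ler_pdivlMr//; apply: le_trans H.
rewrite ler_wpM2l ?rising_ge0 ?(ltW v0)// ler_pdivlMr// -nat1r.
rewrite mulrDl mul1r lerD2l ler_piMr//.
Qed.

Lemma rising_nonincreasing v n : 0 < v <= 1 -> rising v n.+1 <= rising v n.
Proof.
move=> /andP[v0 v1]; rewrite risingS ler_piMr ?rising_ge0 ?(ltW v0)//.
by rewrite ler_pdivrMr// mul1r -nat1r lerD2r.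
Qed.

End rising.

(** * Change of order and differentiation of Laguerre polynomials *)

Section laguerre_algebra.
Context {R : realType}.
Implicit Types (a b u v : R) (k m n : nat).

Lemma rising_pascal v n :
  rising (v + 1) n.+1 = rising v n.+1 + rising (v + 1) n.
Proof.
rewrite addrC !rising_vandermonde big_ord_recl rising0 mul1r; congr (_ + _).
by apply: eq_bigr => i _; rewrite !rising1 lift0 subSS.
Qed.

Definition lag k b u : R := (laguerre_poly k b).[u].

(** The binomial coefficient in [laguerre_poly] is written as a [rising], so that changes of order
    become instances of [rising_vandermonde]. *)
Let lc b k j : R := if (j <= k)%N then
  (-1) ^+ j * rising (b + j.+1%:R) (k - j) / j`!%:R else 0.

Let coef_lag k b j : (laguerre_poly k b)`_j = lc b k j.
Proof.
rewrite coef_poly ltnS /lc; case: leqP => // jk.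
have -> : \prod_(j <= i < k) (b + i.+1%:R) =
    \prod_(i < k - j) (b + j.+1%:R + i%:R).
  rewrite -[X in \prod_(X <= _ < _) _]add0n big_addn big_mkord.
  by apply: eq_bigr => i _; rewrite -addrA -natrD addSn addnC.
by rewrite /rising natrM invfM !mulrA.
Qed.

Let lagE k b u n : (k < n)%N -> lag k b u = \sum_(j < n) lc b k j * u ^+ j.
Proof.
move=> kn; rewrite /lag (@horner_coef_wide _ n).
  by apply: eq_bigr => i _; rewrite coef_lag.
by apply: leq_trans kn; exact: size_poly.
Qed.

Lemma lag0 b u : lag 0 b u = 1.
Proof. by rewrite (@lagE _ _ _ 1)// big_ord1 /lc /= rising0 fact0; field. Qed.

(** The generating function of [lag k b u] is [(1 - x)^(- b - 1) exp (- x u / (1 - x))], so adding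
    [v] to the order multiplies it by [(1 - x)^(- v)]. For [v >= 0] the coefficients are
    nonnegative, and estimates pass from order [a] to order [a + v]. *)
Lemma lagD k a v u :
  lag k (a + v) u = \sum_(i < k.+1) rising v i * lag (k - i) a u.
Proof.
rewrite (@lagE _ _ _ k.+1)//.
under [RHS]eq_bigr => i _ do
  rewrite (@lagE (k - i) _ _ k.+1) ?ltnS ?leq_subr// mulr_sumr.
rewrite exchange_big /=; apply: eq_bigr => j _.
have jk : (j <= k)%N by rewrite -ltnS.
under eq_bigr do rewrite mulrA.
rewrite -mulr_suml; congr (_ * _); rewrite {1}/lc jk.
rewrite (_ : a + v + _ = v + (a + j.+1%:R)); last by rewrite addrAC addrC.
rewrite rising_vandermonde mulr_sumr mulr_suml.
rewrite (big_ord_widen_cond k.+1 xpredT (fun i => (-1) ^+ j *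
  (rising v i * rising (a + j.+1%:R) (k - j - i)) / j`!%:R)) ?ltnS ?leq_subr//=.
rewrite big_mkcond /=; apply: eq_bigr => i _; rewrite ltnS /lc.
have ik : (i <= k)%N by rewrite -ltnS.
rewrite leq_subRL// [(j <= _)%N]leq_subRL// addnC.
case: ifP => _; last by rewrite mulr0.
by rewrite subnAC; ring.
Qed.

Lemma lagS k b u : lag k.+1 (b + 1) u = lag k.+1 b u + lag k (b + 1) u.
Proof.
rewrite !lagD big_ord_recl rising0 mul1r subn0; congr (_ + _).
by apply: eq_bigr => i _; rewrite !rising1 lift0 subSS.
Qed.

(** The derivative is also [- L_(k-1)^(b+1)]; in the present form the degree stays fixed and only
    the order grows, as suits estimates whose scale depends on [k]. *)
Lemma is_derive_lag k b u :
  is_derive u 1 (lag k b) (lag k b u - lag k (b + 1) u).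
Proof.
suff H : (laguerre_poly k b)^`() = laguerre_poly k b - laguerre_poly k (b + 1).
  by rewrite /lag -hornerN -hornerD -H; exact: is_derive_poly.
apply/polyP => j; rewrite coef_deriv coefB !coef_lag /lc.
have [jk|kj] := ltnP j k; last first.
  rewrite mul0rn; case: ifP => jk; last by rewrite subr0.
  have -> : j = k by apply/eqP; rewrite eqn_leq jk kj.
  by rewrite subnn !rising0 subrr.
rewrite (ltnW jk) -[(k - j)%N]prednK ?subn_gt0// -subnS.
rewrite [b + 1 + _]addrAC rising_pascal -[LHS]mulr_natr factS natrM exprS.
have -> : b + j.+2%:R = b + j.+1%:R + 1 :> R by rewrite -addrA natr1.
rewrite mulN1r; field.
by rewrite factR_neq0 nat1r pnatr_eq0.
Qed.

End laguerre_algebra.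

(* For integer [m], [L_k^m (u)] is the value at [k + m] of the Charlier
   polynomial of degree [k] for the weights [u^l / l!]; its bound is one term of
   the norm identity [sum_l w l * P n l ^ 2 = e^u u^n / n!]. *)
Section charlier.
Context {R : realType}.
Variable u : R.
Hypothesis u_ge0 : 0 <= u.

Let P n l : R := \sum_(j < n.+1) 'C(l, n - j)%:R * (- u) ^+ j / j`!%:R.
Let w l : R := u ^+ l / l`!%:R.

Let PS n l : n.+1%:R * P n.+1 l = l%:R * P n l.-1 - u * P n l.
Proof.
transitivity (\sum_(j < n.+2) (n.+1 - j)%:R * ('C(l, n.+1 - j)%:R * (- u) ^+ j / j`!%:R)
  + \sum_(j < n.+2) j%:R * ('C(l, n.+1 - j)%:R * (- u) ^+ j / j`!%:R)).
  rewrite mulr_sumr -big_split /=; apply: eq_bigr => j _.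
  by rewrite -mulrDl -natrD subnK// -ltnS.
rewrite [X in X + _]big_ord_recr [X in _ + X]big_ord_recl /= subnn !mul0r.
rewrite addr0 add0r -mulNr !mulr_sumr; congr (_ + _); apply: eq_bigr => j _.
  have jn : (j <= n)%N by rewrite -ltnS.
  by rewrite subSn// !mulrA -!natrM -mul_bin_diag.
rewrite (_ : bump 0 j = j.+1)// subSS exprS factS natrM.
by field; rewrite factR_neq0 nat1r pnatr_eq0.
Qed.

Let Pdiff n l : P n.+1 l.+1 - P n.+1 l = P n l.
Proof.
rewrite /P [X in X - _]big_ord_recr [X in _ - X]big_ord_recr /= !subnn !bin0.
rewrite opprD addrACA subrr addr0 -sumrB; apply: eq_bigr => j _.
have jn : (j <= n)%N by rewrite -ltnS.
by rewrite subSn// binS natrD -!mulrBl [_ - _]addrC addrA addNr add0r.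
Qed.

Let S n M : R := \sum_(l < M) w l * P n l ^+ 2.

Let wS l : w l.+1 * l.+1%:R = u * w l.
Proof.
by rewrite /w exprS factS natrM; field; rewrite factR_neq0 nat1r pnatr_eq0.
Qed.

(** Summation by parts: [PS] is multiplied by [w l * P n.+1 l] and summed, [wS] shifts the index in
    the first half, and [Pdiff] collapses the difference to [P n l], apart from one boundary term at
    [M]. *)
Let SS n M : n.+1%:R * S n.+1 M.+1 = u * (S n M - w M * P n M * P n.+1 M).
Proof.
rewrite /S mulr_sumr.
transitivity (\sum_(l < M.+1) (w l * l%:R * P n l.-1 * P n.+1 l
    - u * (w l * P n l * P n.+1 l))).
  apply: eq_bigr => l _.
  transitivity (w l * P n.+1 l * (n.+1%:R * P n.+1 l)); first by ring.
  by rewrite PS; ring.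
rewrite sumrB big_ord_recl /= mulr0 !mul0r add0r.
rewrite -mulr_sumr [X in _ - u * X]big_ord_recr /= mulrDr opprD addrA mulrBr.
congr (_ - _); rewrite !mulr_sumr -sumrB; apply: eq_bigr => l _.
rewrite (_ : bump 0 l = l.+1)//= wS.
transitivity (u * (w l * P n l * (P n.+1 l.+1 - P n.+1 l))); first by ring.
by rewrite Pdiff; ring.
Qed.

Let P_le n l : `|P n l| <= 2 ^+ l * expR u.
Proof.
apply: le_trans (ler_norm_sum _ _ _) _.
apply: (@le_trans _ _ (2 ^+ l * \sum_(j < n.+1) u ^+ j / j`!%:R)); last first.
  rewrite ler_pM2l ?exprn_gt0//.
  have := nondecreasing_cvgn_le _ (is_cvg_series_exp_coeff u) n.+1.
  rewrite /= /expR /exp_coeff /series /= big_mkord; apply.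
  apply/nondecreasing_seqP => i; rewrite /= big_nat_recr//= lerDl.
  by apply: divr_ge0 => //; exact: exprn_ge0.
rewrite mulr_sumr ler_sum// => j _.
rewrite !normrM normfV !normr_nat normrX normrN (ger0_norm u_ge0) -mulrA.
rewrite ler_wpM2r//; first by rewrite divr_ge0// exprn_ge0.
rewrite -natrX ler_nat.
have [jl|lj] := leqP (n - j) l; last by rewrite bin_small.
have := @expnDn 1 1 l; rewrite addn1 => ->.
rewrite (bigD1 (Ordinal (_ : (n - j < l.+1)%N)))//= !exp1n !muln1.
exact: leq_addr.
Qed.

(** The boundary term of [SS] vanishes in the limit: each polynomial factor is at most of order
    [2^M], against [M!] in the weight. *)
Let wPP n : (fun M => w M * P n M * P n.+1 M) @ \oo --> (0 : R).
Proof.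
have h : (fun M => (4 * u) ^+ M / M`!%:R * expR (2 * u)) @ \oo --> (0 : R).
  rewrite -(mul0r (expR (2 * u))); apply: cvgMl.
  exact: (cvg_series_cvg_0 (is_cvg_series_exp_coeff (4 * u))).
apply/norm_cvg0P; apply: (squeeze_cvgr _ _ h); last exact: cvg_cst.
near=> M; rewrite normr_ge0 /= [`|_ * P n.+1 M|]normrM [`|_ * P n M|]normrM.
have -> : `|w M| = u ^+ M / M`!%:R.
  by rewrite ger0_norm// divr_ge0// exprn_ge0.
have -> : (4 * u) ^+ M / M`!%:R * expR (2 * u) =
   u ^+ M / M`!%:R * (2 ^+ M * expR u) * (2 ^+ M * expR u).
  have -> : 4 = 2 * 2 :> R by ring.
  have -> : expR (2 * u) = expR u * expR u by rewrite -expRD; congr expR; ring.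
  by rewrite !exprMn; ring.
apply: ler_pM => //; first by rewrite mulr_ge0// divr_ge0// exprn_ge0.
by apply: ler_wpM2l => //; rewrite divr_ge0// exprn_ge0.
Unshelve. all: by end_near. Qed.

Let S_cvg n : S n @ \oo --> expR u * u ^+ n / n`!%:R.
Proof.
elim: n => [|n IH].
  rewrite fact0 expr0 mulr1 divr1.
  have -> : S 0 = series (exp_coeff u).
    apply/funext => M; rewrite /S /series /= big_mkord; apply: eq_bigr => l _.
    by rewrite /P big_ord1 bin0 expr0 fact0 divr1 mulr1 expr1n mulr1.
  exact: is_cvg_series_exp_coeff.
rewrite -(cvg_shiftS (S n.+1)) /=.
have -> : (fun M => S n.+1 M.+1) =
    (fun M => u / n.+1%:R * (S n M - w M * P n M * P n.+1 M)).
  apply/funext => M; have n0 : n.+1%:R != 0 :> R by rewrite pnatr_eq0.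
  by apply: (mulfI n0); rewrite SS; field; rewrite addrC natr1.
have -> : expR u * u ^+ n.+1 / n.+1`!%:R =
    u / n.+1%:R * (expR u * u ^+ n / n`!%:R - 0).
  by rewrite subr0 exprS factS natrM; field; rewrite factR_neq0 nat1r pnatr_eq0.
by apply: cvgMr; apply: cvgB.
Qed.

Let term_le n l : w l * P n l ^+ 2 <= expR u * u ^+ n / n`!%:R.
Proof.
have nd : nondecreasing_seq (S n).
  apply/nondecreasing_seqP => i; rewrite /S big_ord_recr /= lerDl mulr_ge0 ?sqr_ge0//.
  by rewrite divr_ge0// exprn_ge0.
have := nondecreasing_cvgn_le nd (cvgP _ (@S_cvg n)) l.+1.
rewrite (cvg_lim _ (@S_cvg n))//; apply: le_trans.
rewrite /S big_ord_recr /= lerDr sumr_ge0// => i _.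
by rewrite mulr_ge0 ?sqr_ge0// divr_ge0// exprn_ge0.
Qed.

Let binR (m k : nat) : 'C(m + k, k)%:R = rising (m%:R + 1) k :> R.
Proof.
elim: k => [|k IH]; first by rewrite bin0 rising0.
rewrite risingS -IH.
apply: (@mulIf _ k.+1%:R); first by rewrite pnatr_eq0.
rewrite -mulrA divfK ?pnatr_eq0// -addrA nat1r -natrD -!natrM.
by rewrite mulnC -mul_bin_diag addnS mulnC.
Qed.

Let lagP (k m : nat) : lag k m%:R u = P k (k + m).
Proof.
rewrite /lag /laguerre_poly horner_poly; apply: eq_bigr => j _.
have jk : (j <= k)%N by rewrite -ltnS.
have -> : (k + m = (m + j) + (k - j))%N by rewrite -addnA subnKC// addnC.
rewrite binR [(- u) ^+ j]exprNn /rising.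
have -> : \prod_(j <= i < k) (m%:R + i.+1%:R : R) =
    \prod_(l < k - j) ((m + j)%:R + 1 + l%:R).
  rewrite -[X in \prod_(X <= _ < _) _]add0n big_addn big_mkord; apply: eq_bigr => i _.
  by rewrite -natr1 !natrD; ring.
by rewrite natrM; field; rewrite !factR_neq0.
Qed.

Lemma lag_nat_le (k m : nat) :
  u ^+ m * lag k m%:R u ^+ 2 * expR (- u) <= (k + m)`!%:R / k`!%:R.
Proof.
have [u0|u0] := eqVneq u 0; last first.
  have up : 0 < u by rewrite lt_neqAle eq_sym u0.
  have := term_le k (k + m); rewrite -lagP /w => H.
  have h1 : 0 < u ^+ k by rewrite exprn_gt0.
  rewrite expRN ler_pdivrMr ?expR_gt0//.
  have f : 0 < (k + m)`!%:R :> R by rewrite ltr0n fact_gt0.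
  rewrite -(ler_pM2l h1) -(ler_pM2r (_ : 0 < (k + m)`!%:R^-1)) ?invr_gt0//.
  rewrite (_ : _ / _ = u ^+ (k + m) / (k + m)`!%:R * lag k m%:R u ^+ 2); last first.
    by rewrite exprD; ring.
  apply: le_trans H _; rewrite le_eqVlt; apply/orP; left; apply/eqP.
  by field; rewrite !factR_neq0.
rewrite /lag u0 horner_coef0 coef_poly /= oppr0 expR0 mulr1.
case: m => [|m]; last by rewrite exprS !mul0r divr_ge0.
have -> : \prod_(0 <= i < k) (0%:R + i.+1%:R) = k`!%:R :> R.
  rewrite fact_prod big_add1 natr_prod; apply: eq_bigr => i _.
  by rewrite add0r.
rewrite !expr0 !mul1r fact0 muln1 subn0 addn0 divff ?factR_neq0//.
Qed.

End charlier.

(** * Pointwise bounds uniform in the degree *)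

Section laguerre_bounds.
Context {R : realType}.
Implicit Types (a b u v : R) (k m n : nat).

Lemma gt0_powRD (x a b : R) : 0 < x -> x `^ (a + b) = x `^ a * x `^ b.
Proof. by move=> x0; rewrite powRD//; apply/implyP => _; rewrite gt_eqF. Qed.

(** Order [0] is the case [m = 0] of [lag_nat_le], with bound [1]; [lagD] expands order [b] over
    order [0] with nonnegative coefficients, whose sum is [rising (b + 1) k]. *)
Lemma lag_sup b k u : 0 <= b -> 0 <= u ->
  `|lag k b u| * expR (- (u / 2)) <= rising (b + 1) k.
Proof.
move=> b0 u0.
have H j : `|lag j 0 u| * expR (- (u / 2)) <= 1.
  rewrite -(@ler_pXn2r _ 2)// ?nnegrE ?mulr_ge0 ?expR_ge0//.
  rewrite expr1n exprMn real_normK ?num_real// -expRM_natl.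
  have := lag_nat_le u0 j 0; rewrite expr0 mul1r addn0 divff ?factR_neq0//.
  by rewrite mulrN [2 * _]mulrC divfK.
rewrite -[X in lag k X]add0r lagD rising_vandermonde.
apply: (@le_trans _ _ (\sum_(i < k.+1)
    rising b i * (`|lag (k - i) 0 u| * expR (- (u / 2))))).
  under [leRHS]eq_bigr do rewrite mulrA.
  rewrite -mulr_suml ler_wpM2r ?expR_ge0//.
  apply: le_trans (ler_norm_sum _ _ _) _; apply: ler_sum => i _.
  by rewrite normrM ger0_norm ?rising_ge0.
apply: ler_sum => i _; rewrite rising1 ler_wpM2l ?rising_ge0//.
Qed.

(** The bound at [k] is stated for all degrees [j <= k], because the expansion of order [m + v] by
    [lagD] involves every lower degree. The constant comes from
    [(j + m)! / j! <= ((m + 1) (k + 1))^m]. *)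
Lemma lag_nat_decay m k j u : 0 < u -> (j <= k)%N ->
  `|lag j m%:R u| * expR (- (u / 2)) <=
    m.+1%:R ^+ m * Num.sqrt (k.+1%:R / u) ^+ m.
Proof.
move=> u0 jk.
rewrite -(@ler_pXn2r _ 2)// ?nnegrE ?mulr_ge0 ?expR_ge0 ?exprn_ge0 ?sqrtr_ge0//.
rewrite !exprMn real_normK ?num_real// -expRM_natl mulrN [2 * (_ / _)]mulrC divfK//.
rewrite [Num.sqrt _ ^+ m ^+ 2]exprAC sqr_sqrtr; last by rewrite divr_ge0// ltW.
have := lag_nat_le (ltW u0) j m.
rewrite -mulrA -ler_pdivlMl ?exprn_gt0// => /le_trans; apply.
rewrite mulrC expr_div_n [leRHS]mulrA ler_wpM2r// ?invr_ge0 ?exprn_ge0 ?(ltW u0)//.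
have H : forall i : nat, (i <= m)%N -> ((j + i)`! <= j`! * (m.+1 * k.+1) ^ i)%N.
  elim=> [|i IH] im; first by rewrite addn0 expn0 muln1.
  rewrite addnS factS mulnC expnSr mulnA leq_mul ?IH ?(ltnW im)//.
  by rewrite -addSn mulSn leq_add// (leq_trans (ltnW im))// leq_pmulr.
rewrite ler_pdivrMr ?ltr0n ?fact_gt0//.
apply: (@le_trans _ _ (j`! * (m.+1 * k.+1) ^ m)%:R); first by rewrite ler_nat H.
rewrite natrM mulrC ler_wpM2r// natrX natrM exprMn ler_wpM2r ?exprn_ge0//.
by rewrite -exprM ler_weXn2l// ?ler1n// muln2 -addnn leq_addl.
Qed.

Lemma abel_sum_le (x y c : nat -> R) (Y : R) (n : nat) :
  x 0%N = y 0%N -> (forall j, x j.+1 = y j.+1 - y j) ->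
  (forall j, (j <= n)%N -> `|y j| <= Y) -> (forall j, 0 <= c j) ->
  (forall j, (j < n)%N -> c j <= c j.+1) ->
  `|\sum_(j < n.+1) c j * x j| <= 2 * c n * Y.
Proof.
move=> x0 xS yY c0 cS.
have Y0 : 0 <= Y by apply: le_trans (yY 0%N _).
have H : forall m, (m <= n)%N ->
    `|\sum_(j < m.+1) c j * x j - c m * y m| <= (c m - c 0%N) * Y.
  elim=> [|m IH] mn; first by rewrite big_ord1 x0 !subrr normr0 mul0r.
  rewrite big_ord_recr /= xS mulrBr addrA addrAC addrK.
  rewrite (_ : _ - c m.+1 * y m = (\sum_(j < m.+1) c j * x j - c m * y m)
     + (c m - c m.+1) * y m); last by ring.
  apply: le_trans (ler_normD _ _) _.
  have -> : (c m.+1 - c 0%N) * Y = (c m - c 0%N) * Y + (c m.+1 - c m) * Y by ring.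
  apply: lerD; first exact/IH/ltnW.
  rewrite normrM distrC (@ger0_norm _ (c m.+1 - _)) ?subr_ge0 ?cS//.
  by rewrite ler_wpM2l ?subr_ge0 ?cS// yY// ltnW.
rewrite -[X in `|X|](subrK (c n * y n)); apply: le_trans (ler_normD _ _) _.
have h1 := H n (leqnn n).
have h2 : `|c n * y n| <= c n * Y by rewrite normrM ger0_norm// ler_wpM2l ?yY.
have h3 : 0 <= c 0%N * Y by rewrite mulr_ge0.
lra.
Qed.

(* [L_k^(m + v)] is the sum of the [L_(k - i)^m] with coefficients [rising v i].
   The first [M] terms are estimated with order [m]; the others, after Abel
   summation, with order [m + 1]. *)
Lemma lag_split_le m v k u M (B B' : R) : 0 < v <= 1 -> (M <= k)%N ->
  (forall j, (j <= k)%N -> `|lag j m%:R u| * expR (- (u / 2)) <= B) ->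
  (forall j, (j <= k)%N -> `|lag j m.+1%:R u| * expR (- (u / 2)) <= B') ->
  `|lag k (m%:R + v) u| * expR (- (u / 2)) <=
    (\sum_(i < M) rising v i) * B + 2 * rising v M * B'.
Proof.
move=> /andP[v0 v1] Mk HB HB'; rewrite lagD.
set e := expR _; have e0 : 0 <= e := expR_ge0 _.
rewrite -{1}(ger0_norm e0) -normrM mulr_suml -(subnKC (leqW Mk)) big_split_ord /=.
apply: le_trans (ler_normD _ _) _; apply: lerD.
  rewrite mulr_suml; apply: le_trans (ler_norm_sum _ _ _) _; apply: ler_sum => i _.
  rewrite -mulrA normrM [`|lag _ _ _ * _|]normrM (ger0_norm (rising_ge0 i (ltW v0))) (ger0_norm e0).
  by rewrite ler_wpM2l ?rising_ge0 ?(ltW v0)// HB// leq_subr.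
rewrite subSn//.
rewrite (reindex_inj rev_ord_inj) /=.
under eq_bigr => i _ do rewrite -mulrA.
rewrite (eq_bigr (fun j : 'I_(k - M).+1 =>
    rising v (k - j) * (lag j m%:R u * e))); last first.
  move=> j _; have jk : (j <= k - M)%N by rewrite -ltnS.
  have jk2 : (j <= k)%N by rewrite (leq_trans jk)// leq_subr.
  have -> : (M + ((k - M).+1 - j.+1) = k - j)%N.
    by rewrite subSS subnAC subnKC// leq_subRL// addnC -leq_subRL.
  by rewrite subKn.
have := @abel_sum_le (fun j => lag j m%:R u * e) (fun j => lag j m.+1%:R u * e)
  (fun j => rising v (k - j)) B' (k - M).
rewrite subKn//; apply => //.
- by rewrite !lag0.
- by move=> j; rewrite -[m.+1%:R]natr1 lagS; ring.
- move=> j jk; rewrite normrM (ger0_norm e0) HB'//.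
  by rewrite (leq_trans jk)// leq_subr.
- by move=> j; rewrite rising_ge0// ltW.
- move=> j jk; rewrite -[(k - j)%N]prednK ?subn_gt0 ?(leq_trans jk) ?leq_subr//.
  by rewrite -subnS rising_nonincreasing// v0.
Qed.

Lemma sum_rising v n : \sum_(i < n.+1) rising v i = rising (v + 1) n.
Proof.
by rewrite rising_vandermonde; apply: eq_bigr => i _; rewrite rising1 mulr1.
Qed.

(** With [r = sqrt ((k + 1) / u)] the two parts of [lag_split_le] have sizes [M^v r^m] and
    [M^(v - 1) r^(m + 1)]; they balance for [M] near [r] and give [r^(m + v)]. *)
Lemma lag_decay_frac m v : 0 < v < 1 -> exists2 C : R, 0 < C & forall k u, 0 < u ->
  `|lag k (m%:R + v) u| * expR (- (u / 2)) <=
    C * Num.sqrt (k.+1%:R / u) `^ (m%:R + v).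
Proof.
move=> /andP[v0 v1].
pose B n : R := n.+1%:R ^+ n.
have B0 n : 0 < B n by rewrite exprn_gt0.
exists (4 * B m + 4 * B m.+1) => [|k u u0]; first by rewrite addr_gt0 ?mulr_gt0.
set r := Num.sqrt _.
have r0 : 0 < r by rewrite sqrtr_gt0 divr_gt0.
have rmv : r `^ (m%:R + v) = r ^+ m * r `^ v.
  by rewrite gt0_powRD// powR_mulrn// ltW.
have hB j : (j <= k)%N -> `|lag j m%:R u| * expR (- (u / 2)) <= B m * r ^+ m.
  exact: lag_nat_decay.
have hB' j : (j <= k)%N -> `|lag j m.+1%:R u| * expR (- (u / 2)) <= B m.+1 * r ^+ m.+1.
  exact: lag_nat_decay.
have vv : 0 < v <= 1 by rewrite v0 ltW.
have S := lag_split_le vv _ hB hB'.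
have p0 : 0 < r ^+ m by rewrite exprn_gt0.
(* For [r < 1] the first part is empty: [M = 0] leaves [r^(m + 1) <= r^(m + v)]. *)
have [r1|r1] := ltP r 1.
  apply: le_trans (S 0%N _) _ => //; rewrite big_ord0 mul0r add0r rising0 mulr1.
  rewrite rmv exprSr.
  have : r <= r `^ v by rewrite -[leLHS]powRr1 ?(ltW r0)// ger_powR ?r0 ?ltW.
  move=> rv.
  have h : B m.+1 * (r ^+ m * r) <= B m.+1 * (r ^+ m * r `^ v).
    by rewrite ler_pM2l// ler_pM2l.
  have h2 : 0 <= B m.+1 * (r ^+ m * r `^ v).
    by rewrite mulr_ge0 ?(ltW (B0 _))// mulr_ge0 ?powR_ge0 ?(ltW p0).
  have h3 : 0 <= B m * (r ^+ m * r `^ v).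
    by rewrite mulr_ge0 ?(ltW (B0 _))// mulr_ge0 ?powR_ge0 ?(ltW p0).
  lra.
pose M := Num.truncn r.
have Mr : M%:R <= r by rewrite truncn_le ltW.
have rM : r < M.+1%:R := truncnS_gt r.
have rv0 : 0 < r `^ v by rewrite powR_gt0.
have near N : (N <= M)%N -> \sum_(i < N.+1) rising v i <= 4 * r `^ v.
  move=> NM; rewrite sum_rising.
  have /andP[_ h] := @rising_asymp01 R v (introT andP (conj (ltW v0) (ltW v1))) N.
  apply: le_trans h _.
  have : N.+1%:R `^ v <= (2 * r) `^ v.
    apply: ge0_ler_powR; rewrite ?nnegrE ?(ltW v0)//; first by lra.
    apply: (@le_trans _ _ M.+1%:R); first by rewrite ler_nat.
    by rewrite -natr1; lra.
  rewrite powRM ?(ltW r0)// => h.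
  have h2 : 2 `^ v <= 2 :> R.
    by rewrite -[leRHS]powRr1// ler_powR ?ler1n// ltW.
  have := ler_wpM2r (ltW rv0) h2; lra.
have q1 : 0 < B m * (r ^+ m * r `^ v).
  by rewrite mulr_gt0// mulr_gt0.
have q2 : 0 < B m.+1 * (r ^+ m * r `^ v).
  by rewrite mulr_gt0// mulr_gt0.
(* If [lagD] has at most [M.+1] terms in all, the estimate with order [m] covers the whole sum. *)
have [kM|Mk] := leqP k M.
  have h := near k kM.
  apply: (@le_trans _ _ ((\sum_(i < k.+1) rising v i) * (B m * r ^+ m))); last first.
    rewrite rmv.
    have : 0 < B m * r ^+ m by rewrite mulr_gt0.
    move=> /ltW/ler_wpM2r /(_ _ _ h); lra.
  rewrite lagD -(ger0_norm (expR_ge0 (- (u / 2)))) -normrM !mulr_suml.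
  apply: le_trans (ler_norm_sum _ _ _) _; apply: ler_sum => i _.
  rewrite -mulrA normrM [`|lag _ _ _ * _|]normrM (ger0_norm (rising_ge0 i (ltW v0))).
  rewrite (ger0_norm (expR_ge0 _)) ler_wpM2l ?rising_ge0 ?(ltW v0)//.
  by rewrite hB// leq_subr.
apply: le_trans (S M.+1 _) _ => //.
have h1 := near M (leqnn M).
have h2 : rising v M.+1 <= 2 * r `^ (v - 1).
  apply: le_trans (rising_le_decay vv _) _; rewrite ler_pM2l//.
  rewrite -[v - 1]opprB !powRN lef_pV2 ?posrE ?powR_gt0//.
  apply: ge0_ler_powR; rewrite ?nnegrE ?subr_ge0 ?(ltW v1) ?(ltW r0)//.
  by apply: (le_trans (ltW rM)); rewrite ler_nat.
rewrite rmv.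
have h3 : (\sum_(i < M.+1) rising v i) * (B m * r ^+ m) <= 4 * r `^ v * (B m * r ^+ m).
  by rewrite ler_wpM2r// mulr_ge0 ?(ltW (B0 _)) ?(ltW p0).
have h4 : rising v M.+1 * (B m.+1 * r ^+ m.+1) <= 2 * r `^ (v - 1) * (B m.+1 * r ^+ m.+1).
  by rewrite ler_wpM2r// mulr_ge0 ?(ltW (B0 _)) ?exprn_ge0 ?(ltW r0).
have h5 : r `^ (v - 1) * r = r `^ v by rewrite mulrC mulr_powRB1// ltW.
have h6 : 2 * r `^ (v - 1) * (B m.+1 * r ^+ m.+1) = 2 * (B m.+1 * (r ^+ m * r `^ v)).
  by rewrite -h5 exprSr; ring.
lra.
Qed.

Lemma lag_decay b : 0 <= b -> exists2 C : R, 0 < C & forall k u, 0 < u ->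
  `|lag k b u| * expR (- (u / 2)) <= C * Num.sqrt (k.+1%:R / u) `^ b.
Proof.
move=> b0; pose m := Num.truncn b; pose v := b - m%:R.
have bE : b = m%:R + v by rewrite addrC subrK.
have v0 : 0 <= v by rewrite subr_ge0 truncn_le.
have v1 : v < 1 by have := truncnS_gt b; rewrite -natr1 /v -/m; lra.
have [v00|vn0] := eqVneq v 0; last first.
  by rewrite bE; apply: lag_decay_frac; rewrite v1 andbT lt_neqAle eq_sym vn0.
rewrite bE v00 addr0; exists (m.+1%:R ^+ m) => [|k u u0]; first by rewrite exprn_gt0.
by rewrite powR_mulrn ?sqrtr_ge0// lag_nat_decay.
Qed.

(** Up to [u = 1 / K] the bound is [lag_sup], of size [K^b]; beyond it is [lag_decay], where
    [sqrt (K / u)^b = K^b (K u)^(- b / 2)]. *)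
Lemma lag_bound b : 0 <= b -> exists2 C : R, 0 < C & forall k u, 0 <= u ->
  `|lag k b u| * expR (- (u / 2)) <=
    C * (k.+1%:R `^ b * (1 + k.+1%:R * u) `^ (- (b / 2))).
Proof.
move=> b0.
have [C1 C10 H1] := lag_decay b0.
have [c [C2 [_ C20 H2]]] := rising_asymp b0.
have b2 : 0 <= b / 2 by lra.
have t0 : 0 < 2 `^ (b / 2) :> R by rewrite powR_gt0.
exists ((C1 + C2) * 2 `^ (b / 2)) => [|k u u0].
  by rewrite mulr_gt0// addr_gt0.
set K : R := k.+1%:R; have K0 : 0 < K by rewrite ltr0n.
have Ku0 : 0 <= K * u by rewrite mulr_ge0// ltW.
have p0 : 0 < (1 + K * u) `^ (b / 2) by rewrite powR_gt0//; lra.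
have Kb0 : 0 < K `^ b by rewrite powR_gt0.
rewrite powRN.
have [Ku1|Ku1] := leP (K * u) 1.
  apply: le_trans (lag_sup _ b0 u0) _.
  have /andP[_ h2] := H2 k; apply: le_trans h2 _; rewrite -/K.
  rewrite mulrACA mulrA ler_pdivlMr// mulrAC [in leRHS]mulrAC.
  apply: ler_pM => //; try exact: ltW; rewrite ?mulr_ge0 ?(ltW C20) ?(ltW Kb0) ?(ltW p0)//.
    by rewrite ler_wpM2r ?(ltW Kb0)//; lra.
  by apply: ge0_ler_powR; rewrite ?nnegrE//; lra.
have up : 0 < u.
  rewrite lt_neqAle u0 andbT; apply/eqP => u00; move: Ku1; rewrite -u00 mulr0; lra.
apply: le_trans (H1 k u up) _; rewrite -/K.
have -> : Num.sqrt (K / u) `^ b = K `^ b / (K * u) `^ (b / 2).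
  have -> : K / u = K ^+ 2 / (K * u) by field; rewrite !gt_eqF.
  rewrite -powR12_sqrt; last by rewrite divr_ge0// exprn_ge0// ltW.
  rewrite -powRrM [2^-1 * b]mulrC powRM ?exprn_ge0 ?invr_ge0 ?(ltW K0)//.
  rewrite -[K ^+ 2]powR_mulrn ?(ltW K0)// -powRrM [2 * _]mulrC divfK//.
  by rewrite -powR_inv1// powRAC powR_inv1// powR_ge0.
have q0 : 0 < (K * u) `^ (b / 2) by rewrite powR_gt0//; lra.
have h : (1 + K * u) `^ (b / 2) <= 2 `^ (b / 2) * (K * u) `^ (b / 2).
  rewrite -powRM//; apply: ge0_ler_powR; rewrite ?nnegrE//; lra.
have hi : ((K * u) `^ (b / 2))^-1 <= 2 `^ (b / 2) / (1 + K * u) `^ (b / 2).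
  by rewrite ler_pdivlMr// mulrC ler_pdivrMr.
have -> : (C1 + C2) * 2 `^ (b / 2) * (K `^ b / (1 + K * u) `^ (b / 2)) =
  (C1 + C2) * (K `^ b * (2 `^ (b / 2) / (1 + K * u) `^ (b / 2))) by ring.
apply: ler_pM; first exact: ltW.
- by rewrite divr_ge0// ltW.
- by rewrite lerDl ltW.
- by rewrite ler_pM2l.
Qed.

End laguerre_bounds.

Section real_derivatives.
Context {R : realType}.
Implicit Types (f g : R -> R) (x a b c : R).

Lemma is_derive_addr f g x a b :
  is_derive x 1 f a -> is_derive x 1 g b -> is_derive x 1 (fun t => f t + g t) (a + b).
Proof. exact: is_deriveD. Qed.

Lemma is_derive_oppr f x a :
  is_derive x 1 f a -> is_derive x 1 (fun t => - f t) (- a).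
Proof. exact: is_deriveN. Qed.

Lemma is_derive_mulr f g x a b :
  is_derive x 1 f a -> is_derive x 1 g b ->
  is_derive x 1 (fun t => f t * g t) (a * g x + f x * b).
Proof.
move=> fa gb; have := is_deriveM fa gb.
by rewrite /GRing.scale /= addrC [g x * a]mulrC.
Qed.

Lemma is_derive_mulrc f x a c :
  is_derive x 1 f a -> is_derive x 1 (fun t => c * f t) (c * a).
Proof. exact: is_deriveZ. Qed.

Lemma is_derive_expr_comp f x a :
  is_derive x 1 f a -> is_derive x 1 (fun t => expR (f t)) (expR (f x) * a).
Proof. by move=> fa; exact: (@is_derive1_comp _ expR f). Qed.

Lemma is_derive_exprn f x a n :
  is_derive x 1 f a -> is_derive x 1 (fun t => f t ^+ n) (n%:R * f x ^+ n.-1 * a).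
Proof.
move=> fa; rewrite (_ : (fun t => f t ^+ n) = f ^+ n); first exact: is_deriveX.
by elim: n => [|n IH]; apply/funext => t; rewrite ?expr0// !exprS -IH.
Qed.

Lemma is_derive_affine x c b : is_derive x 1 (fun t => c * t + b) c.
Proof.
have := is_derive_addr (is_derive_mulrc c (is_derive_id x (1 : R))) (is_derive_cst b x (1 : R)).
by rewrite mulr1 addr0.
Qed.

Lemma is_derive_affine_comp f x c b a :
  is_derive (c * x + b) 1 f a -> is_derive x 1 (fun t => f (c * t + b)) (a * c).
Proof.
move=> fa; apply: (@is_derive1_comp _ f (fun t => c * t + b)) => //.
exact: is_derive_affine.
Qed.

End real_derivatives.

Section exponential_bounds.
Context {R : realType}.
Implicit Types (t x : R) (n : nat).

Lemma exprn_le_expR n t : 0 <= t -> t ^+ n <= n`!%:R * expR t.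
Proof.
case: n => [|n] t0; first by rewrite expr0 mul1r -expR0 ler_expR.
have := expR_ge1Dxn n t0 => h.
rewrite mulrC -ler_pdivrMr ?ltr0n ?fact_gt0//; apply: le_trans h.
by rewrite lerDr.
Qed.

Lemma powR_le_expR x (e : R) : 0 <= x -> 0 < e ->
  exists2 C : R, 0 < C & forall t, 0 <= t -> t `^ x <= C * expR (e * t).
Proof.
move=> x0 e0; pose n := (Num.truncn x).+1.
exists (1 + n`!%:R / e ^+ n) => [|t t0].
  by rewrite ltr_pwDl// divr_ge0// exprn_ge0// ltW.
have E1 : 1 <= expR (e * t) by rewrite -expR0 ler_expR mulr_ge0// ltW.
have En : t ^+ n <= n`!%:R / e ^+ n * expR (e * t).
  rewrite mulrAC ler_pdivlMr ?exprn_gt0// -exprMn mulrC mulrC.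
  by rewrite [t * e]mulrC exprn_le_expR// mulr_ge0// ltW.
rewrite mulrDl mul1r.
have [t1|t1] := leP t 1.
  apply: (@le_trans _ _ 1).
    have := @ge0_ler_powR R _ x0 t 1; rewrite !nnegrE t0 ler01 powR1 => -> //.
  apply: le_trans E1 _; rewrite lerDl mulr_ge0 ?expR_ge0// divr_ge0// exprn_ge0//.
  exact: ltW.
apply: le_trans (_ : _ <= t ^+ n) _.
  rewrite -powR_mulrn//; apply: ler_powR; first exact: ltW.
  exact: ltW (truncnS_gt x).
by apply: le_trans En _; rewrite lerDr expR_ge0.
Qed.

End exponential_bounds.

(** * The Gamma function and the Hoelder classes *)

Section gamma.
Context {R : realType}.
Local Notation mu := (@lebesgue_measure R).
Implicit Types (t x : R).

Let I x : \bar R := (\int[mu]_(t in `]0%R, +oo[) (t `^ (x - 1) * expR (- t))%:E)%E.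

Let EFin_addI (c : R) (a b : \bar R) : (c%:E + a = c%:E + b)%E -> a = b.
Proof. by case: a b => [a| |] [b| |]//= [] /addrI ->. Qed.

Let mI x : measurable_fun `](0:R), +oo[ (fun t : R => t `^ x * expR (- t)).
Proof.
apply: measurable_funM.
  by apply: measurable_funTS; exact: measurable_powR.
apply: measurable_funTS; exact: measurableT_comp.
Qed.

Let I_ge0 x : (0 <= I x)%E.
Proof. by apply: integral_ge0 => t _; rewrite lee_fin mulr_ge0 ?powR_ge0 ?expR_ge0. Qed.

Let cvg_exp (C : R) : C * expR (- (2^-1 * t)) @[t --> +oo] --> 0.
Proof.
rewrite -(mulr0 C); apply: cvgMr.
apply: (@cvg_comp _ _ _ (fun t : R => 2^-1 * t) (fun t => expR (- t)) _ +oo).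
  by apply: gt0_cvgMry => //; exact: cvg_id.
exact: cvgr_expR.
Qed.

(** [- (t^x + c) exp (- t)] is a primitive of the integrand. The constant [c] makes the integrand
    nonnegative, so that the fundamental theorem on the half-line applies before anything is known
    about integrability. *)
Let FTC x (c : R) : 1 <= x -> 0 <= c ->
  (forall t, 0 <= t -> x * t `^ (x - 1) <= t `^ x + c) ->
  (\int[mu]_(t in `]0%R, +oo[) ((t `^ x + c - x * t `^ (x - 1)) * expR (- t))%:E
    = c%:E)%E.
Proof.
move=> x1 c0 h.
pose F t : R := - ((t `^ x + c) * expR (- t)).
have x0 : 0 < x by lra.
have dF t : 0 < t -> is_derive t 1 F ((t `^ x + c - x * t `^ (x - 1)) * expR (- t)).
  move=> t0; rewrite /F; apply: is_derive_eq.
    apply: is_derive_oppr; apply: is_derive_mulr.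
      by apply: is_derive_addr; exact: is_derive1_powR.
  by rewrite /=; ring.
rewrite integral_itv_obnd_cbnd; last first.
  apply/measurable_EFinP; rewrite (_ : (fun _ => _) = (fun t : R =>
    t `^ x * expR (- t) + c * expR (- t) - x * (t `^ (x - 1) * expR (- t)))); last first.
    by apply/funext => t; ring.
  apply: measurable_funB; last by apply: measurable_funM => //; exact: mI.
  apply: measurable_funD; first exact: mI.
  apply: measurable_funM => //.
  by apply: measurable_funTS; exact: measurableT_comp.
have F0 : F 0 = - c by rewrite /F powR0 ?gt_eqF// oppr0 expR0 add0r mulr1.
have cp y : 0 <= y -> t `^ y @[t --> 0^'+] --> 0 `^ y.
  move=> y0; have [->|yn0] := eqVneq y 0.
    by under eq_fun do rewrite powRr0; rewrite powRr0; exact: cvg_cst.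
  by rewrite powR0//; apply: powR_cvg0; rewrite lt_neqAle eq_sym yn0.
have ce : expR (- t) @[t --> 0^'+] --> expR (- 0 : R).
  apply: cvg_at_right_filter.
  by apply: continuous_comp; [exact: opp_continuous|exact: continuous_expR].
rewrite (@ge0_continuous_FTC2y _ _ F 0 0).
- by rewrite F0 EFinN oppeK add0e.
- move=> t t0; rewrite mulr_ge0 ?expR_ge0// subr_ge0; exact: h.
- apply/continuous_within_itvcyP; split.
    move=> t; rewrite in_itv/= andbT => t0.
    have pc y : {for t, continuous (fun t : R => t `^ y)}.
      apply: differentiable_continuous; apply/derivable1_diffP.
      by apply: derivable_powR; rewrite in_itv/= andbT.
    apply: cvgM; last first.
      by apply: continuous_comp; [exact: opp_continuous|exact: continuous_expR].
    apply: cvgB; last by apply: cvgMr; exact: pc.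
    by apply: cvgD; [exact: pc|exact: cvg_cst].
  apply: cvgM => //; apply: cvgB; last by apply: cvgMr; apply: cp; lra.
  by apply: cvgD; [apply: cp; lra|exact: cvg_cst].
- have [C C0 hC] := @powR_le_expR R x 2^-1 (ltW x0) ltac:(by []).
  have hl := cvg_exp (C + c).
  apply/norm_cvg0P; apply: (squeeze_cvgr _ _ hl); last exact: cvg_cst.
  near=> t; rewrite normr_ge0 /= /F normrN.
  have t0 : 0 <= t by near: t; exact: nbhs_pinfty_ge.
  rewrite ger0_norm; last by rewrite mulr_ge0 ?expR_ge0// addr_ge0 ?powR_ge0.
  have -> : expR (- t) = expR (- (2^-1 * t)) * expR (- (2^-1 * t)).
    by rewrite -expRD; congr expR; lra.
  rewrite mulrA ler_wpM2r ?expR_ge0//.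
  rewrite expRN ler_pdivrMr ?expR_gt0//.
  have := hC t t0; have := @expR_ge1Dx R (2^-1 * t).
  have := expR_gt0 (2^-1 * t).
  move: (expR (2^-1 * t)) => e e0 e1 e2.
  have : c * 1 <= c * e by apply: ler_wpM2l => //; lra.
  lra.
- by move=> t /dF[].
- rewrite /F.
  by apply: cvgN; apply: cvgM => //; apply: cvgD; [apply: cp; exact: ltW|exact: cvg_cst].
- move=> t; rewrite in_itv/= andbT => t0; rewrite derive1E.
  by have := dF t t0 => ?; rewrite derive_val.
Unshelve. all: by end_near. Qed.

(** Difference of two instances of [FTC] at [x = 1], with [c = 1] and [c = 2]. *)
Let I1 : I 1 = 1%:E.
Proof.
have c1 : (forall t, 0 <= t -> 1 * t `^ (1 - 1) <= t `^ 1 + 1 :> R).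
  by move=> t t0; rewrite subrr powRr0 mulr1 lerDr powR_ge0.
have c2 : (forall t, 0 <= t -> 1 * t `^ (1 - 1) <= t `^ 1 + 2 :> R).
  by move=> t t0; have := c1 t t0; lra.
have h2 := FTC (lexx 1) (ler0n _ 2) c2.
have h1 := FTC (lexx 1) ler01 c1.
have : (1%:E + I 1 = 1%:E + 1%:E :> \bar R)%E.
  rewrite -[RHS]h2 -[X in (X + _)%E]h1 /I -ge0_integralD//=.
  - apply: eq_integral => t _; rewrite -EFinD; congr (_%:E).
    by rewrite !subrr !powRr0; ring.
  - move=> t; rewrite in_itv/= andbT => /ltW t0; rewrite lee_fin mulr_ge0 ?expR_ge0//.
    by rewrite subr_ge0 c1.
  - apply/measurable_EFinP; rewrite (_ : (fun _ => _) = (fun t : R => t `^ 1 * expR (- t))).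
      exact: mI.
    by apply/funext => t; rewrite subrr powRr0; ring.
  - by move=> t _; rewrite lee_fin mulr_ge0 ?powR_ge0 ?expR_ge0.
  - by apply/measurable_EFinP; exact: mI.
exact: EFin_addI.
Qed.

Let IS x : 1 <= x -> I (x + 1) = (x%:E * I x)%E.
Proof.
move=> x1; have x0 : 0 < x by lra.
(* With this [c], [x t^(x - 1)] is at most [c] for [t <= x] and at most [t^x] beyond. *)
pose c := x * x `^ (x - 1).
have c0 : 0 <= c by rewrite mulr_ge0 ?powR_ge0// ltW.
have hc t : 0 <= t -> x * t `^ (x - 1) <= t `^ x + c.
  move=> t0; have [tx|tx] := leP t x.
    apply: (@le_trans _ _ c); last by rewrite lerDr powR_ge0.
    rewrite ler_pM2l//; apply: ge0_ler_powR; rewrite ?nnegrE// ?subr_ge0//.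
    exact: ltW.
  apply: (@le_trans _ _ (t `^ x)); last by rewrite lerDl.
  by rewrite -(mulr_powRB1 t0 x0) ler_wpM2r ?powR_ge0// ltW.
have h := FTC x1 c0 hc.
have g0 : forall t : R, `]0, +oo[%classic t ->
    (0 <= ((t `^ x + c - x * t `^ (x - 1)) * expR (- t))%:E)%E.
  move=> t; rewrite /= in_itv/= andbT => /ltW t0; rewrite lee_fin mulr_ge0 ?expR_ge0//.
  by rewrite subr_ge0 hc.
have mg : measurable_fun `](0:R), +oo[
    (fun t => ((t `^ x + c - x * t `^ (x - 1)) * expR (- t))%:E).
  apply/measurable_EFinP; rewrite (_ : (fun _ => _) = (fun t : R =>
    t `^ x * expR (- t) + c * (t `^ 0 * expR (- t)) - x * (t `^ (x - 1) * expR (- t)))).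
    apply: measurable_funB; last by apply: measurable_funM => //; exact: mI.
    apply: measurable_funD; first exact: mI.
    by apply: measurable_funM => //; exact: mI.
  by apply/funext => t; rewrite powRr0; ring.
have p0 y : forall t : R, `]0, +oo[%classic t -> (0 <= (t `^ y * expR (- t))%:E)%E.
  by move=> t _; rewrite lee_fin mulr_ge0 ?powR_ge0 ?expR_ge0.
have mp y : measurable_fun `](0:R), +oo[ (fun t : R => (t `^ y * expR (- t))%:E).
  by apply/measurable_EFinP; exact: mI.
have mu0 : measurable (`]0%R, +oo[ : set R) by [].
have E y k : 0 <= k -> (k%:E * I y =
    \int[mu]_(t in `]0%R, +oo[) (k%:E * (t `^ (y - 1) * expR (- t))%:E))%E.
  move=> k0; apply/esym; apply: ge0_integralZl_EFin => //.
    exact: (p0 (y - 1)).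
  exact: mp.
have p0' y k : 0 <= k -> forall t : R, `]0, +oo[%classic t ->
    (0 <= k%:E * (t `^ y * expR (- t))%:E)%E.
  by move=> k0 t t0; rewrite mule_ge0 ?lee_fin//; exact: (p0 y).
have mp' y k : measurable_fun `](0:R), +oo[
    (fun t : R => (k%:E * (t `^ y * expR (- t))%:E)%E).
  by apply: measurable_funeM; exact: mp.
have L : (I (x + 1) + c%:E * I 1 = \int[mu]_(t in `]0%R, +oo[)
    ((t `^ (x + 1 - 1) * expR (- t))%:E + c%:E * (t `^ (1 - 1) * expR (- t))%:E))%E.
  rewrite E// ge0_integralD//.
  - exact: (p0 (x + 1 - 1)).
  - exact: mp.
  - exact: (p0' (1 - 1)).
  - exact: mp'.
have L' : (c%:E + x%:E * I x = \int[mu]_(t in `]0%R, +oo[)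
    (((t `^ x + c - x * t `^ (x - 1)) * expR (- t))%:E +
      x%:E * (t `^ (x - 1) * expR (- t))%:E))%E.
  rewrite (E x x (ltW x0)) ge0_integralD//; first by congr (_ + _)%E.
  - exact: (p0' (x - 1) x (ltW x0)).
  - exact: mp'.
have : (I (x + 1) + c%:E * I 1 = c%:E + x%:E * I x)%E.
  rewrite L L'; apply: eq_integral => t _; rewrite -!EFinM -!EFinD; congr (_%:E).
  by rewrite subrr powRr0 addrK; ring.
by rewrite I1 mule1 addeC => /EFin_addI.
Qed.

Let I_nat (n : nat) : I n.+1%:R = n`!%:R%:E.
Proof.
elim: n => [|n IH]; first exact: I1.
by rewrite -natr1 IS ?IH -?EFinM ?factS ?natrM// ler1n.
Qed.

Let I_fin x : 1 <= x -> I x \is a fin_num.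
Proof.
move=> x1; pose n := (Num.truncn x).+1.
have xn : x <= n%:R by exact: ltW (truncnS_gt x).
rewrite ge0_fin_numE//; apply: (@le_lt_trans _ _ (I 1 + I n.+1%:R)%E); last first.
  by rewrite I1 I_nat -EFinD ltry.
rewrite /I -ge0_integralD//=.
- apply: ge0_le_integral => //=.
  + by move=> t _; rewrite lee_fin mulr_ge0 ?powR_ge0 ?expR_ge0.
  + by apply/measurable_EFinP; exact: mI.
  + by apply: emeasurable_funD; apply/measurable_EFinP; exact: mI.
  + move=> t; rewrite in_itv/= andbT => t0; rewrite -EFinD lee_fin -mulrDl.
    rewrite ler_wpM2r ?expR_ge0// subrr powRr0.
    have [t1|t1] := leP t 1.
      apply: (@le_trans _ _ 1); last by rewrite lerDl powR_ge0.
      by rewrite -[leRHS](powRr0 t); apply: ger_powR; rewrite ?subr_ge0// t0 t1.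
    apply: (@le_trans _ _ (t `^ (n.+1%:R - 1))); last by rewrite lerDr.
    by apply: ler_powR; [exact: ltW|rewrite -natr1 addrK; lra].
- by move=> t _; rewrite lee_fin mulr_ge0 ?powR_ge0 ?expR_ge0.
- by apply/measurable_EFinP; exact: mI.
- by move=> t _; rewrite lee_fin mulr_ge0 ?powR_ge0 ?expR_ge0.
- by apply/measurable_EFinP; exact: mI.
Qed.

Lemma gammaS x : 1 <= x -> gamma_function (x + 1) = x * gamma_function x.
Proof.
move=> x1; rewrite /gamma_function /Rintegral -/(I (x + 1)) -/(I x) IS//.
by rewrite fineM// I_fin.
Qed.

Lemma gamma1 : gamma_function (1 : R) = 1.
Proof. by rewrite /gamma_function /Rintegral -/(I 1) I1. Qed.

Lemma gamma_gt0 x : 1 <= x -> 0 < gamma_function x.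
Proof.
move=> x1; rewrite /gamma_function /Rintegral -/(I x).
rewrite fine_gt0// -ge0_fin_numE// I_fin// andbT.
apply: (@lt_le_trans _ _ (\int[mu]_(t in `]1%R, 2%R]) (cst (expR (- 2))%:E) t)%E).
  rewrite integral_cst//= lebesgue_measure_itv/= lte_fin ltr1n/=.
  by rewrite -EFinB -EFinM lte_fin mulr_gt0 ?expR_gt0//; lra.
apply: (@le_trans _ _ (\int[mu]_(t in `]1%R, 2%R]) (t `^ (x - 1) * expR (- t))%:E)%E).
  apply: ge0_le_integral => //=.
  - apply/measurable_EFinP; apply: measurable_funS (mI (x - 1)) => //.
    by move=> t /=; rewrite !in_itv/= andbT => /andP[]; lra.
  - move=> t; rewrite in_itv/= => /andP[t1 t2]; rewrite lee_fin.
    rewrite -[leLHS]mul1r; apply: ler_pM; rewrite ?expR_ge0//.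
      by rewrite -[leLHS](powRr0 t) ler_powR ?subr_ge0// ltW.
    by rewrite ler_expR; lra.
apply: ge0_subset_integral => //=.
- by apply/measurable_EFinP; exact: mI.
- by move=> t _; rewrite lee_fin mulr_ge0 ?powR_ge0 ?expR_ge0.
- by move=> t /=; rewrite !in_itv/= andbT => /andP[]; lra.
Qed.

(** The square of the normalising constant of [laguerre1]; by [rising_asymp] it is of size
    [(k + 1)^(- a)]. *)
Lemma gamma_ratio (a : R) (k : nat) : 0 <= a ->
  gamma_function (k%:R + 1) / gamma_function (k%:R + a + 1) =
  (gamma_function (a + 1) * rising (a + 1) k)^-1.
Proof.
move=> a0; elim: k => [|k IH].
  by rewrite rising0 mulr1 !add0r gamma1 mul1r.
have k0 : 0 <= k%:R :> R by [].
rewrite risingS -natr1; move: (k%:R : R) k0 IH => y y0 IH.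
rewrite (@gammaS (y + 1)); last by lra.
rewrite (_ : y + 1 + a + 1 = y + a + 1 + 1); last by ring.
rewrite (@gammaS (y + a + 1)); last by lra.
rewrite invfM mulrACA IH mulrA [in RHS]invfM mulrC; congr (_ * _).
rewrite invf_div; congr (_ / _); ring.
Qed.

End gamma.

Section mean_value.
Context {R : realType}.
Implicit Types (f g : R -> R).

Lemma mean_value_le f g (B x y : R) :
  (forall t, Num.min x y <= t <= Num.max x y -> is_derive t 1 f (g t)) ->
  (forall t, Num.min x y <= t <= Num.max x y -> `|g t| <= B) ->
  `|f y - f x| <= B * `|y - x|.
Proof.
wlog xy : x y / x <= y => [H|].
  have /orP[xy|yx] := le_total x y; first exact: H.
  by rewrite minC maxC distrC (distrC y) => h1 h2; exact: H.
rewrite (min_idPl xy) (max_idPr xy) => df gB.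
have [||c cxy ->] := @MVT_segment R f g x y xy.
- by move=> t; rewrite in_itv/= => /andP[xt ty]; apply: df; rewrite !ltW.
- apply: derivable_within_continuous => t; rewrite in_itv/= => txy.
  by have [] := df t txy.
by rewrite normrM ler_wpM2r// gB//; move: cxy; rewrite in_itv.
Qed.

(** By concavity [t^b] lies above its chord [y^b t / y] on [[0, y]]; the chord inequalities at [x]
    and [y - x] are added. *)
Lemma powR_sub_le (b x y : R) : 0 < b <= 1 -> 0 <= x -> x <= y ->
  y `^ b - x `^ b <= (y - x) `^ b.
Proof.
move=> /andP[b0 b1] x0 xy.
have [y0|y0] := leP y 0.
  have -> : y = 0 by lra.
  have -> : x = 0 by lra.
  by rewrite subrr powR_ge0.
have H t : 0 <= t <= y -> y `^ b * (t / y) <= t `^ b.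
  move=> /andP[t0 ty]; have [->|tn0] := eqVneq t 0.
    by rewrite mul0r mulr0 powR_ge0.
  have tp : 0 < t by rewrite lt_neqAle eq_sym tn0.
  have -> : t `^ b = y `^ b * (t / y) `^ b.
    by rewrite -powRM ?divr_ge0 ?(ltW y0)// mulrC divfK ?gt_eqF.
  rewrite ler_pM2l ?powR_gt0//; apply: ger1_powR => //.
  by rewrite divr_gt0//= ler_pdivrMr// mul1r.
have h1 := H x; have h2 := H (y - x).
rewrite x0 xy in h1; rewrite subr_ge0 xy in h2.
have := h1 isT; have := h2 ltac:(by rewrite /=; lra).
have : y `^ b * (x / y) + y `^ b * ((y - x) / y) = y `^ b.
  by field; rewrite gt_eqF.
lra.
Qed.

End mean_value.

(** * Hoelder classes on the open half-line and Taylor polynomials *)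

Section hoelder_classes.
Context {R : realType}.
Variable th : R.
Implicit Types (f g : R -> R) (M : R) (n : nat).

(** Class [C^(n, th)] with one constant for all derivatives. The derivatives are witnesses
    constrained only at positive points, so the behaviour at [0] and to its left is free. *)
Fixpoint hoelder_class M n f : Prop :=
  (forall u, 0 < u -> `|f u| <= M) /\
  match n with
  | 0 => forall u v, 0 < u -> 0 < v -> `|f u - f v| <= M * `|u - v| `^ th
  | n'.+1 => exists2 g : R -> R,
      forall u : R, 0 < u -> is_derive u 1 f (g u) & hoelder_class M n' g
  end.

Lemma hoelder_class_bound M n f : hoelder_class M n f ->
  forall u, 0 < u -> `|f u| <= M.
Proof. by case: n => [|n] []. Qed.

Lemma hoelder_class_le M M' n f : M <= M' ->
  hoelder_class M n f -> hoelder_class M' n f.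
Proof.
move=> MM; elim: n f => [|n IH] f [f1 f2]; split.
- by move=> u /f1/le_trans; exact.
- by move=> u v u0 v0; apply: le_trans (f2 u v u0 v0) _; rewrite ler_wpM2r ?powR_ge0.
- by move=> u /f1/le_trans; exact.
- by case: f2 => g fg /IH; exists g.
Qed.

Lemma hoelder_class_eq M n f g : (forall u, 0 < u -> f u = g u) ->
  hoelder_class M n f -> hoelder_class M n g.
Proof.
case: n => [|n] fg [f1 f2]; split.
- by move=> u u0; rewrite -fg// f1.
- by move=> u v u0 v0; rewrite -!fg// f2.
- by move=> u u0; rewrite -fg// f1.
- case: f2 => h fh hh; exists h => // u u0.
  apply: (near_eq_is_derive _ (fh u u0)).
  by near=> t; apply: fg; near: t; exact: lt_nbhsr.
Unshelve. all: by end_near. Qed.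

Lemma hoelder_classD M M' n f g : hoelder_class M n f -> hoelder_class M' n g ->
  hoelder_class (M + M') n (fun u => f u + g u).
Proof.
elim: n f g => [|n IH] f g [f1 f2] [g1 g2]; split.
- by move=> u u0; apply: le_trans (ler_normD _ _) _; rewrite lerD ?f1 ?g1.
- move=> u v u0 v0; rewrite opprD addrACA mulrDl.
  by apply: le_trans (ler_normD _ _) _; rewrite lerD ?f2 ?g2.
- by move=> u u0; apply: le_trans (ler_normD _ _) _; rewrite lerD ?f1 ?g1.
- case: f2 => f' ff' hf; case: g2 => g' gg' hg.
  exists (fun u => f' u + g' u); last exact: IH.
  by move=> u u0; apply: is_derive_addr; [exact: ff'|exact: gg'].
Qed.

Lemma hoelder_classZ M c C n f : `|c| <= C -> hoelder_class M n f ->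
  hoelder_class (C * M) n (fun u => c * f u).
Proof.
move=> cC; have C0 : 0 <= C by apply: le_trans cC.
elim: n f => [|n IH] f [f1 f2]; split.
- by move=> u u0; rewrite normrM ler_pM ?f1.
- by move=> u v u0 v0; rewrite -mulrBr normrM -mulrA ler_pM ?f2.
- by move=> u u0; rewrite normrM ler_pM ?f1.
- case: f2 => f' ff' hf; exists (fun u => c * f' u); last exact: IH.
  by move=> u u0; apply: is_derive_mulrc; exact: ff'.
Qed.

Lemma hoelder_class_shift M n f (e : R) : 0 <= e -> hoelder_class M n f ->
  hoelder_class M n (fun u => f (u + e)).
Proof.
move=> e0; elim: n f => [|n IH] f [f1 f2]; split.
- by move=> u u0; rewrite f1// ltr_wpDr.
- move=> u v u0 v0; have := f2 (u + e) (v + e).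
  by rewrite opprD addrACA subrr addr0; apply; rewrite ltr_wpDr.
- by move=> u u0; rewrite f1// ltr_wpDr.
- case: f2 => f' ff' hf; exists (fun u => f' (u + e)); last exact: IH.
  move=> u u0; have := @is_derive_affine_comp R f u 1 e (f' (u + e)).
  rewrite mul1r mulr1 => /(_ (ff' _ _)) h.
  have -> : (fun u : R => f (u + e)) = (fun u => f (1 * u + e)).
    by apply/funext => t; rewrite mul1r.
  by apply: h; rewrite ltr_wpDr.
Qed.

(** The Taylor polynomial of [f] is a primitive of that of its derivative. The remainder vanishes at
    [u0] and has a derivative bounded by induction, so the mean value inequality adds one power
    without changing the constant. *)
Lemma hoelder_class_taylor M n f : 0 < th -> hoelder_class M n f ->
  forall u0, 0 < u0 -> exists2 c : nat -> R,
    forall j, (j <= n)%N -> `|c j| <= M &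
    forall u, 0 < u ->
      `|f u - \sum_(j < n.+1) c j * (u - u0) ^+ j| <= M * `|u - u0| `^ (n%:R + th).
Proof.
move=> th0; elim: n f => [|n IH] f [f1 f2] u0 u0_gt0.
  exists (fun=> f u0) => [j _|u u_gt0]; first exact: f1.
  by rewrite big_ord1 mulr1 add0r; exact: f2.
case: f2 => g fg /IH /(_ u0 u0_gt0)[c cM cT].
have M0 : 0 <= M by apply: le_trans (cM 0%N _).
exists (fun j => if j is j'.+1 then c j' / j'.+1%:R else f u0).
  case=> [|j] jn; first exact: f1.
  rewrite normrM normfV normr_nat ler_pdivrMr// (le_trans (cM j jn))//.
  by rewrite ler_peMr// ler1n.
move=> u u_gt0.
pose T (c : nat -> R) m (u : R) := \sum_(j < m) c j * (u - u0) ^+ j.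
pose c' := (fun j => if j is j'.+1 then c j' / j'.+1%:R else f u0 : R).
have dT m (t : R) : is_derive t 1 (T c' m.+1) (T c m t).
  elim: m => [|m IHm].
    have -> : T c' 1%N = cst (f u0).
      by apply/funext => s; rewrite /T big_ord1 expr0 mulr1.
    by rewrite /T big_ord0; exact: is_derive_cst.
  have -> : T c' m.+2 = (fun s => T c' m.+1 s + c' m.+1 * (s - u0) ^+ m.+1).
    by apply/funext => s; rewrite /T big_ord_recr.
  rewrite /T [X in is_derive _ _ _ X]big_ord_recr /= -/(T c m t).
  have h1 : is_derive t 1 (fun s : R => s - u0) 1 by exact: is_derive_shift.
  have h2 := is_derive_mulrc (c' m.+1) (is_derive_exprn m.+1 h1).
  apply: is_derive_eq (is_derive_addr IHm h2) _; congr (_ + _).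
  by rewrite /=; field; rewrite nat1r pnatr_eq0.
pose h u := f u - T c' n.+2 u.
have hu0 : h u0 = 0.
  rewrite /h /T big_ord_recl /= expr0 mulr1 big1 ?addr0 ?subrr// => i _.
  by rewrite expr0n /= mulr0.
rewrite -/c' -/(T c' n.+2 u) -/(h u) -[h u]subr0 -hu0.
have -> : M * `|u - u0| `^ (n.+1%:R + th) = M * `|u - u0| `^ (n%:R + th) * `|u - u0|.
  rewrite -mulrA -natr1; congr (_ * _).
  have [->|un] := eqVneq `|u - u0| 0.
    by rewrite mulr0 powR0// gt_eqF// ltr_wpDl.
  rewrite -[X in _ = _ * X]powRr1// -powRD ?un ?implybT//.
  by congr (_ `^ _); ring.
apply: (@mean_value_le _ _ (fun t => g t - T c n.+1 t)) => t /andP[t1 t2].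
  have t0 : 0 < t by apply: lt_le_trans t1; rewrite lt_min u0_gt0.
  exact: is_derive_addr (fg t t0) (is_derive_oppr (dT n.+1 t)).
have t0 : 0 < t by apply: lt_le_trans t1; rewrite lt_min u0_gt0.
apply: le_trans (cT t t0) _; rewrite ler_wpM2l//.
apply: ge0_ler_powR; rewrite ?nnegrE ?normr_ge0 ?addr_ge0 ?(ltW th0)//.
move: t1 t2; have [uu|uu] := leP u0 u => a b.
  by rewrite !ger0_norm ?subr_ge0// lerD2r.
by rewrite !ler0_norm ?subr_le0 ?(ltW uu)// lerN2 lerD2r.
Qed.

End hoelder_classes.

Lemma hoelder_class0 {R : realType} (th M : R) n :
  0 <= M -> hoelder_class th M n (fun=> 0).
Proof.
move=> M0; elim: n => [|n IH]; split=> [u _|]; rewrite ?normr0//.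
  by move=> u v _ _; rewrite subrr normr0 mulr_ge0 ?powR_ge0.
by exists (fun=> 0) => // u _; exact: is_derive_cst.
Qed.

(** * Laguerre functions in the variable [w = (k + 1) u] *)

Section laguerre_scaled.
Context {R : realType}.
Variable a : R.
Hypothesis a_ge0 : 0 <= a.
Implicit Types (k l : nat) (u w b : R).

Definition lag_exp k b u : R := lag k b u * expR (- (u / 2)).

Lemma is_derive_lag_exp k b u :
  is_derive u 1 (lag_exp k b) (2^-1 * lag_exp k b u - lag_exp k (b + 1) u).
Proof.
have h1 : is_derive u 1 (fun u : R => - (u / 2)) (- 2^-1).
  apply: is_derive_oppr; have := is_derive_affine u 2^-1 0.
  by rewrite (_ : (fun t => _) = (fun t => t / 2))//; apply/funext => t; rewrite addr0 mulrC.
apply: is_derive_eq (is_derive_mulr (is_derive_lag k b u) (is_derive_expr_comp h1)) _.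
by rewrite /lag_exp; field.
Qed.

(** Rescaled and divided by [(k + 1)^(a + l)], the function satisfies [lag_bound] with a right-hand
    side free of [k]. The index [l] counts how often differentiation has raised the order. *)
Definition lag_scaled k l w : R :=
  k.+1%:R `^ (- (a + l%:R)) * lag_exp k (a + l%:R) (k.+1%:R^-1 * w).

Lemma is_derive_lag_scaled k l w : is_derive w 1 (lag_scaled k l)
  ((2 * k.+1%:R)^-1 * lag_scaled k l w - lag_scaled k l.+1 w).
Proof.
have h : is_derive w 1 (fun w => lag_exp k (a + l%:R) (k.+1%:R^-1 * w))
   ((2^-1 * lag_exp k (a + l%:R) (k.+1%:R^-1 * w) -
      lag_exp k (a + l%:R + 1) (k.+1%:R^-1 * w)) * k.+1%:R^-1).
  apply: (@is_derive1_comp _ (lag_exp k (a + l%:R)) (fun w => k.+1%:R^-1 * w)).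
    exact: is_derive_lag_exp.
  by rewrite -[X in is_derive _ _ _ X]mulr1; apply: is_derive_mulrc.
apply: is_derive_eq (is_derive_mulrc _ h) _.
rewrite /lag_scaled -[l.+1%:R]natr1 [a + (_ + 1)]addrA.
have -> : k.+1%:R `^ (- (a + l%:R + 1)) = k.+1%:R `^ (- (a + l%:R)) / k.+1%:R :> R.
  by rewrite opprD gt0_powRD// powR_inv1.
by field; rewrite nat1r pnatr_eq0.
Qed.

Lemma lag_scaled_le l : exists2 C : R, 0 < C & forall k w, 0 <= w ->
  `|lag_scaled k l w| <= C * (1 + w) `^ (- (a / 2)).
Proof.
have al0 : 0 <= a + l%:R by rewrite addr_ge0.
have [C C0 H] := lag_bound al0.
exists C => // k w w0; set K : R := k.+1%:R.
have K0 : 0 < K by rewrite ltr0n.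
have w0' : 0 <= K^-1 * w by rewrite mulr_ge0 ?invr_ge0// ltW.
have := H k _ w0'; rewrite -/K mulVKf ?gt_eqF// => h.
rewrite /lag_scaled /lag_exp normrM ger0_norm ?powR_ge0// normrM.
rewrite (ger0_norm (expR_ge0 _)) -/K powRN ler_pdivrMl ?powR_gt0//.
apply: le_trans h _; rewrite mulrCA ler_pM2l ?powR_gt0// ler_pM2l//.
apply: ler_powR; first by rewrite lerDl.
by rewrite lerN2 ler_pM2r// lerDl.
Qed.

(** For [i = l = 0] this is the Laguerre function up to a factor depending on [k]. The index [i]
    counts the derivatives spent on the power; the family is closed under differentiation, with
    coefficients bounded in [k]. *)
Definition lag_profile k i l w : R := w `^ (a / 2 - i%:R) * lag_scaled k l w.

Lemma is_derive_lag_profile k i l w : 0 < w -> is_derive w 1 (lag_profile k i l)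
  ((a / 2 - i%:R) * lag_profile k i.+1 l w +
   ((2 * k.+1%:R)^-1 * lag_profile k i l w + (-1) * lag_profile k i l.+1 w)).
Proof.
move=> w0.
have h := is_derive_mulr (is_derive1_powR (a / 2 - i%:R) w0) (is_derive_lag_scaled k l w).
apply: is_derive_eq h _; rewrite /lag_profile.
have -> : a / 2 - i.+1%:R = a / 2 - i%:R - 1 by rewrite -(natr1 i); ring.
ring.
Qed.

Lemma lag_profile_le i l : 0 <= a / 2 - i%:R -> exists2 C : R, 0 < C & forall k w, 0 < w ->
  `|lag_profile k i l w| <= C.
Proof.
move=> b0; have [C C0 H] := lag_scaled_le l.
exists C => // k w w0; rewrite /lag_profile normrM ger0_norm ?powR_ge0//.
apply: le_trans (ler_wpM2l (powR_ge0 _ _) (H k w (ltW w0))) _.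
rewrite mulrCA ger_pMr// powRN ler_pdivrMr ?mul1r ?powR_gt0//; last by lra.
apply: (@le_trans _ _ ((1 + w) `^ (a / 2 - i%:R))).
  by apply: ge0_ler_powR; rewrite ?nnegrE//; lra.
by apply: ler_powR; rewrite ?lerDl ?(ltW w0)// gerBl.
Qed.

Lemma hoelder_of_bounded (f : R -> R) (C C' b th : R) : 0 < th <= b ->
  b <= 1 -> 0 <= C -> 0 <= C' -> (forall w, 0 < w -> `|f w| <= C) ->
  (forall v u, 0 < v -> v <= u -> `|f u - f v| <= C' * ((u - v) `^ b + (u - v))) ->
  forall u v, 0 < u -> 0 < v -> `|f u - f v| <= (2 * C + 2 * C') * `|u - v| `^ th.
Proof.
move=> /andP[th0 thb] b1 C0 C'0 fC fH u v u0 v0.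
have t0 : 0 <= `|u - v| `^ th by exact: powR_ge0.
have [uv1|uv1] := leP 1 `|u - v|.
  have t1 : 1 <= `|u - v| `^ th.
    by rewrite -[leLHS](powRr0 `|u - v|) ler_powR// ltW.
  apply: le_trans (ler_normB _ _) _.
  have := fC u u0; have := fC v v0.
  have : 2 * C * 1 <= 2 * C * `|u - v| `^ th by rewrite ler_wpM2l// mulr_ge0.
  have : 0 <= 2 * C' * `|u - v| `^ th by rewrite !mulr_ge0.
  lra.
have h : `|f u - f v| <= C' * (`|u - v| `^ b + `|u - v|).
  have /orP[uv|vu] := le_total u v.
    by rewrite distrC (distrC u) (ger0_norm (_ : 0 <= v - u)) ?subr_ge0// fH.
  by rewrite (ger0_norm (_ : 0 <= u - v)) ?subr_ge0// fH.
have [uv0|uvn0] := eqVneq `|u - v| 0.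
  move: uv0 => /eqP; rewrite normr_eq0 subr_eq0 => /eqP ->.
  by rewrite !subrr normr0 mulr_ge0 ?powR_ge0// addr_ge0// mulr_ge0.
have uvp : 0 < `|u - v| by rewrite lt_neqAle eq_sym uvn0 normr_ge0.
have h1 : `|u - v| `^ b <= `|u - v| `^ th by rewrite ger_powR// uvp ltW.
have h2 : `|u - v| <= `|u - v| `^ th.
  rewrite -[leLHS]powRr1//; apply: ger_powR; first by rewrite uvp ltW.
  exact: le_trans b1.
have : C' * (`|u - v| `^ b + `|u - v|) <= C' * (`|u - v| `^ th + `|u - v| `^ th).
  by rewrite ler_wpM2l// lerD.
have : 0 <= 2 * C * `|u - v| `^ th by rewrite !mulr_ge0.
lra.
Qed.

(** An exponent [a / 2 - i >= 1] leaves a bounded derivative. Otherwise the increment is that of the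
    power, which is Hoelder, times a bounded factor, plus the power at [v] times the increment of
    [lag_scaled], whose decay [(1 + v)^(- a / 2)] absorbs the power. *)
Lemma lag_profile_hoelder th i l : 0 < th <= 1 ->
  a / 2 - i%:R = 0 \/ th <= a / 2 - i%:R ->
  exists2 C : R, 0 < C & forall k, hoelder_class th C 0 (lag_profile k i l).
Proof.
move=> /andP[th0 th1] hb.
have b0 : 0 <= a / 2 - i%:R by case: hb => [->//|]; apply: le_trans; exact: ltW.
have [C C0 HC] := lag_profile_le l b0.
suff [b [C' [bth b1 C'0 H]]] : exists b C' : R, [/\ th <= b, b <= 1, 0 <= C' &
    forall k v u, 0 < v -> v <= u ->
    `|lag_profile k i l u - lag_profile k i l v| <= C' * ((u - v) `^ b + (u - v))].
  exists (2 * C + 2 * C') => [|k]; first by rewrite ltr_pwDl ?mulr_gt0 ?mulr_ge0.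
  split=> [w w0|u v u0 v0].
    apply: le_trans (HC k w w0) _.
    have : 0 <= 2 * C' by rewrite mulr_ge0.
    lra.
  apply: (@hoelder_of_bounded _ _ _ b) => //; rewrite ?th0 ?(ltW C0)//.
    exact: HC.
  exact: H.
have [b1|b1] := leP 1 (a / 2 - i%:R).
  have b1' : 0 <= a / 2 - i.+1%:R by rewrite -(natr1 i); lra.
  have [C1 C10 HC1] := lag_profile_le l b1'.
  have [C2 C20 HC2] := lag_profile_le l.+1 b0.
  have G0 : 0 <= (a / 2 - i%:R) * C1 + (C + C2).
    apply: addr_ge0; first by apply: mulr_ge0 => //; exact: ltW.
    by apply: addr_ge0; exact: ltW.
  exists 1, ((a / 2 - i%:R) * C1 + (C + C2)); split => //.
  move=> k v u v0 vu.
  apply: (@le_trans _ _ (((a / 2 - i%:R) * C1 + (C + C2)) * `|u - v|)); last first.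
    by rewrite ger0_norm ?subr_ge0// ler_wpM2l// lerDr powR_ge0.
  apply: (@mean_value_le R (lag_profile k i l) (fun w =>
     (a / 2 - i%:R) * lag_profile k i.+1 l w +
      ((2 * k.+1%:R)^-1 * lag_profile k i l w + (-1) * lag_profile k i l.+1 w))).
    move=> t; rewrite (min_idPl vu) => /andP[vt _].
    by apply: is_derive_lag_profile; exact: lt_le_trans vt.
  move=> t; rewrite (min_idPl vu) => /andP[vt _].
  have t0 : 0 < t by exact: lt_le_trans vt.
  apply: le_trans (ler_normD _ _) _; apply: lerD.
    by rewrite normrM (ger0_norm b0) ler_wpM2l// HC1.
  apply: le_trans (ler_normD _ _) _; apply: lerD; last first.
    by rewrite mulN1r normrN HC2.
  rewrite normrM ger0_norm ?invr_ge0 ?mulr_ge0// -[leRHS]mul1r ler_pM ?HC//.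
  by rewrite invf_le1 ?mulr_gt0// -[leLHS]mulr1 ler_pM ?ler1n// ler1n.
have [C1 C10 HC1] := lag_scaled_le l.
have [C2 C20 HC2] := lag_scaled_le l.+1.
(* For exponent [0] the power is constant and any Hoelder exponent would do; the value [1] gives
   [th <= b] in both cases. *)
pose b := if a / 2 - i%:R == 0 then 1 else a / 2 - i%:R.
have bth : th <= b.
  by rewrite /b; case: ifPn => // bn0; case: hb bn0 => // ->; rewrite eqxx.
have bl1 : b <= 1 by rewrite /b; case: ifP => // _; exact: ltW.
exists b, (C1 + (C1 + C2)); split => //.
  by rewrite !addr_ge0 ?(ltW C10) ?(ltW C20).
move=> k v u v0 vu; rewrite /lag_profile.
have u0 : 0 < u by exact: lt_le_trans vu.
have -> : u `^ (a / 2 - i%:R) * lag_scaled k l u - v `^ (a / 2 - i%:R) * lag_scaled k l v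
  = (u `^ (a / 2 - i%:R) - v `^ (a / 2 - i%:R)) * lag_scaled k l u +
    v `^ (a / 2 - i%:R) * (lag_scaled k l u - lag_scaled k l v) by ring.
apply: le_trans (ler_normD _ _) _.
have small C' w : 0 < C' -> v <= w -> C' * (1 + w) `^ (- (a / 2)) <= C' * (1 + v) `^ (- (a / 2)).
  move=> C'0 vw; rewrite ler_pM2l// !powRN lef_pV2 ?posrE ?powR_gt0//; try lra.
  by apply: ge0_ler_powR; rewrite ?nnegrE ?divr_ge0//; lra.
have vle : v `^ (a / 2 - i%:R) * (1 + v) `^ (- (a / 2)) <= 1.
  rewrite powRN ler_pdivrMr ?mul1r ?powR_gt0//; last by lra.
  apply: (@le_trans _ _ ((1 + v) `^ (a / 2 - i%:R))).
    by apply: ge0_ler_powR; rewrite ?nnegrE//; lra.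
  by apply: ler_powR; rewrite ?lerDl ?(ltW v0)// gerBl.
have S1 : `|lag_scaled k l u| <= C1.
  apply: le_trans (HC1 k u (ltW u0)) _; rewrite ger_pMr//.
  rewrite powRN invf_le1 ?powR_gt0//; last lra.
  by rewrite -[leLHS](powRr0 (1 + u)) ler_powR ?lerDl ?(ltW u0) ?divr_ge0.
have T1 : `|u `^ (a / 2 - i%:R) - v `^ (a / 2 - i%:R)| <= (u - v) `^ b.
  rewrite /b; case: ifPn => [/eqP ->|bn0].
    by rewrite !powRr0 subrr normr0 powR_ge0.
  rewrite ger0_norm; last by rewrite subr_ge0 ge0_ler_powR// ?nnegrE ltW.
  by apply: powR_sub_le => //; rewrite ?(ltW v0)// lt_neqAle eq_sym bn0 b0 ltW.
have T2 : v `^ (a / 2 - i%:R) * `|lag_scaled k l u - lag_scaled k l v| <= (C1 + C2) * (u - v).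
  have D : `|lag_scaled k l u - lag_scaled k l v| <=
      (C1 + C2) * (1 + v) `^ (- (a / 2)) * `|u - v|.
    apply: (@mean_value_le R (lag_scaled k l) (fun w =>
      (2 * k.+1%:R)^-1 * lag_scaled k l w - lag_scaled k l.+1 w)) => t.
      by move=> _; exact: is_derive_lag_scaled.
    rewrite (min_idPl vu) => /andP[vt _]; have t0 : 0 <= t by lra.
    rewrite [(C1 + C2) * _]mulrDl; apply: le_trans (ler_normB _ _) _; apply: lerD; last first.
      exact: le_trans (HC2 k t t0) (small _ _ C20 vt).
    rewrite normrM ger0_norm ?invr_ge0 ?mulr_ge0//.
    apply: le_trans (le_trans (HC1 k t t0) (small _ _ C10 vt)).
    rewrite ler_piMl//.
    by rewrite invf_le1 ?mulr_gt0// -[leLHS]mulr1 ler_pM ?ler1n// ler1n.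
  apply: le_trans (ler_wpM2l (powR_ge0 _ _) D) _.
  rewrite ger0_norm ?subr_ge0// !mulrA ler_wpM2r ?subr_ge0//.
  by rewrite mulrAC ler_piMl ?addr_ge0 ?(ltW C10) ?(ltW C20).
rewrite normrM [`|v `^ _ * _|]normrM (ger0_norm (powR_ge0 v _)).
have X0 : 0 <= (u - v) `^ b by exact: powR_ge0.
have : `|u `^ (a / 2 - i%:R) - v `^ (a / 2 - i%:R)| * `|lag_scaled k l u| <= (u - v) `^ b * C1.
  by rewrite ler_pM.
have : 0 <= (C1 + C2) * (u - v) `^ b by rewrite mulr_ge0// addr_ge0 ?ltW.
have : 0 <= C1 * (u - v) by rewrite mulr_ge0 ?subr_ge0// ltW.
nra.
Qed.

Variables (P : nat) (th : R).
Hypothesis th01 : 0 < th <= 1.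
Hypothesis ha : (exists2 m : nat, (m <= P)%N & a = (2 * m)%:R) \/ P%:R + th <= a / 2.

(** The condition on the order enters here: the exponent of the power descends by [1] per
    derivative, and either reaches [0], where the next derivative of the power has coefficient [0],
    or remains at least [th] for all [i <= P]. *)
Let good i := a / 2 - i%:R = 0 \/ th <= a / 2 - i%:R.

Let goodS i : (i < P)%N -> good i -> a / 2 - i%:R != 0 -> good i.+1.
Proof.
have /andP[th0 th1] := th01.
move=> iP gi an0; case: ha => [[m mP am]|Pa]; last first.
  right; have : i.+1%:R <= P%:R :> R by rewrite ler_nat.
  lra.
have am2 : a / 2 = m%:R by rewrite am natrM mulrC mulKf.
move: an0 gi; rewrite /good am2 => an0 gi.
have im : (i < m)%N.
  rewrite ltnNge; apply/negP => mi; move: an0; rewrite subr_eq0 eqr_nat => an0.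
  have mi' : (m < i)%N by rewrite ltn_neqAle an0 mi.
  move: gi => [/eqP|]; first by rewrite subr_eq0 eqr_nat (negbTE an0).
  have : m%:R <= i%:R :> R by rewrite ler_nat.
  lra.
rewrite -!natrB//.
have [->|imS] := eqVneq i.+1 m; first by left; rewrite subnn.
right; apply: le_trans th1 _; rewrite ler1n subn_gt0 ltn_neqAle imS//.
Qed.

Let good0 : good 0%N.
Proof.
have /andP[th0 th1] := th01.
rewrite /good subr0; case: ha => [[m mP ->]|Pa]; last first.
  by right; apply: le_trans Pa; rewrite lerDr.
rewrite natrM mulrC mulKf//; case: m mP => [|m] _; [by left|right].
by apply: le_trans th1 _; rewrite ler1n.
Qed.

Lemma lag_profile_class n i l : (i + n <= P)%N -> good i ->
  exists2 C : R, 0 < C & forall k, hoelder_class th C n (lag_profile k i l).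
Proof.
elim: n i l => [|n IH] i l inP gi; first exact: lag_profile_hoelder.
have /andP[th0 th1] := th01.
have b0 : 0 <= a / 2 - i%:R by case: gi => [->//|]; apply: le_trans; exact: ltW.
have [C0 C00 H0] := lag_profile_le l b0.
have inP' : (i + n <= P)%N by rewrite (leq_trans _ inP)// addnS.
have [C1 C10 H1] := IH i l inP' gi.
have [C2 C20 H2] := IH i l.+1 inP' gi.
have [C3 C30 H3] : exists2 C : R, 0 < C & forall k, hoelder_class th C n
    (fun w => (a / 2 - i%:R) * lag_profile k i.+1 l w).
  have [->|bn0] := eqVneq (a / 2 - i%:R) 0.
    exists 1 => // k; apply: (@hoelder_class_eq _ _ _ _ (fun=> 0)).
      by move=> u _; rewrite mul0r.
    exact: hoelder_class0.
  have iP : (i < P)%N by rewrite (leq_trans _ inP)// -addn1 leq_add2l.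
  have [||C C'0 H] := IH i.+1 l; first by rewrite addSnnS.
    exact: goodS.
  exists ((a / 2 - i%:R) * C) => [|k].
    by rewrite mulr_gt0// lt_neqAle eq_sym bn0.
  by apply: hoelder_classZ; rewrite ?ger0_norm.
exists (C0 + (C3 + (1 * C1 + 1 * C2))) => [|k].
  by rewrite !addr_gt0// mulr_gt0.
split=> [w w0|].
  apply: le_trans (H0 k w w0) _; rewrite lerDl.
  by rewrite !addr_ge0 ?mulr_ge0 ?(ltW C30) ?(ltW C10) ?(ltW C20).
exists (fun w => (a / 2 - i%:R) * lag_profile k i.+1 l w +
   ((2 * k.+1%:R)^-1 * lag_profile k i l w + (-1) * lag_profile k i l.+1 w)).
  by move=> u u0; exact: is_derive_lag_profile.
apply: (@hoelder_class_le _ _ (C3 + (1 * C1 + 1 * C2))); first by rewrite lerDr ltW.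
apply: hoelder_classD; first exact: H3.
apply: hoelder_classD; apply: hoelder_classZ => //.
  rewrite ger0_norm ?invr_ge0 ?mulr_ge0// invf_le1 ?mulr_gt0//.
  by rewrite -[leLHS]mulr1 ler_pM ?ler1n// ler1n.
by rewrite normrN1.
Qed.

(** The rescaling leaves a factor [K^(a / 2)] with [K = k + 1]. By [gamma_ratio] and the lower half
    of [rising_asymp] the normalising constant is at most a multiple of [K^(- a / 2)], so the
    product is bounded in [k]. *)
Lemma laguerre1_class : exists2 M : R, 0 < M & forall k, exists2 g,
  hoelder_class th M P g & forall u, 0 < u -> laguerre1 k a u = g (k.+1%:R * u).
Proof.
have [C C0 H] := @lag_profile_class P 0 0 (leqnn P) good0.
have [c [C' [c0 C'0 HR]]] := rising_asymp a_ge0.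
have G0 : 0 < gamma_function (a + 1) by apply: gamma_gt0; rewrite lerDr.
pose B := Num.sqrt ((gamma_function (a + 1) * c)^-1).
have B0 : 0 < B by rewrite sqrtr_gt0 invr_gt0 mulr_gt0.
exists (B * C) => [|k]; first by rewrite mulr_gt0.
set K : R := k.+1%:R; have K0 : 0 < K by rewrite ltr0n.
pose ck := Num.sqrt (gamma_function (k%:R + 1) / gamma_function (k%:R + a + 1)).
exists (fun w => (ck * K `^ (a / 2)) * lag_profile k 0 0 w).
  apply: hoelder_classZ; last exact: H.
  rewrite ger0_norm ?mulr_ge0 ?sqrtr_ge0 ?powR_ge0//.
  have -> : K `^ (a / 2) = Num.sqrt (K `^ a).
    by rewrite -powR12_sqrt ?powR_ge0// -powRrM.
  rewrite -sqrtrM; last by rewrite gamma_ratio// invr_ge0 mulr_ge0 ?(ltW G0)// rising_ge0// addr_ge0.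
  rewrite ler_sqrt; last by rewrite invr_ge0 mulr_ge0 ?ltW.
  rewrite gamma_ratio// mulrC ler_pdivrMr; last by rewrite mulr_gt0// rising_gt0// ltr_wpDl.
  rewrite ler_pdivlMl ?mulr_gt0//.
  have /andP[h _] := HR k; rewrite -mulrA ler_pM2l//.
move=> u u0; rewrite /laguerre1 -/ck /lag_profile subr0 /lag_scaled addr0 /lag_exp.
rewrite -/K mulKf ?gt_eqF// -/(lag k a u) powRM ?(ltW K0) ?(ltW u0)//.
have -> : K `^ (- a) = (K `^ (a / 2))^-1 * (K `^ (a / 2))^-1.
  by rewrite -!powRN -gt0_powRD//; congr (_ `^ _); lra.
field; rewrite gt_eqF// powR_gt0//.
Qed.

End laguerre_scaled.

(** * Pairing of atoms with product functions *)

Section integral_rV.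
Context {R : realType}.
Local Notation leb := (@lebesgue_measure R).

(* Same as [measurable_rV_cons], for the sigma-algebra of [lebesgue_measure] on
   the first factor: unification does not identify the two structures. *)
Let mrc n : measurable_fun [set: measurableTypeR R * 'rV[R]_n] (@rV_cons R n).
Proof. exact: measurable_rV_cons. Qed.

Let ge0_integral_rV_pushforward n (f : 'rV[R]_n.+1 -> \bar R) :
  measurable_fun setT f -> (forall x, 0 <= f x)%E ->
  (\int[lebesgue_rV n.+1]_x f x =
   \int[leb \x lebesgue_rV n]_z (f \o @rV_cons R n) z)%E.
Proof.
move=> mf f0.
have := @ge0_integral_pushforward _ _ _ _ R _ (@mrc n) (leb \x lebesgue_rV n)%E
  setT f measurableT mf.
by rewrite preimage_setT; apply=> x _; exact: f0.
Qed.

Lemma ge0_integral_rVS n (f : 'rV[R]_n.+1 -> \bar R) :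
  measurable_fun setT f -> (forall x, 0 <= f x)%E ->
  (\int[lebesgue_rV n.+1]_x f x =
   \int[leb]_t \int[lebesgue_rV n]_x f (rV_cons (t, x)))%E.
Proof.
move=> mf f0.
rewrite ge0_integral_rV_pushforward//.
rewrite fubini_tonelli1//.
- exact: (measurableT_comp mf (@mrc n)).
- by move=> x; exact: f0.
Qed.

Lemma integral_rV0 (f : 'rV[R]_0 -> \bar R) : (\int[lebesgue_rV 0]_x f x = f 0%R)%E.
Proof.
rewrite (_ : f = cst (f 0%R)); last by apply/funext => x; rewrite (thinmx0 x).
by rewrite integral_cst//= diracT mule1.
Qed.

Lemma measurable_prod_coord n (f : 'I_n -> R -> R) :
  (forall i, measurable_fun setT (f i)) ->
  measurable_fun setT (fun x : 'rV[R]_n => \prod_(i < n) f i (x ord0 i)).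
Proof.
move=> mf; apply: measurable_prod => i _.
by apply: measurableT_comp => //; exact: measurable_coord.
Qed.

Lemma prod_rV_cons n (f : 'I_n.+1 -> R -> R) t x :
  \prod_(i < n.+1) f i (rV_cons (t, x) ord0 i) =
  f ord0 t * \prod_(i < n) f (lift ord0 i) (x ord0 i).
Proof.
rewrite big_ord_recl mxE unlift_none; congr (_ * _).
by apply: eq_bigr => i _; rewrite mxE liftK.
Qed.

Lemma ge0_integral_prod_rV n (f : 'I_n -> R -> R) :
  (forall i, measurable_fun setT (f i)) -> (forall i t, 0 <= f i t) ->
  (\int[lebesgue_rV n]_x (\prod_(i < n) f i (x ord0 i))%:E =
   \prod_(i < n) \int[leb]_t (f i t)%:E)%E.
Proof.
elim: n f => [|n IH] f mf f0; first by rewrite integral_rV0 !big_ord0.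
rewrite ge0_integral_rVS; last 2 first.
- by apply/measurable_EFinP; exact: measurable_prod_coord.
- by move=> x; rewrite lee_fin prodr_ge0.
rewrite big_ord_recl -IH//.
under eq_integral => t _.
  under eq_integral => x _ do rewrite prod_rV_cons EFinM.
  rewrite ge0_integralZl_EFin//; last 2 first.
  - by move=> x _; rewrite lee_fin prodr_ge0.
  - apply/measurable_EFinP.
    exact: (measurable_prod_coord (f := fun i => f (lift ord0 i))).
  over.
rewrite ge0_integralZr//.
- by apply/measurable_EFinP; exact: mf.
- by move=> t _; rewrite lee_fin.
- by apply: integral_ge0 => x _; rewrite lee_fin prodr_ge0.
Qed.

Lemma integrable_prod_rV n (f : 'I_n -> R -> R) :
  (forall i, leb.-integrable setT (EFin \o f i)) ->
  (lebesgue_rV n).-integrable setT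
    (fun x => (\prod_(i < n) f i (x ord0 i))%:E).
Proof.
move=> intf.
have mf i : measurable_fun setT (f i).
  by have /measurable_int/measurable_EFinP := intf i.
apply/integrableP; split; first by apply/measurable_EFinP; exact: measurable_prod_coord.
under eq_integral => x _.
  rewrite abse_EFin normr_prod; over.
rewrite (ge0_integral_prod_rV (f := fun i t => `|f i t|)) => //; last first.
  by move=> i; apply: measurableT_comp.
have fin i : (\int[leb]_t `|f i t|%:E)%E \is a fin_num.
  have := intf i => /integrableP[_] h.
  by rewrite ge0_fin_numE// integral_ge0.
suff : (\prod_(i < n) \int[leb]_t `|f i t|%:E)%E \is a fin_num.
  by rewrite fin_numElt => /andP[].
by elim/big_ind : _ => // x y; exact: fin_numM.
Qed.

Lemma Rintegral_prod_rV n (f : 'I_n -> R -> R) :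
  (forall i, leb.-integrable setT (EFin \o f i)) ->
  \int[lebesgue_rV n]_x (\prod_(i < n) f i (x ord0 i)) =
  \prod_(i < n) \int[leb]_t f i t.
Proof.
elim: n f => [|n IH] f intf.
  by rewrite /Rintegral integral_rV0 !big_ord0.
have mf i : measurable_fun setT (f i).
  by have /measurable_int/measurable_EFinP := intf i.
have I := integrable_prod_rV intf.
pose F (x : 'rV[R]_n.+1) := (\prod_(i < n.+1) f i (x ord0 i))%:E.
have mF : measurable_fun setT F.
  by apply/measurable_EFinP; exact: measurable_prod_coord.
have Ic : (leb \x lebesgue_rV n)%E.-integrable setT (F \o @rV_cons R n).
  apply/integrableP; split; first exact: (measurableT_comp mF (@mrc n)).
  have /integrableP[_] := I; rewrite (_ : (\int[_]_x _)%E =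
    (\int[leb \x lebesgue_rV n]_z `|(F \o @rV_cons R n) z|)%E)//.
  rewrite (ge0_integral_rV_pushforward (f := fun x => `|F x|%E))//.
  by apply: measurableT_comp.
rewrite /Rintegral.
transitivity (fine (\int[leb \x lebesgue_rV n]_z (F \o @rV_cons R n) z)%E).
  congr fine; have := @integral_pushforward _ _ _ _ R _ (@mrc n)
    (leb \x lebesgue_rV n)%E setT F mF.
  by rewrite preimage_setT; apply.
rewrite -integral12_prod_meas1//= /fubini_F.
rewrite big_ord_recl -IH//.
have I' := @integrable_prod_rV n (fun i => f (lift ord0 i)) (fun i => intf _).
under eq_integral => t _.
  under eq_integral => x _ do rewrite /F /comp prod_rV_cons EFinM.
  rewrite integralZl//=.
  over.
have -> : (\int[lebesgue_rV n]_x (\prod_(i < n) f (lift ord0 i) (x ord0 i))%:E)%E =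
   (\int[lebesgue_rV n]_x \prod_(i < n) f (lift ord0 i) (x ord0 i))%:E.
  by rewrite /Rintegral fineK// integrable_fin_num.
rewrite integralZr//; last exact: intf.
by rewrite fineM// integrable_fin_num//; exact: intf.
Qed.

End integral_rV.

Section balls.
Context {R : realType} {d : nat}.
Local Notation V := 'rV[R]_d.
Local Notation mu := (@lebesgue_rV R d).

Lemma measurable_euclidean_ball (c : V) (r : R) : measurable (euclidean_ball c r).
Proof.
pose f (x : V) := Num.sqrt (\sum_(i < d) (x ord0 i - c ord0 i) ^+ 2).
have mf : measurable_fun setT f.
  apply: (@measurableT_comp _ _ _ _ _ _ (@Num.sqrt R)).
    by apply: continuous_measurable_fun; exact: sqrt_continuous.
  apply: measurable_sum => i; apply: measurable_funX.
  by apply: measurable_funB; [exact: measurable_coord|exact: measurable_cst].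
rewrite (_ : euclidean_ball c r = setT `&` f @^-1` `]-oo, r[%classic).
  by apply: mf.
by apply/seteqP; split => x /=; rewrite in_itv/= => // -[].
Qed.

Lemma measurable_box (A : 'I_d -> set R) : (forall i, measurable (A i)) ->
  measurable [set x : V | forall i, A i (x ord0 i)].
Proof.
move=> mA; rewrite (_ : mkset _ = \bigcap_(i in [set: 'I_d])
    (fun x : V => x ord0 i) @^-1` A i); last first.
  by apply/seteqP; split => x /= Ax i; [move=> _|]; exact: Ax.
apply: fin_bigcap_measurable => // i _.
by rewrite -[X in measurable X]setTI; exact: measurable_coord.
Qed.

Lemma measurable_orthant : measurable (orthant R d).
Proof.
rewrite (_ : orthant R d = [set x : V | forall i, `]0, +oo[%classic (x ord0 i)]).
  exact: (@measurable_box (fun=> `]0, +oo[%classic) (fun=> measurable_itv _)).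
by apply/seteqP; split => x /= h i; have := h i; rewrite /= in_itv/= andbT.
Qed.

Lemma euclidean_ball_coord (c x : V) (r : R) :
  euclidean_ball c r x -> forall i, `|x ord0 i - c ord0 i| < r.
Proof.
move=> /= h i; apply: le_lt_trans h; rewrite -sqrtr_sqr.
by apply: ler_wsqrtr; rewrite (bigD1 i)//= lerDl sumr_ge0// => j _; exact: sqr_ge0.
Qed.

Hypothesis d_gt0 : (0 < d)%N.

Lemma euclidean_ball_of_coord (c x : V) (r : R) : 0 < r ->
  (forall i, `|x ord0 i - c ord0 i| < r / d%:R) -> euclidean_ball c r x.
Proof.
move=> r0 h; rewrite /euclidean_ball /=.
have dR : 0 < d%:R :> R by rewrite ltr0n.
rewrite -[X in _ < X](ger0_norm (ltW r0)) -sqrtr_sqr ltr_sqrt ?exprn_gt0//.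
apply: (@lt_le_trans _ _ (\sum_(i < d) (r / d%:R) ^+ 2)).
  have := @ltr_sum R 'I_d (index_enum _) xpredT
    (fun i => (x ord0 i - c ord0 i) ^+ 2) (fun=> (r / d%:R) ^+ 2).
  apply; last first.
    move=> i _; rewrite -[ltLHS]real_normK ?num_real// ltrXn2r//.
  by apply/hasP; exists (Ordinal d_gt0); rewrite // mem_index_enum.
rewrite sumr_const card_ord -[X in X <= _]mulr_natl.
have -> : d%:R * (r / d%:R) ^+ 2 = r ^+ 2 / d%:R by field; rewrite gt_eqF.
by rewrite ler_pdivrMr// ler_peMr ?exprn_ge0 ?(ltW r0)// ler1n.
Qed.

Let box_measure (c : V) (r : R) : 0 < r ->
  mu [set x : V | forall i, `](c ord0 i - r), (c ord0 i + r)[%classic (x ord0 i)] =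
  ((2 * r) ^+ d)%:E.
Proof.
move=> r0; rewrite (@lebesgue_rV_box _ _
  (fun i => `](c ord0 i - r), (c ord0 i + r)[%classic)) => [|i]; last exact: measurable_itv.
under eq_bigr => i _.
  rewrite lebesgue_measure_itv/= lte_fin ltrD2l gtrN// -EFinB.
  rewrite (_ : _ - _ = 2 * r); last by ring.
  over.
by rewrite prodEFin prodr_const card_ord.
Qed.

(** Cubes inside and around the ball suffice, as only the order [r ^ d] of its measure is used. *)
Lemma euclidean_ball_measure (c : V) (r : R) : 0 < r ->
  exists2 m : R, mu (euclidean_ball c r) = m%:E &
    (2 * (r / d%:R)) ^+ d <= m <= (2 * r) ^+ d.
Proof.
move=> r0; have dR : 0 < d%:R :> R by rewrite ltr0n.
have rd0 : 0 < r / d%:R by rewrite divr_gt0.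
have hE i (x : V) (e : R) : (`|x ord0 i - c ord0 i| < e) =
    (c ord0 i - e < x ord0 i < c ord0 i + e).
  by rewrite ltr_distl.
have mbox (e : R) : measurable [set x : V |
    forall i, `](c ord0 i - e), (c ord0 i + e)[%classic (x ord0 i)].
  exact: (@measurable_box (fun i => `](c ord0 i - e), (c ord0 i + e)[%classic)
    (fun=> measurable_itv _)).
have h1 : (((2 * (r / d%:R)) ^+ d)%:E <= mu (euclidean_ball c r))%E.
  rewrite -(box_measure c rd0) le_measure ?inE//.
  - exact: measurable_euclidean_ball.
  - move=> x /= h; apply: euclidean_ball_of_coord => // i; rewrite hE.
    by have := h i; rewrite in_itv.
have h2 : (mu (euclidean_ball c r) <= ((2 * r) ^+ d)%:E)%E.
  rewrite -(box_measure c r0) le_measure ?inE//.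
  - exact: measurable_euclidean_ball.
  - by move=> x /euclidean_ball_coord h i; have := h i; rewrite hE /= in_itv.
move: h1 h2; case: (mu (euclidean_ball c r)) => [m| |]//.
by rewrite !lee_fin => h1 h2; exists m => //; rewrite h1.
Qed.

(** Hoelder's inequality against the indicator of the ball. The estimates for atoms start from this
    [L^1] bound, so they hold alike for every [q >= 1]. *)
Lemma Lnorm_le_L1 (q : \bar R) (a : V -> R) (c : V) (r e : R) : 0 < r ->
  (1 <= q)%E -> measurable_fun setT a ->
  (forall x, ~ euclidean_ball c r x -> a x = 0) ->
  ('N[mu]_q[EFin \o a] <= mu (euclidean_ball c r) `^ ((fine q)^-1 - e))%E ->
  (\int[mu]_x `|a x|%:E <= mu (euclidean_ball c r) `^ (1 - e))%E.
Proof.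
move=> r0 q1 ma a0 aq; set B := euclidean_ball c r in a0 aq *.
have mB : measurable B := measurable_euclidean_ball c r.
have [m mE /andP[m1 m2]] := euclidean_ball_measure c r0.
have dR : 0 < d%:R :> R by rewrite ltr0n.
have m0 : 0 < m by apply: lt_le_trans m1; rewrite exprn_gt0// mulr_gt0// divr_gt0.
move: aq; rewrite -/B in mE *; rewrite mE.
have aB x : a x = a x * \1_B x.
  rewrite indicE; have [/set_mem xB|/negP xB] := boolP (x \in B); first by rewrite mulr1.
  by rewrite a0 ?mul0r// => /mem_set.
case: q q1 => [q| |]// q1 aq.
  rewrite lee_fin in q1; have [q1'|qn1] := eqVneq q 1.
    by move: aq; rewrite q1' Lnorm1 invr1.
  have q1' : 1 < q by rewrite lt_neqAle eq_sym qn1.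
  have q0 : 0 < q by lra.
  pose q' := (1 - q^-1)^-1.
  have q'0 : 0 < q' by rewrite invr_gt0 subr_gt0 invf_lt1.
  have mI : measurable_fun setT (\1_B : V -> R) by [].
  have := hoelder mu ma mI q0 q'0; rewrite invrK addrC subrK => /(_ erefl).
  rewrite Lnorm1 (_ : (\int[mu]_x _)%E = (\int[mu]_x `|a x|%:E)%E); last first.
    by apply: eq_integral => x _; rewrite /= -aB.
  move=> /le_trans; apply.
  have -> : ('N[mu]_q'%:E[EFin \o \1_B] = m%:E `^ (1 - q^-1))%E.
    rewrite unlock /Lnorm invrK; congr (_ `^ _)%E.
    have -> : m%:E = (\int[mu]_x (\1_B x)%:E)%E by rewrite integral_indic// setIT.
    apply: eq_integral => x _ /=.
    rewrite indicE; case: (x \in B); rewrite /= ?normr1 ?powR1//.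
    by rewrite normr0 powR0// gt_eqF.
  apply: le_trans (lee_wpmul2r _ aq) _; first exact: poweR_ge0.
  rewrite !poweR_EFin -EFinM lee_fin -gt0_powRD//.
  by rewrite le_eqVlt; apply/orP; left; apply/eqP; congr (_ `^ _); rewrite /=; lra.
(* For [q = +oo] the norm is the essential supremum only when the whole space has positive
   measure. *)
have muT : (0 < mu [set: V])%E.
  apply: (@lt_le_trans _ _ (mu B)); first by rewrite mE lte_fin.
  by rewrite le_measure ?inE.
move: aq; rewrite unlock /Lnorm muT /= invr0 add0r => aq.
rewrite (_ : (\int[mu]_x _)%E = (\int[mu]_(x in B) `|a x|%:E)%E); last first.
  rewrite [RHS]integral_mkcond; apply: eq_integral => x _.
  rewrite patchE; case: ifPn => // /negP xB.
  by rewrite a0 ?normr0// => /mem_set.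
apply: (@le_trans _ _ (\int[mu]_(x in B) (cst (m `^ (- e))%:E x))%E).
  apply: ae_ge0_le_integral => //.
  - apply/measurable_EFinP; apply: measurable_funTS.
    by apply: measurableT_comp.
  - by move=> x _; rewrite lee_fin powR_ge0.
  - have := @ess_sup_ge _ _ _ mu (abse \o (EFin \o a)).
    apply: filterS => x /= h _; apply: le_trans h _.
    exact: aq.
have -> : (\int[mu]_(x in B) cst (m `^ (- e))%:E x = (m `^ (- e))%:E * mu B)%E.
  exact: integral_cst.
by rewrite mE -EFinM lee_fin gt0_powRD// powRr1 ?(ltW m0)// mulrC.
Qed.

End balls.

Section polynomial_functions.
Context {R : realType} {d : nat}.
Local Notation V := 'rV[R]_d.
Implicit Types (f g : V -> R) (k : nat) (m : {ffun 'I_d -> nat}).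

Definition monomial m : V -> R := fun x => \prod_(i < d) x ord0 i ^+ m i.

(** Polynomial functions of total degree at most [k], generated inductively so that the vanishing
    moments of an atom pass from monomials to all of them by induction. *)
Inductive poly_le k : (V -> R) -> Prop :=
| poly_le0 : poly_le k (fun=> 0)
| poly_le_add c m f : (multi_size m <= k)%N -> poly_le k f ->
    poly_le k (fun x => c * monomial m x + f x).

Lemma poly_le_cst k c : poly_le k (fun=> c).
Proof.
rewrite (_ : (fun _ => c) = (fun x => c * monomial [ffun=> 0%N] x + 0)).
  by apply: poly_le_add (poly_le0 _); rewrite /multi_size big1// => i _; rewrite ffunE.
apply/funext => x; rewrite addr0 /monomial big1 ?mulr1// => i _.
by rewrite ffunE expr0.
Qed.

Lemma poly_leD k f g : poly_le k f -> poly_le k g -> poly_le k (fun x => f x + g x).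
Proof.
elim=> [|c m f0 mk _ IH] hg.
  by under eq_fun do rewrite add0r.
by under eq_fun do rewrite -addrA; apply: poly_le_add => //; exact: IH.
Qed.

Lemma poly_leZ k c f : poly_le k f -> poly_le k (fun x => c * f x).
Proof.
elim=> [|c' m f0 mk _ IH].
  by under eq_fun do rewrite mulr0; exact: poly_le0.
by under eq_fun do rewrite mulrDr mulrA; exact: poly_le_add.
Qed.

Lemma poly_le_weak k k' f : (k <= k')%N -> poly_le k f -> poly_le k' f.
Proof.
move=> kk; elim=> [|c m f0 mk _ IH]; first exact: poly_le0.
by apply: poly_le_add => //; exact: leq_trans kk.
Qed.

Lemma poly_le_mulX k (i : 'I_d) f : poly_le k f ->
  poly_le k.+1 (fun x => x ord0 i * f x).
Proof.
elim=> [|c m f0 mk _ IH].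
  by under eq_fun do rewrite mulr0; exact: poly_le0.
pose m' := [ffun j => (m j + (j == i))%N].
rewrite (_ : (fun x => _) = (fun x : V => c * monomial m' x + x ord0 i * f0 x)).
  apply: poly_le_add => //; rewrite /multi_size.
  under eq_bigr do rewrite ffunE; rewrite big_split /= -/(multi_size m).
  by rewrite (bigD1 i)//= eqxx big1 ?addn0 ?addn1// => j /negbTE ->.
apply/funext => x; rewrite mulrDr mulrCA; congr (c * _ + _).
rewrite /monomial (bigD1 i)//= [RHS](bigD1 i)//= ffunE eqxx addn1 exprS mulrA.
by congr (_ * _); apply: eq_bigr => j /negbTE ji; rewrite ffunE ji addn0.
Qed.

Lemma poly_le_mul_affine k (i : 'I_d) (c : R) f n : poly_le k f ->
  poly_le (k + n) (fun x => (x ord0 i - c) ^+ n * f x).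
Proof.
elim: n => [|n IH] kf.
  by rewrite addn0; under eq_fun do rewrite expr0 mul1r.
rewrite addnS (_ : (fun x => _) = (fun x : V => x ord0 i * ((x ord0 i - c) ^+ n * f x) +
   (- c) * ((x ord0 i - c) ^+ n * f x))).
  apply: poly_leD; first exact/poly_le_mulX/IH.
  by apply: poly_leZ; apply: poly_le_weak (IH kf).
by apply/funext => x; rewrite exprS; ring.
Qed.

Lemma poly_le_sum k n (f : nat -> V -> R) (P : pred nat) :
  (forall j, (j < n)%N -> P j -> poly_le k (f j)) ->
  poly_le k (fun x => \sum_(j < n | P j) f j x).
Proof.
elim: n => [|n IH] h.
  by under eq_fun do rewrite big_ord0; exact: poly_le0.
have h' : poly_le k (fun x => \sum_(j < n | P j) f j x).
  by apply: IH => j jn; exact: h (ltnW _).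
under eq_fun do rewrite big_mkcond big_ord_recr /= -big_mkcond /=.
apply: poly_leD => //.
by case: (P n) (h n (ltnSn n)) => [h0|_]; [exact: h0|exact: poly_le0].
Qed.

Lemma measurable_poly_le k f : poly_le k f -> measurable_fun setT f.
Proof.
elim=> [|c m f0 _ _ IH]; first exact: measurable_cst.
apply: measurable_funD => //; apply: measurable_funM; first exact: measurable_cst.
apply: measurable_prod => i _; apply: measurable_funX.
exact: measurable_coord.
Qed.

End polynomial_functions.

(** * Taylor expansion of products, truncated by total degree *)

Section product_taylor.
Context {R : realType}.

(** The error is [h] times the error for [Q], plus the error for [h] times the expansion of [Q],
    plus the products of total degree above [P]; the last are of order [dl^(P + 1) <= dl^ga] because
    [dl <= 1]. *)
Lemma conv_trunc_le (P : nat) (A H : nat -> R) (h Q B C dl ga : R) :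
  0 <= B -> 0 <= C -> 0 < dl -> dl <= 1 -> 0 <= ga -> ga <= P.+1%:R ->
  (forall j, (j <= P)%N -> `|A j| <= B * dl ^+ j) ->
  (forall j, (j <= P)%N -> `|H j| <= C * dl ^+ j) ->
  `|h| <= B -> `|h - \sum_(j < P.+1) A j| <= B * dl `^ ga ->
  `|Q - \sum_(j < P.+1) H j| <= C * dl `^ ga ->
  `|h * Q - \sum_(j < P.+1) \sum_(a < P.+1) \sum_(b < P.+1 | (a + b == j)%N) A a * H b|
     <= (3 * P.+1%:R ^+ 2 * (B * C)) * dl `^ ga.
Proof.
move=> B0 C0 dl0 dl1 ga0 gaP hA hH hB hhA hQ.
set L : R := P.+1%:R; have L1 : 1 <= L by rewrite ler1n.
have BC0 : 0 <= B * C by rewrite mulr_ge0.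
set D := dl `^ ga; have D0 : 0 <= D by exact: powR_ge0.
have HB : `|\sum_(j < P.+1) H j| <= L * C.
  apply: le_trans (ler_norm_sum _ _ _) _.
  rewrite /L -[X in X%:R]card_ord mulr_natl -sumr_const; apply: ler_sum => j _.
  apply: le_trans (hH _ _) _; first by rewrite -ltnS.
  by rewrite ler_piMr// exprn_ile1// ltW.
have -> : \sum_(j < P.+1) \sum_(a < P.+1) \sum_(b < P.+1 | (a + b == j)%N) A a * H b =
    \sum_(a < P.+1) \sum_(b < P.+1) (if (a + b < P.+1)%N then A a * H b else 0).
  rewrite exchange_big /=; apply: eq_bigr => a _.
  under eq_bigr do rewrite big_mkcond; rewrite exchange_big /=; apply: eq_bigr => b _.
  rewrite -big_mkcond; case: ifPn => [ab|ab].
    by rewrite (bigD1 (Ordinal ab)) //= big1 ?addr0// => j /andP[/eqP jE /negP[]]; apply/eqP/val_inj.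
  by rewrite big1// => j /eqP ab'; move: ab; rewrite ab' ltn_ord.
have E : h * Q - \sum_(a < P.+1) \sum_(b < P.+1) (if (a + b < P.+1)%N then A a * H b else 0) =
  h * (Q - \sum_(j < P.+1) H j) + (h - \sum_(j < P.+1) A j) * \sum_(j < P.+1) H j +
  \sum_(a < P.+1) \sum_(b < P.+1) (if (a + b < P.+1)%N then 0 else A a * H b).
  have -> : \sum_(a < P.+1) \sum_(b < P.+1) (if (a + b < P.+1)%N then 0 else A a * H b) =
     (\sum_(a < P.+1) A a) * (\sum_(b < P.+1) H b) -
     \sum_(a < P.+1) \sum_(b < P.+1) (if (a + b < P.+1)%N then A a * H b else 0).
    rewrite big_distrl /= -sumrB; apply: eq_bigr => a _.
    rewrite big_distrr /= -sumrB; apply: eq_bigr => b _.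
    by case: ifP; rewrite ?subrr ?subr0.
  by ring.
rewrite E; apply: le_trans (ler_normD _ _) _.
have -> : 3 * L ^+ 2 * (B * C) * D = L ^+ 2 * (B * C) * D + L ^+ 2 * (B * C) * D + L ^+ 2 * (B * C) * D by ring.
have LL : L <= L ^+ 2 by rewrite expr2 ler_peMl// ltW// (lt_le_trans _ L1).
have L2 : 1 <= L ^+ 2 by rewrite (le_trans L1).
apply: lerD; first (apply: le_trans (ler_normD _ _) _; apply: lerD).
- rewrite normrM; apply: (@le_trans _ _ (B * (C * D))); first by rewrite ler_pM.
  by rewrite mulrA -[X in _ <= X]mulrA ler_peMl// mulr_ge0.
- rewrite normrM; apply: (@le_trans _ _ ((B * D) * (L * C))); first by rewrite ler_pM.
  have -> : B * D * (L * C) = L * (B * C) * D by ring.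
  by rewrite ler_wpM2r// ler_wpM2r.
apply: le_trans (ler_norm_sum _ _ _) _.
have -> : L ^+ 2 * (B * C) * D = \sum_(a < P.+1) \sum_(b < P.+1) B * C * D.
  rewrite !sumr_const card_ord -!(mulr_natl (_ *+ _)) -[in RHS]mulr_natl -/L.
  by ring.
apply: ler_sum => a _; apply: le_trans (ler_norm_sum _ _ _) _.
apply: ler_sum => b _; case: ltnP => ab; first by rewrite normr0 mulr_ge0.
rewrite normrM; apply: (@le_trans _ _ ((B * dl ^+ a) * (C * dl ^+ b))).
  by rewrite ler_pM// ?hA ?hH// -ltnS.
rewrite mulrACA -exprD ler_wpM2l// /D -powR_mulrn ?(ltW dl0)//.
apply: ger_powR; first by rewrite dl0.
by apply: le_trans gaP _; rewrite ler_nat.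
Qed.

(** Multiplying the Taylor polynomials of all coordinates gives degrees up to [d P], whereas atoms
    annihilate total degree at most [P]; hence the pieces [H j] of degree [j] are tracked separately
    and cut at [P] after each factor. *)
Lemma product_taylor (d P : nat) (ga B : R) (s : seq 'I_d) :
  0 <= ga -> ga <= P.+1%:R -> 0 <= B -> exists2 C : R, 0 <= C &
  forall (dl : R) (D : set 'rV[R]_d) (u0 : 'I_d -> R) (h : 'I_d -> R -> R)
    (A : 'I_d -> nat -> R), 0 < dl -> dl <= 1 ->
  (forall i x, D x -> [/\ `|h i (x ord0 i)| <= B,
     forall j, (j <= P)%N -> `|A i j * (x ord0 i - u0 i) ^+ j| <= B * dl ^+ j &
     `|h i (x ord0 i) - \sum_(j < P.+1) A i j * (x ord0 i - u0 i) ^+ j| <= B * dl `^ ga]) ->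
  exists H : nat -> 'rV[R]_d -> R, [/\ forall j, (j <= P)%N -> poly_le j (H j),
    forall x, D x -> forall j, (j <= P)%N -> `|H j x| <= C * dl ^+ j &
    forall x, D x ->
    `|\prod_(i <- s) h i (x ord0 i) - \sum_(j < P.+1) H j x| <= C * dl `^ ga].
Proof.
move=> ga0 gaP B0; elim: s => [|i s [C C0 IH]].
  exists 1 => // dl D u0 h A dl0 dl1 _.
  exists (fun j => if j is 0 then (fun=> 1) else (fun=> 0)); split.
  - by case=> [|j] _; [exact: poly_le_cst|exact: poly_le0].
  - by move=> x _ [|j] _; rewrite ?normr1 ?normr0 ?expr0 ?mulr1// mul1r exprn_ge0// ltW.
  - move=> x _; rewrite big_nil big_ord_recl /= big1// addr0 subrr normr0.
    by rewrite mul1r powR_ge0.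
exists (3 * P.+1%:R ^+ 2 * (B * C)); first by rewrite !mulr_ge0.
move=> dl D u0 h A dl0 dl1 hD.
have [H [Hp HC HQ]] := IH dl D u0 h A dl0 dl1 hD.
pose H' (j : nat) (x : 'rV[R]_d) := \sum_(a < P.+1) \sum_(b < P.+1 | (a + b == j)%N)
  (A i a * (x ord0 i - u0 i) ^+ a) * H b x.
exists H'; split.
- move=> j jP; rewrite /H'.
  have := @poly_le_sum R d j P.+1 (fun a x => \sum_(b < P.+1 | (a + b == j)%N)
    (A i a * (x ord0 i - u0 i) ^+ a) * H b x) xpredT; apply.
  move=> a aP _; have := @poly_le_sum R d j P.+1 (fun b x =>
    (A i a * (x ord0 i - u0 i) ^+ a) * H b x) (fun b => (a + b == j)%N); apply.
  move=> b bP /eqP <-; under eq_fun do rewrite -mulrA.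
  by apply: poly_leZ; rewrite addnC; apply: poly_le_mul_affine; exact: Hp.
- move=> x Dx j jP; have [_ hA _] := hD i x Dx.
  apply: le_trans (ler_norm_sum _ _ _) _.
  apply: (@le_trans _ _ (\sum_(a < P.+1) \sum_(b < P.+1) B * C * dl ^+ j)).
    apply: ler_sum => a _; rewrite big_mkcond /=.
    apply: le_trans (ler_norm_sum _ _ _) _; apply: ler_sum => b _.
    have ? : 0 <= B * C * dl ^+ j by rewrite !mulr_ge0// exprn_ge0// ltW.
    case: ifP => [/eqP <-|_]; last by rewrite normr0.
    rewrite normrM exprD mulrACA; apply: ler_pM => //; first by apply: hA; rewrite -ltnS.
    by apply: HC => //; rewrite -ltnS.
  rewrite !sumr_const card_ord -!(mulr_natl (_ *+ _)) -[X in _ * X]mulr_natl.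
  set L : R := P.+1%:R.
  have : 0 <= L ^+ 2 * (B * C * dl ^+ j).
    by rewrite !mulr_ge0 ?exprn_ge0// ltW.
  by move=> h0; lra.
- move=> x Dx; rewrite big_cons; have [hB hA hT] := hD i x Dx.
  apply: (@conv_trunc_le P (fun j => A i j * (x ord0 i - u0 i) ^+ j) (H ^~ x)) => //.
    exact: HC.
  exact: HQ.
Qed.

End product_taylor.

(** * Cancellation and size of atoms *)

Section atom_pairing.
Context {R : realType} {d : nat}.
Local Notation V := 'rV[R]_d.
Local Notation mu := (@lebesgue_rV R d).
Hypothesis d_gt0 : (0 < d)%N.

Lemma poly_le_ball_bounded k (f : V -> R) (c : V) (r : R) : 0 < r -> poly_le k f ->
  exists2 C : R, 0 <= C & forall x, euclidean_ball c r x -> `|f x| <= C.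
Proof.
move=> r0; elim=> [|c' m f0 _ _ [C C0 IH]]; first by exists 0 => // x _; rewrite normr0.
exists (`|c'| * \prod_(i < d) (`|c ord0 i| + r) ^+ m i + C) => [|x xB].
  rewrite addr_ge0// mulr_ge0// prodr_ge0// => i _.
  by rewrite exprn_ge0// addr_ge0// ltW.
apply: le_trans (ler_normD _ _) _; apply: lerD; last exact: IH.
rewrite normrM ler_wpM2l// normr_prod; apply: ler_prod => i _.
rewrite normr_ge0 normrX /= lerXn2r ?nnegrE//; first by rewrite addr_ge0// ltW.
have := euclidean_ball_coord xB i => /ltW h.
rewrite -[x ord0 i](subrK (c ord0 i)) addrC; apply: le_trans (ler_normD _ _) _.
by rewrite lerD2l.
Qed.

Lemma integrable_mul_bounded (D : set V) (a f : V -> R) (C : R) :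
  mu.-integrable setT (EFin \o a) -> measurable_fun setT f ->
  (forall x, ~ D x -> a x = 0) -> (forall x, D x -> `|f x| <= C) ->
  mu.-integrable setT (EFin \o (fun x => a x * f x)).
Proof.
move=> ia mf a0 fC.
have ma : measurable_fun setT a by have /measurable_int/measurable_EFinP := ia.
apply: (le_integrable measurableT _ _ (integrableZr measurableT C ia)).
  by apply/measurable_EFinP; exact: measurable_funM.
move=> x _ /=; rewrite lee_fin !normrM.
have [Dx|nDx] := pselect (D x); last by rewrite a0// normr0 !mul0r.
by rewrite ler_wpM2l// (le_trans (fC _ Dx))// ler_norm.
Qed.

Lemma le_Rintegral_mul (D : set V) (a f : V -> R) (C : R) :
  mu.-integrable setT (EFin \o a) -> measurable_fun setT f ->
  (forall x, ~ D x -> a x = 0) -> (forall x, D x -> `|f x| <= C) ->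
  `|\int[mu]_x (a x * f x)| <= C * \int[mu]_x `|a x|.
Proof.
move=> ia mf a0 fC.
have iaf := integrable_mul_bounded ia mf a0 fC.
apply: le_trans (le_normr_Rintegral measurableT iaf) _.
have ia' : mu.-integrable setT (EFin \o (fun x => `|a x|)) by exact: integrable_norm.
rewrite -RintegralZl//; apply: le_Rintegral => //.
- exact: (integrable_norm iaf).
- exact: (integrableZl measurableT C ia').
- move=> x _; rewrite normrM mulrC.
  have [Dx|nDx] := pselect (D x); last by rewrite a0// normr0 !mulr0.
  by rewrite ler_wpM2r// fC.
Qed.

Lemma orthant_Rintegral (a f : V -> R) : (forall x, ~ orthant R d x -> a x = 0) ->
  \int[mu]_(x in orthant R d) (a x * f x) = \int[mu]_x (a x * f x).
Proof.
move=> a0; rewrite /Rintegral integral_mkcond; congr fine.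
apply: eq_integral => x _; rewrite patchE; case: ifPn => // /negP h.
by rewrite a0 ?mul0r// => /mem_set.
Qed.

(** The [L^1] norm is at most the measure of the ball to the power [1 - p^-1]. This exponent is
    negative, so it is the lower bound for the measure that enters, with its factor [2 / d]. *)
Lemma atom_cancellation (p : R) (q : \bar R) : 0 < p -> p < 1 -> (1 <= q)%E ->
  exists2 C : R, 0 < C & forall a : V -> R, atom p q a ->
  exists (c : V) (r : R), [/\ 0 < r, forall x, ~ euclidean_ball c r x -> a x = 0,
   mu.-integrable setT (EFin \o a),
   \int[mu]_x `|a x| <= C * r `^ (- (d%:R * (p^-1 - 1))) &
   forall f, poly_le (moment_order (d := d) p) f -> \int[mu]_x (a x * f x) = 0].
Proof.
move=> p0 p1 q1; have dR : 0 < d%:R :> R by rewrite ltr0n.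
exists ((2 / d%:R) `^ (- (d%:R * (p^-1 - 1)))) => [|a [ma [c [r [r0 a0 aq am]]]]].
  by rewrite powR_gt0// divr_gt0.
set B := euclidean_ball c r in a0 aq am.
have mB : measurable B := measurable_euclidean_ball c r.
have [m mE /andP[m1 m2]] := euclidean_ball_measure d_gt0 c r0.
have L1 := Lnorm_le_L1 d_gt0 r0 q1 ma a0 aq.
rewrite mE poweR_EFin in L1.
have ia : mu.-integrable setT (EFin \o a).
  apply/integrableP; split; first exact/measurable_EFinP.
  by apply: le_lt_trans L1 _; rewrite ltry.
exists c, r; split => //.
  have -> : \int[mu]_x `|a x| = fine (\int[mu]_x `|a x|%:E)%E by [].
  have : (\int[mu]_x `|a x|%:E)%E \is a fin_num.
    by rewrite ge0_fin_numE ?integral_ge0//; apply: le_lt_trans L1 _; rewrite ltry.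
  move=> fi; rewrite -lee_fin fineK//; apply: le_trans L1 _; rewrite lee_fin.
  have h0 : 0 < 2 * (r / d%:R) by rewrite mulr_gt0// divr_gt0.
  have hd0 : 0 < (2 * (r / d%:R)) ^+ d by rewrite exprn_gt0.
  have m0 : 0 < m by apply: lt_le_trans m1.
  have pE : 0 < p^-1 - 1 by rewrite subr_gt0 invf_gt1.
  rewrite -powRM ?divr_ge0 ?(ltW r0) ?(ltW dR)// (_ : 2 / d%:R * r = 2 * (r / d%:R)); last first.
    by rewrite mulrAC -mulrA.
  rewrite -mulrN powRrM powR_mulrn ?(ltW h0)// opprB.
  rewrite -(opprB p^-1) !powRN lef_pV2 ?posrE ?powR_gt0 ?exprn_gt0//.
    by apply: ge0_ler_powR; rewrite ?nnegrE// ltW.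
move=> f hf.
elim: hf => [|c' mm f0 hm hf IH].
  by under eq_Rintegral do rewrite mulr0; rewrite /Rintegral integral0.
have hm1 : poly_le (moment_order (d := d) p) (monomial mm : V -> R).
  have -> : (monomial mm : V -> R) = (fun x : V => 1 * monomial mm x + 0).
    by apply/funext => x; rewrite mul1r addr0.
  exact: poly_le_add (poly_le0 _).
have [C1 _ hC1] := poly_le_ball_bounded c r0 hf.
have [C2 _ hC2] := poly_le_ball_bounded c r0 hm1.
have i1 := integrable_mul_bounded ia (measurable_poly_le hf) a0 hC1.
have i2 := integrable_mul_bounded ia (measurable_poly_le hm1) a0 hC2.
transitivity (\int[mu]_x (c' * (a x * monomial mm x) + a x * f0 x)).
  by apply: eq_Rintegral => x _; rewrite mulrDr mulrCA.
rewrite RintegralD//; last exact: (integrableZl measurableT c' i2).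
rewrite RintegralZl// IH addr0.
rewrite (_ : \int[mu]_x _ = 0) ?mulr0//.
rewrite -[RHS](am mm hm) /Rintegral [in RHS]integral_mkcond; congr fine.
apply: eq_integral => x _; rewrite patchE; case: ifPn => // /negP h.
by rewrite a0 ?mul0r// => /mem_set.
Qed.

End atom_pairing.
(** Lets a Taylor expansion be centred at a positive point, where the Hoelder classes live, even
    when the ball is centred outside the orthant. *)
Lemma dist_max_le (R : realType) (c r x : R) : 0 < x -> `|x - c| < r ->
  `|x - Num.max c r| <= r.
Proof.
rewrite ltr_distl ler_distl => x0 /andP[h1 h2].
by have [h|h] := leP c r; apply/andP; split; lra.
Qed.

Section atom_pairing_bound.
Context {R : realType} {d : nat}.
Local Notation V := 'rV[R]_d.
Local Notation mu := (@lebesgue_rV R d).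
Hypothesis d_gt0 : (0 < d)%N.

(** The radius is produced before the functions, because the summation over [n] needs one radius for
    all [n]. The first estimate uses only the sup norm, the second subtracts a polynomial of degree
    [P]. Separating [F] from the product lets the two differ outside the orthant. *)
Lemma atom_pairing_le (p : R) (q : \bar R) (th M : R) :
  0 < p -> p < 1 -> (1 <= q)%E -> 0 < th -> th <= 1 -> 0 <= M ->
  let P := moment_order (d := d) p in
  exists2 C : R, 0 < C & forall a : V -> R, atom p q a ->
    (forall x, ~ orthant R d x -> a x = 0) ->
  exists2 r : R, 0 < r & forall (N : R) (K : 'I_d -> R) (g : 'I_d -> R -> R) (F : V -> R),
    (forall i, 0 < K i <= N) -> (forall i, hoelder_class th M P (g i)) ->
    measurable_fun setT F ->
    (forall x, orthant R d x -> F x = \prod_(i < d) g i (K i * x ord0 i)) ->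
    `|\int[mu]_(x in orthant R d) (a x * F x)| <= C * r `^ (- (d%:R * (p^-1 - 1))) /\
    `|\int[mu]_(x in orthant R d) (a x * F x)|
       <= C * r `^ (- (d%:R * (p^-1 - 1))) * (N * r) `^ (P%:R + th).
Proof.
move=> p0 p1 q1 th0 th1 M0 P.
have [C1 C10 hC1] := atom_cancellation d_gt0 p0 p1 q1.
have ga0 : 0 <= P%:R + th by rewrite addr_ge0 ?ler0n ?ltW.
have gaP : P%:R + th <= P.+1%:R by rewrite -(natr1 P) lerD2l.
have [C2 C20 hC2] := product_taylor (index_enum 'I_d) ga0 gaP M0.
have Md : 0 <= M ^+ d by rewrite exprn_ge0.
exists (C1 * (M ^+ d + C2 + 1)) => [|a aa aorth].
  by rewrite mulr_gt0// ltr_wpDl// addr_ge0.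
have [c [r [r0 a0 ia aL amom]]] := hC1 a aa; exists r => // N K g F KN hg mF FE.
rewrite orthant_Rintegral//.
set k := r `^ _ in aL *; have k0 : 0 < k by rewrite powR_gt0.
have aL0 : 0 <= \int[mu]_x `|a x| by apply: Rintegral_ge0.
pose D : set V := euclidean_ball c r `&` orthant R d.
have aD x : ~ D x -> a x = 0.
  move=> nD; have [xB|] := pselect (euclidean_ball c r x); last exact: a0.
  by apply: aorth => xo; apply: nD.
have FM x : D x -> `|F x| <= M ^+ d.
  move=> [xB xo]; rewrite FE// normr_prod -[d in M ^+ d]card_ord -prodr_const.
  apply: ler_prod => i _; rewrite normr_ge0 /=.
  apply: (hoelder_class_bound (hg i)); apply: mulr_gt0; last exact: xo.
  by have /andP[] := KN i.
have b1 : `|\int[mu]_x (a x * F x)| <= C1 * (M ^+ d + C2 + 1) * k.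
  apply: le_trans (le_Rintegral_mul ia mF aD FM) _.
  apply: (@le_trans _ _ (M ^+ d * (C1 * k))); first by rewrite ler_wpM2l.
  have : 0 <= C1 * k * (C2 + 1) by rewrite !mulr_ge0 ?(ltW C10) ?(ltW k0)// addr_ge0.
  by move=> h; lra.
split=> //.
have [i0] : exists i : 'I_d, true by exists (Ordinal d_gt0).
move=> _; have N0 : 0 < N by have /andP[h1 h2] := KN i0; apply: lt_le_trans h2.
have Nr0 : 0 < N * r by rewrite mulr_gt0.
have C0 : 0 <= C1 * (M ^+ d + C2 + 1) * k.
  by rewrite !mulr_ge0 ?(ltW C10) ?(ltW k0)// !addr_ge0.
(* For [N r >= 1] the second estimate follows from the first; the truncated expansion requires
   [N r <= 1]. *)
have [Nr1|Nr1] := leP 1 (N * r).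
  apply: le_trans b1 _; rewrite ler_peMr//.
  by rewrite -[leLHS](powRr0 (N * r)) ler_powR.
pose u0 i := Num.max (c ord0 i) r.
have u0r i x : D x -> `|x ord0 i - u0 i| <= r.
  by move=> [xB xo]; apply: dist_max_le (euclidean_ball_coord xB i); exact: xo.
have u0p i : 0 < u0 i by rewrite lt_max r0 orbT.
have KNi i : 0 < K i by have /andP[] := KN i.
have cE i : {ci : nat -> R | (forall j, (j <= P)%N -> `|ci j| <= M) /\
    forall u, 0 < u -> `|g i u - \sum_(j < P.+1) ci j * (u - K i * u0 i) ^+ j|
      <= M * `|u - K i * u0 i| `^ (P%:R + th)}.
  apply: cid; have [|ci h1 h2] := hoelder_class_taylor th0 (hg i) (u0 := K i * u0 i).
    by rewrite mulr_gt0.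
  by exists ci.
pose A i j := sval (cE i) j * K i ^+ j.
have Kr i x : D x -> `|K i * x ord0 i - K i * u0 i| <= N * r.
  move=> Dx; rewrite -mulrBr normrM ger0_norm ?(ltW (KNi i))//.
  by rewrite ler_pM ?u0r// ?(ltW (KNi i))//; have /andP[] := KN i.
have AE i j x : A i j * (x ord0 i - u0 i) ^+ j =
    sval (cE i) j * (K i * x ord0 i - K i * u0 i) ^+ j.
  by rewrite /A -mulrA -exprMn mulrBr.
have [|i x Dx|H [Hp HC HQ]] := hC2 (N * r) D u0 (fun i u => g i (K i * u)) A Nr0 _ _.
- exact: ltW.
- have [_ xo] := Dx; case E : (cE i) => [ci [hc1 hc2]]; split.
  + by apply: (hoelder_class_bound (hg i)); rewrite mulr_gt0.
  + move=> j jP; rewrite AE E /= normrM normrX.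
    by rewrite ler_pM ?hc1 ?exprn_ge0// lerXn2r ?nnegrE ?(ltW Nr0)// Kr.
  + under eq_bigr do rewrite AE E.
    apply: le_trans (hc2 _ _) _; first by rewrite mulr_gt0// xo.
    by rewrite ler_wpM2l// ge0_ler_powR ?nnegrE ?(ltW Nr0)// Kr.
pose G (x : V) := \sum_(j < P.+1) H j x.
have Gp : poly_le P G.
  have := @poly_le_sum R d P P.+1 H xpredT; apply => j jP _.
  by apply: poly_le_weak (Hp _ _).
have [CG _ hCG] := poly_le_ball_bounded c r0 Gp.
have iG := integrable_mul_bounded ia (measurable_poly_le Gp) a0 hCG.
have iF := integrable_mul_bounded ia mF aD FM.
have FG x : D x -> `|F x - G x| <= C2 * (N * r) `^ (P%:R + th).
  by move=> Dx; have [_ xo] := Dx; rewrite FE//; exact: HQ.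
have -> : \int[mu]_x (a x * F x) = \int[mu]_x (a x * (F x - G x)).
  under [RHS]eq_Rintegral do rewrite mulrBr.
  by rewrite RintegralB// (amom _ Gp) subr0.
have mFG : measurable_fun setT (fun x => F x - G x).
  by apply: measurable_funB => //; exact: measurable_poly_le Gp.
apply: le_trans (le_Rintegral_mul ia mFG aD FG) _.
set w := _ `^ _; have w0 : 0 <= w by exact: powR_ge0.
apply: (@le_trans _ _ (C2 * w * (C1 * k))); first by rewrite ler_wpM2l// mulr_ge0.
have -> : C1 * (M ^+ d + C2 + 1) * k * w =
    C2 * w * (C1 * k) + C1 * k * w * (M ^+ d + 1) by ring.
by rewrite lerDl !mulr_ge0 ?(ltW C10) ?(ltW k0)// addr_ge0.
Qed.

End atom_pairing_bound.

(** * Summation over the indices and over the atoms *)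

Section weighted_sum.
Context {R : realType}.

Lemma powR_increment (th : R) (N : nat) : 0 < th -> th <= 1 ->
  N.+1%:R^-1 * N.+1%:R `^ th <= th^-1 * (N.+1%:R `^ th - N%:R `^ th).
Proof.
move=> th0 th1; set L : R := N.+1%:R; have L0 : 0 < L by rewrite ltr0n.
have L1 : L^-1 <= 1 by rewrite invf_le1// ler1n.
have E : N%:R = L * (1 + - L^-1) :> R.
  by rewrite mulrDr mulr1 mulrN divff ?gt_eqF// /L -natr1 addrK.
rewrite E powRM ?(ltW L0) ?subr_ge0//.
have := @bernoulli_powR_le R th (- L^-1).
rewrite (ltW th0) th1 lerN2 L1 => /(_ isT isT) B.
rewrite ler_pdivlMl// mulrCA mulrC -mulrA mulrCA -[X in _ <= X - _]mulr1 -mulrBr.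
by rewrite ler_wpM2l ?powR_ge0// lerBrDr addrC -lerBrDr -mulrN.
Qed.

(** Comparison with telescoping sums: for [Y N = (N r)^th], the increments of [min (Y, 1)] dominate
    the terms with [N r <= 1] and those of [1 / max (Y, 1)] the others. Both quantities stay in
    [[0, 1]], so the bound does not see [r]. *)
Lemma balanced_sum_le (th r : R) (t : nat -> R) (M : nat) : 0 < th -> th <= 1 -> 0 < r ->
  (forall N, t N.+1 <= N.+1%:R^-1 * (N.+1%:R * r) `^ th) ->
  (forall N, t N.+1 <= N.+1%:R^-1 * (N.+1%:R * r) `^ (- th)) ->
  \sum_(m < M) t m.+1 <= 3 / th.
Proof.
move=> th0 th1 r0 t1 t2.
pose Y N := (N%:R * r) `^ th.
have Y0 N : 0 < Y N.+1 by rewrite powR_gt0// mulr_gt0.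
have K N : N.+1%:R^-1 * Y N.+1 <= th^-1 * (Y N.+1 - Y N).
  rewrite /Y !powRM ?(ltW r0)// -mulrBl !mulrA.
  by rewrite ler_wpM2r ?powR_ge0//; exact: powR_increment.
have YD N : Y N <= Y N.+1.
  by apply: ge0_ler_powR; rewrite ?nnegrE ?mulr_ge0 ?(ltW r0) ?(ltW th0)// ler_wpM2r ?(ltW r0)// ler_nat.
pose G N := Num.min (Y N) 1; pose G' N := (Num.max (Y N) 1)^-1.
have GD N : G N <= G N.+1.
  by rewrite /G le_min ge_min YD ge_min lexx orbT.
have G'D N : G' N.+1 <= G' N.
  rewrite /G' lef_pV2 ?posrE ?lt_max ?ltr01 ?orbT//.
  by rewrite ge_max !le_max YD lexx orbT.
(* The second increment is a forward one; the factor [2] pays for [N + 2 <= 2 (N + 1)]. *)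
have T N : t N.+1 <= th^-1 * (G N.+1 - G N) + 2 * th^-1 * (G' N.+1 - G' N.+2).
  have h1 : 0 <= th^-1 * (G N.+1 - G N) by rewrite mulr_ge0 ?subr_ge0// invr_ge0 ltW.
  have h2 : 0 <= 2 * th^-1 * (G' N.+1 - G' N.+2) by rewrite !mulr_ge0 ?subr_ge0// invr_ge0 ltW.
  have [Y1|Y1] := leP (Y N.+1) 1.
    apply: ler_wpDr => //; rewrite /G !min_l//; last by apply: le_trans (YD _) _.
    by apply: le_trans (t1 _) (K _).
  apply: ler_wpDl => //; rewrite /G' !max_l ?(ltW Y1)//; last by apply: le_trans (YD _); exact: ltW.
  apply: le_trans (t2 _) _; rewrite powRN -/(Y N.+1).
  have -> : 2 * th^-1 * ((Y N.+1)^-1 - (Y N.+2)^-1) =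
      2 * (th^-1 * (Y N.+2 - Y N.+1)) / (Y N.+1 * Y N.+2).
    by field; rewrite !gt_eqF.
  apply: (@le_trans _ _ (2 * (N.+2%:R^-1 * Y N.+2) / (Y N.+1 * Y N.+2))); last first.
    by rewrite ler_wpM2r ?invr_ge0 ?mulr_ge0 ?(ltW (Y0 _))// ler_wpM2l// K.
  have -> : 2 * (N.+2%:R^-1 * Y N.+2) / (Y N.+1 * Y N.+2) = 2 * N.+2%:R^-1 * (Y N.+1)^-1.
    by have := gt_eqF (Y0 N); have := gt_eqF (Y0 N.+1) => ? ?; field; rewrite !gt_eqF.
  rewrite ler_wpM2r ?invr_ge0 ?(ltW (Y0 _))//.
  rewrite ler_pdivlMr ?ltr0n// mulrC ler_pdivrMr ?ltr0n//.
  by rewrite -natrM ler_nat; rewrite mul2n -addnn addSn addnS !ltnS leq_addr.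
apply: (@le_trans _ _ (\sum_(m < M)
    (th^-1 * (G m.+1 - G m) + 2 * th^-1 * (G' m.+1 - G' m.+2)))).
  by apply: ler_sum => i _; exact: T.
rewrite big_split /= -!mulr_sumr.
have -> : \sum_(i < M) (G i.+1 - G i) = G M - G 0%N.
  by rewrite -(big_mkord xpredT (fun i => G i.+1 - G i)) telescope_sumr.
have -> : \sum_(i < M) (G' i.+1 - G' i.+2) = G' 1%N - G' M.+1.
  by elim: {T} M => [|M IH]; rewrite ?big_ord0 ?subrr// big_ord_recr/= IH; ring.
have g1 : G M - G 0%N <= 1.
  have : 0 <= G 0%N by rewrite /G le_min powR_ge0 ler01.
  have : G M <= 1 by rewrite /G ge_min lexx orbT.
  by lra.
have g2 : G' 1%N - G' M.+1 <= 1.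
  have : 0 <= G' M.+1 by rewrite /G' invr_ge0 le_max ler01 orbT.
  have : G' 1%N <= 1 by rewrite /G' invf_le1 ?lt_max ?ltr01 ?orbT// le_max lexx orbT.
  by lra.
have th' : 0 <= th^-1 by rewrite invr_ge0 ltW.
have -> : 3 / th = th^-1 * 1 + 2 * th^-1 * 1 by ring.
by rewrite lerD// ler_wpM2l// mulr_ge0.
Qed.

(** The coordinates other than the first determine an index of given size, and each is at most
    [m]. *)
Lemma multi_size_count (d m : nat) (A : seq {ffun 'I_d.+1 -> nat}) : uniq A ->
  (forall n, n \in A -> multi_size n = m) -> (size A <= m.+1 ^ d)%N.
Proof.
move=> uA hA.
pose f (n : {ffun 'I_d.+1 -> nat}) : {ffun 'I_d -> 'I_m.+1} :=
  [ffun i => inord (n (lift ord0 i))].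
have le_m n : n \in A -> forall i, (n i <= m)%N.
  by move=> /hA <- i; rewrite /multi_size (bigD1 i)//= leq_addr.
have finj : {in A &, injective f}.
  move=> n n' nA nA' /ffunP ff.
  have E i : n (lift ord0 i) = n' (lift ord0 i).
    have /(congr1 val) := ff i; rewrite !ffunE /= !inordK// ltnS; exact: le_m.
  have E0 : n ord0 = n' ord0.
    have := hA n nA; rewrite -(hA n' nA') /multi_size !big_ord_recl.
    by under eq_bigr do rewrite E; move=> /addIn.
  by apply/ffunP => i; case: (unliftP ord0 i) => [j|] ->.
have -> : (m.+1 ^ d = #|{ffun 'I_d -> 'I_m.+1}|)%N by rewrite card_ffun !card_ord.
by rewrite -(size_map f) -(card_uniqP _) ?map_inj_in_uniq// max_card.
Qed.

(** At most [N^(d - 1)] indices have [|n| + 1 = N], so grouping by size reduces the sum to that of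
    [N^-1 (N r)^(- si) min (1, (N r)^(si + et))], to which [balanced_sum_le] applies. *)
Lemma multi_sum_le (d : nat) (si et : R) : (0 < d)%N -> 0 < si -> 0 < et ->
  exists2 C : R, 0 < C & forall (r : R) (A : seq {ffun 'I_d -> nat}) (phi : {ffun 'I_d -> nat} -> R),
   0 < r -> uniq A ->
   (forall n, phi n <= r `^ (- si)) ->
   (forall n, phi n <= r `^ et * (multi_size n).+1%:R `^ (si + et)) ->
  \sum_(n <- A) phi n / (multi_size n).+1%:R `^ (d%:R + si) <= C.
Proof.
case: d => // d _ si0 et0.
(* [si] is the decay for large [N r], [et] the growth for small [N r], and [1] the cap in
   [balanced_sum_le]. *)
pose th := Num.min (Num.min si et) 1.
have th0 : 0 < th by rewrite !lt_min si0 et0 ltr01.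
have th1 : th <= 1 by rewrite ge_min lexx orbT.
have thsi : th <= si by rewrite /th !ge_min lexx.
have thet : th <= et by rewrite /th !ge_min lexx orbT.
exists (3 / th) => [|r A phi r0 uA h1 h2]; first by rewrite divr_gt0.
pose w (N : nat) := (r `^ (- si)) * (Num.min 1 ((N%:R * r) `^ (si + et))) / N%:R `^ (d.+1%:R + si).
have phiw n : phi n / (multi_size n).+1%:R `^ (d.+1%:R + si) <= w (multi_size n).+1.
  rewrite /w ler_wpM2r ?invr_ge0 ?powR_ge0//.
  rewrite minr_pMr ?powR_ge0// mulr1 le_min h1 /=.
  apply: le_trans (h2 n) _; rewrite powRM ?(ltW r0)// mulrCA mulrC -gt0_powRD// addKr.
  exact: lexx.
have w0 N : 0 <= w N.
  by rewrite /w !mulr_ge0 ?invr_ge0 ?powR_ge0// le_min ler01 powR_ge0.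
apply: (@le_trans _ _ (\sum_(n <- A) w (multi_size n).+1)); first exact: ler_sum.
pose M := (\max_(n <- A) multi_size n).+1.
have nM n : n \in A -> (multi_size n < M)%N by move=> nA; rewrite ltnS; exact: leq_bigmax_seq.
rewrite big_seq.
under eq_bigr => n nA.
  rewrite (_ : w _ = \sum_(m < M) if multi_size n == m then w m.+1 else 0); last first.
    rewrite (bigD1 (Ordinal (nM n nA)))//= eqxx big1 ?addr0// => m /eqP mn.
    by case: ifP => // /eqP nm; case: mn; apply/val_inj.
  over.
rewrite -big_seq exchange_big /=.
apply: (@le_trans _ _ (\sum_(m < M) m.+1%:R ^+ d * w m.+1)).
  apply: ler_sum => m _; rewrite -big_mkcond -big_filter.
  rewrite big_const_seq count_predT iter_addr addr0 -[X in X <= _]mulr_natl ler_wpM2r// -natrX ler_nat.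
  apply: multi_size_count; first exact: filter_uniq.
  by move=> n; rewrite mem_filter => /andP[/eqP].
have key x : 0 < x -> x `^ (- si) * Num.min 1 (x `^ (si + et)) <= x `^ th /\
    x `^ (- si) * Num.min 1 (x `^ (si + et)) <= x `^ (- th).
  move=> x0; have thN : - th <= th by apply: (@le_trans _ _ 0); rewrite ?oppr_le0 ltW.
  have [x1|x1] := leP 1 x.
    have h : x `^ (- si) * Num.min 1 (x `^ (si + et)) <= x `^ (- th).
      apply: (@le_trans _ _ (x `^ (- si))); first by rewrite ler_piMr ?powR_ge0// ge_min lexx.
      by apply: ler_powR => //; rewrite lerN2.
    by split=> //; apply: le_trans h _; exact: ler_powR.
  have x01 : 0 < x <= 1 by rewrite x0 ltW.
  have h : x `^ (- si) * Num.min 1 (x `^ (si + et)) <= x `^ th.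
    apply: (@le_trans _ _ (x `^ et)); last exact: ger_powR.
    rewrite (_ : x `^ et = x `^ (- si) * x `^ (si + et)); last by rewrite -gt0_powRD// addKr.
    rewrite ler_wpM2l ?powR_ge0//.
    by rewrite ge_min lexx orbT.
  by split=> //; apply: le_trans h _; exact: ger_powR.
have := @balanced_sum_le th r (fun N => N%:R ^+ d * w N) M th0 th1 r0; apply => N.
all: set L : R := N.+1%:R; have L0 : 0 < L by rewrite ltr0n.
all: have Lr0 : 0 < L * r by rewrite mulr_gt0.
all: have -> : L ^+ d * w N.+1 = L^-1 * ((L * r) `^ (- si) * Num.min 1 ((L * r) `^ (si + et))).
1,3: rewrite /w -/L -[d.+1%:R]natr1 !gt0_powRD// powRr1 ?(ltW L0)// powR_mulrn ?(ltW L0)//;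
  rewrite (powRM (- si)) ?(ltW L0) ?(ltW r0)// !powRN; field;
  by rewrite !gt_eqF ?powR_gt0 ?exprn_gt0.
all: rewrite ler_wpM2l ?invr_ge0 ?(ltW L0)//.
by have [] := key _ Lr0.
by have [] := key _ Lr0.
Qed.

End weighted_sum.

(** * Superposition of atoms with [l^p] coefficients *)

Section powers_of_sums.
Context {R : realType}.

Lemma powR_gt0K (x a : R) : 0 <= x -> a != 0 -> (x `^ a) `^ a^-1 = x.
Proof. by move=> x0 a0; rewrite -powRrM divff// powRr1. Qed.

Lemma powR_gt0VK (x a : R) : 0 <= x -> a != 0 -> (x `^ a^-1) `^ a = x.
Proof. by move=> x0 a0; rewrite -powRrM mulVf// powRr1. Qed.

(** Since [b = s / 2 <= 1], the power [b] of the absolute value is Hoelder continuous by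
    [powR_sub_le]; the power [s] is its square. *)
Lemma cvg_powR_norm (s : R) (u : R^nat) (v : R) : 0 < s -> s <= 2 ->
  u @ \oo --> v -> (fun n => `|u n| `^ s) @ \oo --> `|v| `^ s.
Proof.
move=> s0 s2 uv; set b := s / 2.
have b01 : 0 < b <= 1 by rewrite /b; apply/andP; split; lra.
have b0 : 0 < b by case/andP: b01.
suff h : (fun n => `|u n| `^ b) @ \oo --> `|v| `^ b.
  have sE x : x `^ s = x `^ b * x `^ b :> R.
    rewrite -powRD; first by congr (_ `^ _); rewrite /b; lra.
    by apply/implyP; rewrite (_ : b + b = s) ?(gt_eqF s0)// /b; lra.
  by rewrite sE; under eq_fun do rewrite sE; exact: cvgM.
have D (x y : R) : `| `|x| `^ b - `|y| `^ b | <= `|x - y| `^ b.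
  wlog xy : x y / `|x| <= `|y| => [H|].
    have /orP[] := le_total `|x| `|y|; first exact: H.
    by rewrite distrC (distrC x) => /H.
  have h : `|x| `^ b <= `|y| `^ b by rewrite ge0_ler_powR ?nnegrE// ltW.
  rewrite distrC ger0_norm ?subr_ge0//; apply: le_trans (powR_sub_le b01 _ xy) _ => //.
  rewrite ge0_ler_powR ?nnegrE ?subr_ge0 ?(ltW b0)//.
  by rewrite (distrC x); apply: lerB_normD || exact: lerB_dist.
apply/cvgrPdist_lt => e e0.
have e'0 : 0 < e `^ b^-1 by rewrite powR_gt0.
move/cvgrPdist_lt: uv => /(_ _ e'0); apply: filterS => n h.
apply: le_lt_trans (D _ _) _.
have -> : e = (e `^ b^-1) `^ b by rewrite powR_gt0VK ?(ltW e0)// gt_eqF.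
by apply: gt0_ltr_powR; rewrite ?nnegrE// ltW.
Qed.

Lemma sum_powR_le (J : nat) (y : nat -> R) (t : R) : 1 <= t -> (forall j, 0 <= y j) ->
  \sum_(j < J) y j `^ t <= (\sum_(j < J) y j) `^ t.
Proof.
move=> t1 y0; set Y := \sum_(j < J) y j.
have Y0 : 0 <= Y by exact: sumr_ge0.
have t0 : 0 < t by apply: lt_le_trans t1.
have H : forall z, 0 <= z -> z `^ t = z * z `^ (t - 1).
  by move=> z z0; rewrite mulr_powRB1.
rewrite [leRHS]H// /Y mulr_suml; apply: ler_sum => j _.
rewrite H// ler_wpM2l// ge0_ler_powR ?nnegrE ?subr_ge0//.
by rewrite (bigD1 j)//= lerDl sumr_ge0.
Qed.

Lemma powR_sum_le (J : nat) (y : nat -> R) (s : R) : 0 < s -> s <= 1 -> (forall j, 0 <= y j) ->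
  (\sum_(j < J) y j) `^ s <= \sum_(j < J) y j `^ s.
Proof.
move=> s0 s1 y0; have s'1 : 1 <= s^-1 by rewrite invf_ge1.
have := @sum_powR_le J (fun j => y j `^ s) s^-1 s'1 (fun j => powR_ge0 _ _).
under eq_bigr do rewrite powR_gt0K ?gt_eqF//.
move=> h; have {}h : (\sum_(j < J) y j) `^ s <= ((\sum_(j < J) y j `^ s) `^ s^-1) `^ s.
  apply: ge0_ler_powR => //; rewrite ?nnegrE ?(ltW s0) ?powR_ge0//.
  exact: sumr_ge0.
move: h; rewrite powR_gt0VK ?gt_eqF//.
by apply: sumr_ge0 => j _; exact: powR_ge0.
Qed.

Lemma bernoulli_powR_ge (s y : R) : 1 <= s -> 0 <= y -> 1 + s * (y - 1) <= y `^ s.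
Proof.
move=> s1 y0; have s0 : 0 < s by apply: lt_le_trans s1.
have [h|h] := leP (-1) (s * (y - 1)); last by apply: (@le_trans _ _ 0); [lra|exact: powR_ge0].
have := @bernoulli_powR_le R s^-1 _ _ h.
rewrite invr_ge0 (ltW s0) invf_le1// s1 mulKf ?gt_eqF// (addrC 1 (y - 1)) subrK => /(_ isT) B.
have {}B : ((1 + s * (y - 1)) `^ s^-1) `^ s <= y `^ s.
  by apply: ge0_ler_powR; rewrite ?nnegrE ?powR_ge0// ltW.
by move: B; rewrite powR_gt0VK ?gt_eqF//; lra.
Qed.

(** Each [z j] is compared with the weighted mean [m] through the tangent line of the power, that is
    [bernoulli_powR_ge] at [z j / m]; the linear terms cancel in the weighted sum. *)
Lemma jensen_powR (J : nat) (x z : nat -> R) (s : R) : 1 <= s ->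
  (forall j, 0 <= x j) -> (forall j, 0 <= z j) ->
  (\sum_(j < J) x j * z j) `^ s <= (\sum_(j < J) x j) `^ (s - 1) * \sum_(j < J) x j * z j `^ s.
Proof.
move=> s1 x0 z0; have s0 : 0 < s by apply: lt_le_trans s1.
set W := \sum_(j < J) x j; set X := \sum_(j < J) x j * z j.
have W0 : 0 <= W by exact: sumr_ge0.
have X0 : 0 <= X by apply: sumr_ge0 => j _; exact: mulr_ge0.
have S0 : 0 <= \sum_(j < J) x j * z j `^ s.
  by apply: sumr_ge0 => j _; rewrite mulr_ge0 ?powR_ge0.
have [XE|Xn0] := eqVneq X 0; first by rewrite XE powR0 ?gt_eqF// mulr_ge0 ?powR_ge0.
have Xp : 0 < X by rewrite lt_neqAle eq_sym Xn0.
have Wp : 0 < W.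
  rewrite lt_neqAle W0 andbT eq_sym; apply/eqP => WE; case/eqP: Xn0.
  apply: big1 => j _; have /eqP := WE; rewrite psumr_eq0// => /allP/(_ j).
  by rewrite mem_index_enum => /(_ isT)/eqP ->; rewrite mul0r.
pose m := X / W; have m0 : 0 < m by rewrite divr_gt0.
have T j : m `^ s * (1 + s * (z j / m - 1)) <= z j `^ s.
  have -> : z j `^ s = m `^ s * (z j / m) `^ s.
    by rewrite -powRM ?divr_ge0 ?(ltW m0)// mulrC divfK ?gt_eqF.
  by rewrite ler_wpM2l ?powR_ge0// bernoulli_powR_ge// divr_ge0// ltW.
have : \sum_(j < J) x j * (m `^ s * (1 + s * (z j / m - 1))) <= \sum_(j < J) x j * z j `^ s.
  by apply: ler_sum => j _; rewrite ler_wpM2l.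
have -> : \sum_(j < J) x j * (m `^ s * (1 + s * (z j / m - 1))) = m `^ s * W.
  under eq_bigr => j _.
    rewrite (_ : _ * _ = m `^ s * (1 - s) * x j + m `^ s * s / m * (x j * z j)); last first.
      by field; rewrite gt_eqF.
    over.
  rewrite big_split /= -!mulr_sumr -/W -/X /m; field.
  by rewrite gt_eqF//= gt_eqF.
move=> h; have -> : X `^ s = W `^ (s - 1) * (m `^ s * W).
  have -> : X = m * W by rewrite /m divfK ?gt_eqF.
  by rewrite mulrCA (mulrC (W `^ _) W) mulr_powRB1// powRM// ltW.
by rewrite ler_wpM2l ?powR_ge0.
Qed.

(** For [s <= 1] the power is subadditive and the [l^s] sum is controlled by the [l^p] sum as
    [p <= s]. For [s > 1], Jensen with weights [|l j|] leaves the [l^1] sum, controlled as [p < 1].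
    Partial sums come first, and the limit is taken on the finite list [A]. *)
Lemma superposition_sum_le (I : choiceType) (A : seq I) (w : I -> R) (l : R^nat)
    (c : nat -> I -> R) (v : I -> R) (p s B S : R) :
  0 < p -> p < 1 -> p <= s -> s <= 2 -> 0 <= B ->
  (forall n, 0 <= w n) ->
  (forall j, \sum_(n <- A) `|c j n| `^ s * w n <= B) ->
  (forall J, \sum_(j < J) `|l j| `^ p <= S) ->
  (forall n, series (fun j => l j * c j n) @ \oo --> v n) ->
  \sum_(n <- A) `|v n| `^ s * w n <= B * S `^ (s / p).
Proof.
move=> p0 p1 ps s2 B0 w0 cB lS cv.
have s0 : 0 < s by apply: lt_le_trans ps.
have lim : (fun J => \sum_(n <- A) `|series (fun j => l j * c j n) J| `^ s * w n) @ \oo -->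
    \sum_(n <- A) `|v n| `^ s * w n.
  apply: cvg_big => [|n _]; first exact: add_continuous.
  by apply: cvgMl; exact: cvg_powR_norm.
apply: (cvgr_to_le lim); apply: nearW => J /=.
set X := \sum_(j < J) `|l j| `^ p.
have X0 : 0 <= X by apply: sumr_ge0 => j _; exact: powR_ge0.
apply: (@le_trans _ _ (B * X `^ (s / p))); last first.
  rewrite ler_wpM2l// ge0_ler_powR ?nnegrE ?divr_ge0 ?(ltW s0) ?(ltW p0)//.
    exact: le_trans (lS J).
  exact: lS.
have sp1 : 1 <= s / p by rewrite ler_pdivlMr// mul1r.
have sumE n : series (fun j => l j * c j n) J = \sum_(j < J) l j * c j n.
  by rewrite /series /= big_mkord.
have [s1|s1] := leP s 1.
  apply: (@le_trans _ _ (\sum_(n <- A) (\sum_(j < J) `|l j| `^ s * `|c j n| `^ s) * w n)).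
    apply: ler_sum => n _; rewrite ler_wpM2r// sumE.
    apply: (@le_trans _ _ ((\sum_(j < J) `|l j * c j n|) `^ s)).
      rewrite ge0_ler_powR ?nnegrE ?(ltW s0)//; first exact: sumr_ge0.
      exact: ler_norm_sum.
    apply: le_trans (@powR_sum_le J (fun j => `|l j * c j n|) s s0 s1 _) _ => //.
    by apply: ler_sum => j _; rewrite normrM powRM.
  under eq_bigr do rewrite mulr_suml; rewrite exchange_big /=.
  apply: (@le_trans _ _ (\sum_(j < J) `|l j| `^ s * B)).
    apply: ler_sum => j _; under eq_bigr do rewrite -mulrA.
    by rewrite -mulr_sumr ler_wpM2l ?powR_ge0.
  rewrite -mulr_suml mulrC ler_wpM2l//.
  have -> : \sum_(j < J) `|l j| `^ s = \sum_(j < J) (`|l j| `^ p) `^ (s / p).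
    by apply: eq_bigr => j _; rewrite -powRrM mulrC divfK// gt_eqF.
  by apply: (@sum_powR_le J (fun j => `|l j| `^ p)) => // j; exact: powR_ge0.
pose W : R := \sum_(j < J) `|l j|.
have W0 : 0 <= W by exact: sumr_ge0.
apply: (@le_trans _ _ (\sum_(n <- A) (W `^ (s - 1) * \sum_(j < J) `|l j| * `|c j n| `^ s) * w n)).
  apply: ler_sum => n _; rewrite ler_wpM2r// sumE.
  apply: (@le_trans _ _ ((\sum_(j < J) `|l j| * `|c j n|) `^ s)).
    rewrite ge0_ler_powR ?nnegrE ?(ltW s0)//.
      by apply: sumr_ge0 => j _; exact: mulr_ge0.
    by apply: le_trans (ler_norm_sum _ _ _) _; apply: ler_sum => j _; rewrite normrM.
  by apply: (@jensen_powR J (fun j => `|l j|) (fun j => `|c j n|)); rewrite ?(ltW s1).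
under eq_bigr do rewrite -mulrA mulr_suml; rewrite -mulr_sumr exchange_big /=.
apply: (@le_trans _ _ (W `^ (s - 1) * (W * B))).
  rewrite ler_wpM2l ?powR_ge0// /W mulr_suml; apply: ler_sum => j _.
  by under eq_bigr do rewrite -mulrA; rewrite -mulr_sumr ler_wpM2l.
rewrite mulrA (mulrC _ W) mulr_powRB1// mulrC ler_wpM2l//.
apply: (@le_trans _ _ ((X `^ p^-1) `^ s)); last by rewrite -powRrM mulrC.
rewrite ge0_ler_powR ?nnegrE ?(ltW s0) ?powR_ge0//.
have -> : W = \sum_(j < J) (`|l j| `^ p) `^ p^-1.
  by apply: eq_bigr => j _; rewrite powR_gt0K// gt_eqF.
by apply: (@sum_powR_le J (fun j => `|l j| `^ p)) => [|j]; rewrite ?powR_ge0// ltW// invf_gt1.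
Qed.

End powers_of_sums.

(** * The pairing of the Hardy space with the Laguerre functions *)

Section tensor_schwartz.
Context {R : realType}.

(** All derivatives are listed explicitly, so that iterated partial derivatives of a tensor product
    are again tensor products of members of the towers. *)
Definition derivative_tower (D : nat -> R -> R) : Prop :=
  forall k (u : R), is_derive u 1 (D k) (D k.+1 u).

Definition schwartz_tower (D : nat -> R -> R) : Prop :=
  derivative_tower D /\
  forall k m, exists M : R, forall u, (1 + `|u|) ^+ m * `|D k u| <= M.

Context {d : nat}.
Local Notation V := 'rV[R]_d.
Variable D : 'I_d -> nat -> R -> R.
Implicit Types (m : 'I_d -> nat).

Definition tensor m : V -> R := fun x => \prod_(i < d) D i (m i) (x ord0 i).

Hypothesis towerD : forall i, derivative_tower (D i).

Lemma differentiable_tensor m x : differentiable (tensor m) x.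
Proof.
rewrite /tensor; elim: (index_enum _) => [|i s IH].
  rewrite (_ : (fun y : V => _) = cst 1); last by apply/funext => y; rewrite big_nil.
  exact: differentiable_cst.
rewrite (_ : (fun y : V => _) = (fun y : V => D i (m i) (y ord0 i)) *
    (fun y : V => \prod_(j <- s) D j (m j) (y ord0 j))); last first.
  by apply/funext => y; rewrite big_cons.
apply: differentiableM => //.
apply: (@differentiable_comp _ _ _ _ (fun x : V => x ord0 i) (D i (m i))).
  exact: differentiable_coord.
by apply/derivable1_diffP; have [] := towerD i (m i) (x ord0 i).
Qed.

Lemma partial_tensor m i :
  partial i (tensor m) = tensor (fun j => (m j + (j == i))%N).
Proof.
apply/funext => x; rewrite /partial /derive.
pose c := \prod_(j < d | j != i) D j (m j) (x ord0 j).
have -> : (fun h : R => h^-1 *: ((tensor m \o shift x) (h *: (delta_mx ord0 i : V)) - tensor m x)) =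
  (fun h : R => c * (h^-1 *: ((D i (m i) \o shift (x ord0 i)) (h *: (1 : R)) - D i (m i) (x ord0 i)))).
  apply/funext => h; rewrite /tensor /= (bigD1 i)//= [X in _ - X](bigD1 i)//= !mxE !eqxx.
  rewrite (eq_bigr (fun j => D j (m j) (x ord0 j))) => [|j /negbTE ji].
    by rewrite -/c -mulrBl /GRing.scale /= !mulr1 mulrA [LHS]mulrC.
  by rewrite !mxE ji andbF mulr0 add0r.
apply/cvg_lim => //; rewrite /tensor (bigD1 i)//= eqxx addn1.
rewrite (eq_bigr (fun j => D j (m j) (x ord0 j))) => [|j /negbTE ->]; last by rewrite addn0.
rewrite -/c mulrC; apply: cvgMr.
have [dv' <-] := towerD i (m i) (x ord0 i).
exact: dv'.
Qed.

Lemma partials_tensor (s : seq 'I_d) m :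
  partials s (tensor m) = tensor (fun j => (m j + count_mem j s)%N).
Proof.
elim: s => [|i s IH]; first by rewrite /= ; congr tensor; apply/funext => j; rewrite addn0.
rewrite /= IH partial_tensor; congr tensor; apply/funext => j.
by rewrite /= -addnA (addnC (count_mem _ _)) eq_sym.
Qed.

Lemma smooth_tensor m : smooth (tensor m).
Proof. by move=> s x; rewrite partials_tensor; exact: differentiable_tensor. Qed.

Lemma one_norm_le_prod (x : V) : 1 + `|x| <= \prod_(i < d) (1 + `|x ord0 i|).
Proof.
have P1 (A : pred 'I_d) : 1 <= \prod_(i < d | A i) (1 + `|x ord0 i|).
  by elim/big_ind : _ => // [a b a1 b1|i _]; [rewrite -[1]mulr1 ler_pM|rewrite lerDl].
rewrite addrC -lerBrDr [`|x|]mx_normrE; apply/bigmax_leP; split => /=.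
  by rewrite subr_ge0.
move=> [i j] _ /=; rewrite (ord1 i) lerBrDr addrC (bigD1 j)//= ler_peMr// addr_ge0.
Qed.

Hypothesis schwartzD : forall i, schwartz_tower (D i).

Lemma schwartz_tensor m : schwartz (tensor m).
Proof.
split; first exact: smooth_tensor.
move=> k s; rewrite partials_tensor; pose m' := (fun j => (m j + count_mem j s)%N).
have /fin_all_exists[M hM] : forall i : 'I_d, exists M : R, forall u,
    (1 + `|u|) ^+ k * `|D i (m' i) u| <= M.
  by move=> i; have [_] := schwartzD i; apply.
exists (\prod_(i < d) M i) => x; rewrite /tensor normr_prod.
apply: (@le_trans _ _ (\prod_(i < d) ((1 + `|x ord0 i|) ^+ k * `|D i (m' i) (x ord0 i)|))).
  rewrite big_split /= ler_wpM2r ?prodr_ge0// prodrXl lerXn2r ?nnegrE ?addr_ge0//.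
    by rewrite prodr_ge0// => i _; rewrite addr_ge0.
  exact: one_norm_le_prod.
apply: ler_prod => i _; rewrite hM andbT mulr_ge0// exprn_ge0// addr_ge0.
Qed.

End tensor_schwartz.

(** * A flat cutoff at the origin *)

Section cutoff_exponential.
Context {R : realType}.
Variable e : R.
Hypothesis e_gt0 : 0 < e.

(* The factor [exp (- e / v)] makes the extension by zero flat at the origin. *)
Definition cut_exp (b v : R) : R :=
  if 0 < v then v `^ b * expR (- (v / 2) - e / v) else 0.

Lemma cut_exp_ge0 b v : 0 <= cut_exp b v.
Proof. by rewrite /cut_exp; case: ifP => // _; rewrite mulr_ge0 ?powR_ge0 ?expR_ge0. Qed.

Lemma cut_expM b v : v * cut_exp b v = cut_exp (b + 1) v.
Proof.
rewrite /cut_exp; case: ifP => v0; last by rewrite mulr0.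
by rewrite gt0_powRD// powRr1 ?(ltW v0)//; ring.
Qed.

Lemma cut_exp_le b (k : nat) : exists2 C : R, 0 < C &
  forall v, 0 < v -> cut_exp b v <= C * v ^+ k.
Proof.
(* So large that [exp (- e / v) <= n! (v / e)^n] outweighs both a negative [b] and the wanted order
   [k]. *)
pose n := (Num.truncn (`|b| + k%:R)).+1.
have nb : `|b| + k%:R <= n%:R.
  by rewrite ltW// truncnS_gt.
have x0 : 0 <= b + n%:R - k%:R.
  by have := ler_norm (- b); rewrite normrN => h; lra.
have [C C0 hC] := @powR_le_expR R (b + n%:R - k%:R) 2^-1 x0 ltac:(by []).
exists (n`!%:R / e ^+ n * C) => [|v v0].
  by rewrite mulr_gt0// divr_gt0 ?exprn_gt0// ltr0n fact_gt0.
have ev0 : 0 < e / v by rewrite divr_gt0.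
have h := exprn_le_expR n (ltW ev0).
have {}h : expR (- (e / v)) <= n`!%:R / e ^+ n * v ^+ n.
  rewrite expRN -[leRHS]invrK lef_pV2 ?posrE ?expR_gt0//; last first.
    by rewrite invr_gt0 mulr_gt0 ?exprn_gt0// divr_gt0 ?exprn_gt0// ltr0n fact_gt0.
  move: h; rewrite expr_div_n !invfM invrK -ler_pdivrMl ?ltr0n ?fact_gt0// mulrA.
  by rewrite -!mulrA.
rewrite /cut_exp v0 expRD.
have {}hC := hC v (ltW v0).
have -> : v `^ b = v `^ (b + n%:R - k%:R) * v ^+ k / v ^+ n.
  rewrite -!powR_mulrn ?(ltW v0)// -powRN -!gt0_powRD//; congr (_ `^ _); ring.
apply: (@le_trans _ _ ((C * expR (2^-1 * v)) * v ^+ k / v ^+ n * (expR (- (v / 2)) *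
   (n`!%:R / e ^+ n * v ^+ n)))).
  apply: ler_pM.
  - by rewrite !mulr_ge0 ?powR_ge0 ?invr_ge0 ?exprn_ge0// ltW.
  - by rewrite mulr_ge0 ?expR_ge0.
  - by rewrite ler_wpM2r ?invr_ge0 ?exprn_ge0 ?(ltW v0)// ler_wpM2r ?exprn_ge0 ?(ltW v0)//.
  - by rewrite ler_wpM2l ?expR_ge0.
rewrite le_eqVlt; apply/orP; left; apply/eqP.
rewrite expRN (mulrC 2^-1 v); field.
by rewrite !gt_eqF ?expR_gt0 ?exprn_gt0.
Qed.

Lemma cut_exp_decay b (m : nat) : exists M : R, forall v,
  (1 + `|v|) ^+ m * `|cut_exp b v| <= M.
Proof.
elim: m b => [|m IH] b.
  have [C C0 hC] := cut_exp_le b 0; exists C => v; rewrite expr0 mul1r ger0_norm ?cut_exp_ge0//.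
  have [v0|v0] := ltP 0 v; first by have := hC v v0; rewrite mulr1.
  by rewrite /cut_exp ltNge v0 ltW.
have [M1 h1] := IH b; have [M2 h2] := IH (b + 1).
exists (M1 + M2) => v; rewrite exprSr mulrDr mulr1 mulrDl; apply: lerD; first exact: h1.
by rewrite -mulrA -normrM cut_expM.
Qed.

Lemma is_derive_cut_exp b (v : R) : is_derive v 1 (cut_exp b)
  (b * cut_exp (b - 1) v + ((- 2^-1) * cut_exp b v + e * cut_exp (b - 2) v)).
Proof.
have [v0|v0] := ltP 0 v; last first.
  rewrite /cut_exp ltNge v0 /= !mulr0 !addr0.
  have [->|v0'] := eqVneq v 0.
    (* Vanishing to second order makes the difference quotient at [0] at most [C |h|]. *)
    have [C C0 hC] := cut_exp_le b 2.
    have H : (fun h : R => h^-1 *: ((cut_exp b \o shift 0) (h *: (1 : R)) - cut_exp b 0)) @ 0^' --> (0 : R).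
      apply/norm_cvg0P.
      have hl : (fun h : R => C * `|h|) @ (0 : R)^' --> (0 : R).
        rewrite -[X in _ --> X](mulr0 C); apply: cvgMr.
        rewrite -[X in _ --> X](@normr0 _ R); apply: cvg_norm.
        exact: cvg_within.
      apply: (squeeze_cvgr _ _ hl); last exact: cvg_cst.
      near=> h; rewrite normr_ge0 /=.
      have h0 : h != 0 by near: h; exact: nbhs_dnbhs_neq.
      rewrite addr0 /cut_exp ltxx subr0 /GRing.scale /= mulr1 -/(cut_exp b h).
      rewrite normrM normfV ler_pdivrMl ?normr_gt0//.
      rewrite (ger0_norm (cut_exp_ge0 b h)).
      have [hp|hp] := ltP 0 h; last by rewrite /cut_exp ltNge hp /= !mulr_ge0// ltW.
      by apply: le_trans (hC h hp) _; rewrite (gtr0_norm hp) mulrCA.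
    split; first by apply/cvg_ex; exists 0.
    by apply/cvg_lim.
  have {}v0' : v < 0 by rewrite lt_neqAle v0'.
  apply: (@near_eq_is_derive _ _ _ (cst 0)) (is_derive_cst (0 : R) v 1).
  near=> t; rewrite /= /cut_exp ltNge (_ : t <= 0)//.
  by apply/ltW; near: t; exact: lt_nbhsl.
pose f t := t `^ b * expR (- (t / 2) - e / t).
have df : is_derive v 1 f (b * cut_exp (b - 1) v + ((- 2^-1) * cut_exp b v + e * cut_exp (b - 2) v)).
  have vn0 : v != 0 by rewrite gt_eqF.
  have d1 := is_derive_oppr (is_derive_mulrc 2^-1 (is_derive_id v (1 : R))).
  have d2 := is_derive_oppr (is_derive_mulrc e (is_deriveV (f := id) vn0 (is_derive_id v (1 : R)))).
  have d3 := is_derive_mulr (is_derive1_powR b v0) (is_derive_expr_comp (is_derive_addr d1 d2)).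
  rewrite /f; under [fun t : R => _]funext => t do rewrite (mulrC t).
  apply: (is_derive_eq d3); rewrite /GRing.scale /= !mulr1 (mulrC 2^-1).
  rewrite /cut_exp v0; set E := expR _.
  have -> : v `^ (b - 2) = v `^ b / v ^+ 2.
    by rewrite gt0_powRD// powRN powR_mulrn// ltW.
  rewrite -/E; ring.
apply: (near_eq_is_derive _ df).
near=> t; rewrite /f /cut_exp (_ : 0 < t)//.
by near: t; exact: lt_nbhsr.
Unshelve. all: by end_near. Qed.

(** Linear combinations of [cut_exp], as lists of coefficients and exponents; this span contains the
    cut Laguerre functions and is closed under derivation. *)
Definition cut_sum (s : seq (R * R)) (v : R) : R := \sum_(c <- s) c.1 * cut_exp c.2 v.

Definition cut_sum_derivative (s : seq (R * R)) : seq (R * R) :=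
  flatten [seq [:: (c.1 * c.2, c.2 - 1); (- (c.1 / 2), c.2); (c.1 * e, c.2 - 2)] | c <- s].

Lemma is_derive_cut_sum s (v : R) :
  is_derive v 1 (cut_sum s) (cut_sum (cut_sum_derivative s) v).
Proof.
elim: s => [|c s IH].
  rewrite (_ : cut_sum [::] = cst 0); last by apply/funext => t; rewrite /cut_sum big_nil.
  by rewrite /cut_sum_derivative; exact: is_derive_cst.
rewrite (_ : cut_sum (c :: s) = (fun t => c.1 * cut_exp c.2 t + cut_sum s t)); last first.
  by apply/funext => t; rewrite /cut_sum big_cons.
apply: is_derive_eq.
  exact: (is_derive_addr (is_derive_mulrc c.1 (is_derive_cut_exp c.2 v)) IH).
by rewrite /cut_sum_derivative /= /cut_sum !big_cons /=; ring.
Qed.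

Lemma schwartz_cut_sum s :
  schwartz_tower (fun k => cut_sum (iter k cut_sum_derivative s)).
Proof.
split=> [k v|k m]; first exact: is_derive_cut_sum.
elim: (iter k _ _) => [|c s' [M hM]].
  by exists 0 => v; rewrite /cut_sum big_nil normr0 mulr0.
have [M' hM'] := cut_exp_decay c.2 m; exists (`|c.1| * M' + M) => v.
rewrite /cut_sum big_cons -/(cut_sum s' v).
apply: le_trans (ler_wpM2l _ (ler_normD _ _)) _; first by rewrite exprn_ge0// addr_ge0.
rewrite mulrDr; apply: lerD => //.
by rewrite normrM mulrCA ler_wpM2l.
Qed.

End cutoff_exponential.
Lemma schwartz_tower_shift (R : realType) (D : nat -> R -> R) (t : R) :
  schwartz_tower D -> schwartz_tower (fun k u => D k (u + t)).
Proof.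
move=> [tD rD]; split=> [k u|k m].
  have := @is_derive_affine_comp R (D k) u 1 t (D k.+1 (u + t)).
  rewrite mul1r mulr1 => /(_ (tD _ _)).
  by rewrite (_ : (fun v => D k (1 * v + t)) = (fun v => D k (v + t)))//; apply/funext => v; rewrite mul1r.
have [M hM] := rD k m; exists ((1 + `|t|) ^+ m * M) => u.
apply: le_trans (ler_wpM2l _ (hM (u + t))); last by rewrite exprn_ge0// addr_ge0.
rewrite mulrA ler_wpM2r// -exprMn lerXn2r ?nnegrE ?mulr_ge0 ?addr_ge0//.
have : `|u| <= `|u + t| + `|t|.
  by rewrite -{1}(addrK t u); apply: le_trans (ler_normB _ _) _.
have : 0 <= `|t| * `|u + t| by rewrite mulr_ge0.
by lra.
Qed.

Section cutoff_hoelder.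
Context {R : realType}.
Variables (th t : R).
Hypotheses (th_gt0 : 0 < th) (th_le1 : th <= 1) (t_gt0 : 0 < t).

Lemma cut_exp_bound b : exists2 C : R, 0 < C & forall e v, 0 < e -> t <= v -> cut_exp e b v <= C.
Proof.
have [C C0 hC] : exists2 C : R, 0 < C & forall v, t <= v -> v `^ b * expR (- (v / 2)) <= C.
  have [b0|b0] := leP 0 b.
    have [C C0 hC] := @powR_le_expR R b 2^-1 b0 ltac:(by []).
    exists C => // v tv; rewrite expRN ler_pdivrMr ?expR_gt0// (mulrC v).
    by apply: hC; apply: le_trans tv; exact: ltW.
  exists (t `^ b) => [|v tv]; first exact: powR_gt0.
  have v0 : 0 < v by apply: lt_le_trans tv.
  rewrite -[leRHS]mulr1 ler_pM ?powR_ge0 ?expR_ge0//.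
    rewrite -[b]opprK [v `^ _]powRN [t `^ _]powRN lef_pV2 ?posrE ?powR_gt0//.
    by rewrite ge0_ler_powR ?nnegrE ?oppr_ge0 ?(ltW b0) ?(ltW t_gt0) ?(ltW v0).
  by rewrite -expR0 ler_expR oppr_le0 divr_ge0// ltW.
exists C => // e v e0 tv; have v0 : 0 < v by apply: lt_le_trans tv.
rewrite /cut_exp v0; apply: le_trans (hC v tv); rewrite ler_wpM2l ?powR_ge0//.
by rewrite ler_expR lerBlDr lerDl divr_ge0// ltW.
Qed.

Lemma hoelder_class_lipschitz (f g : R -> R) (M : R) : 
  (forall u : R, 0 < u -> is_derive u 1 f (g u)) -> (forall u, 0 < u -> `|f u| <= M) ->
  (forall u, 0 < u -> `|g u| <= M) -> hoelder_class th (2 * M) 0 f.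
Proof.
move=> df fM gM; have M0 : 0 <= M by apply: le_trans (fM 1 _).
split=> [u u0|u v u0 v0]; first by apply: le_trans (fM u u0) _; rewrite ler_peMl// ler1n.
have [uv|uv] := leP `|u - v| 1; last first.
  apply: (@le_trans _ _ (2 * M)).
    by apply: le_trans (ler_normB _ _) _; rewrite mulr2n mulrDl !mul1r lerD ?fM.
  rewrite ler_peMr ?mulr_ge0// -[leLHS](powRr0 `|u - v|) ler_powR//; exact: ltW.
have min0 w : Num.min v u <= w <= Num.max v u -> 0 < w.
  by move=> /andP[h _]; apply: lt_le_trans h; rewrite lt_min v0 u0.
have h : `|f u - f v| <= M * `|u - v|.
  by apply: (@mean_value_le R f g M v u) => w /min0; [exact: df|exact: gM].
apply: le_trans h _; have [->|uvn] := eqVneq `|u - v| 0.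
  by rewrite mulr0 mulr_ge0 ?powR_ge0// mulr_ge0.
have uv0 : 0 < `|u - v| by rewrite lt_neqAle eq_sym uvn normr_ge0.
rewrite -mulrA mulrCA ler_wpM2l//.
apply: (@le_trans _ _ (`|u - v| `^ th)); last by rewrite ler_peMl ?powR_ge0// ler1n.
by apply: ger1_powR; rewrite ?uv0.
Qed.

(** Differentiation brings in lower powers of the argument, bounded because the argument is at least
    [t], while [exp (- e / v) <= 1] and [e <= 1]; hence the constant is free of [e]. *)
Lemma cut_exp_hoelder n b : exists2 M : R, 0 < M & forall e, 0 < e -> e <= 1 ->
  hoelder_class th M n (fun w => cut_exp e b (w + t)).
Proof.
have D e c (u : R) : 0 < e -> is_derive u 1 (fun w => cut_exp e c (w + t))
    (c * cut_exp e (c - 1) (u + t) + ((- 2^-1) * cut_exp e c (u + t) + e * cut_exp e (c - 2) (u + t))).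
  move=> e0; have := @is_derive_affine_comp R (cut_exp e c) u 1 t _ (is_derive_cut_exp e0 c (1 * u + t)).
  rewrite mul1r mulr1.
  by rewrite (_ : (fun v => cut_exp e c (1 * v + t)) = (fun v => cut_exp e c (v + t)))//; apply/funext => v; rewrite mul1r.
have T u : 0 < u -> t <= u + t by move=> u0; rewrite lerDr ltW.
elim: n b => [|n IH] b.
  have [C0 C00 h0] := cut_exp_bound b; have [C1 C10 h1] := cut_exp_bound (b - 1).
  have [C2 C20 h2] := cut_exp_bound (b - 2).
  exists (2 * (`|b| * C1 + (C0 + C2))) => [|e e0 e1].
    by rewrite mulr_gt0// ltr_wpDl ?mulr_ge0 ?(ltW C10)// addr_gt0.
  apply: (hoelder_class_lipschitz (g := fun u => b * cut_exp e (b - 1) (u + t) +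
     ((- 2^-1) * cut_exp e b (u + t) + e * cut_exp e (b - 2) (u + t)))) => u u0.
  - exact: D.
  - rewrite ger0_norm ?cut_exp_ge0//; apply: le_trans (h0 e _ e0 (T u u0)) _.
    by rewrite addrCA lerDl addr_ge0 ?mulr_ge0// ltW.
  - apply: le_trans (ler_normD _ _) _; apply: lerD.
      by rewrite normrM ler_wpM2l// ger0_norm ?cut_exp_ge0// h1// T.
    apply: le_trans (ler_normD _ _) _; apply: lerD; rewrite normrM (ger0_norm (cut_exp_ge0 _ _ _)).
      rewrite normrN ger0_norm ?invr_ge0// -[leRHS]mul1r ler_pM ?cut_exp_ge0 ?h0 ?T//.
      by rewrite invf_le1// ler1n.
    by rewrite -[leRHS]mul1r (gtr0_norm e0) ler_pM ?cut_exp_ge0 ?h2 ?T// ltW.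
have [M0 M00 H0] := IH b; have [M1 M10 H1] := IH (b - 1); have [M2 M20 H2] := IH (b - 2).
have [C0 C00 h0] := cut_exp_bound b.
exists (C0 + (`|b| * M1 + (2^-1 * M0 + 1 * M2))) => [|e e0 e1].
  by rewrite ltr_pwDl// !addr_ge0// mulr_ge0// ltW.
split=> [u u0|].
  rewrite ger0_norm ?cut_exp_ge0//; apply: le_trans (h0 e _ e0 (T u u0)) _.
  by rewrite lerDl !addr_ge0// mulr_ge0// ltW.
exists (fun u => b * cut_exp e (b - 1) (u + t) +
   ((- 2^-1) * cut_exp e b (u + t) + e * cut_exp e (b - 2) (u + t))) => [u u0|]; first exact: D.
apply: (@hoelder_class_le _ _ (`|b| * M1 + (2^-1 * M0 + 1 * M2))); first by rewrite lerDr ltW.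
apply: hoelder_classD; first by apply: hoelder_classZ => //; exact: H1.
apply: hoelder_classD; apply: hoelder_classZ; rewrite ?normrN ?ger0_norm// ?(ltW e0)//; [exact: H0|exact: H2].
Qed.

Lemma cut_sum_hoelder n s : exists2 M : R, 0 < M & forall e, 0 < e -> e <= 1 ->
  hoelder_class th M n (fun w => cut_sum e s (w + t)).
Proof.
elim: s => [|c s [M M0 IH]].
  exists 1 => // e _ _; apply: (@hoelder_class_eq _ _ _ _ (fun=> 0)).
    by move=> u _; rewrite /cut_sum big_nil.
  exact: hoelder_class0.
have [M' M'0 H] := cut_exp_hoelder n c.2.
exists (`|c.1| * M' + M) => [|e e0 e1]; first by rewrite ltr_wpDl// mulr_ge0// ltW.
apply: (@hoelder_class_eq _ _ _ _ (fun u => c.1 * cut_exp e c.2 (u + t) + cut_sum e s (u + t))).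
  by move=> u _; rewrite /cut_sum big_cons.
by apply: hoelder_classD; [apply: hoelder_classZ => //; exact: H|exact: IH].
Qed.

End cutoff_hoelder.

Definition laguerre1_terms {R : realType} (k : nat) (a : R) : seq (R * R) :=
  [seq (Num.sqrt (gamma_function (k%:R + 1) / gamma_function (k%:R + a + 1)) *
        (laguerre_poly k a)`_j, a / 2 + j%:R) | j <- index_iota 0 (size (laguerre_poly k a))].

Lemma laguerre1_cut_sum {R : realType} (k : nat) (a e v : R) : 0 < v ->
  cut_sum e (laguerre1_terms k a) v = laguerre1 k a v * expR (- (e / v)).
Proof.
move=> v0; rewrite /cut_sum /laguerre1_terms big_map.
rewrite big_mkord.
rewrite /laguerre1 horner_coef !mulr_sumr !mulr_suml; apply: eq_bigr => j _ /=.
by rewrite /cut_exp v0 expRD gt0_powRD// powR_mulrn ?(ltW v0)//; ring.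
Qed.

(** * Independence of the atomic decomposition *)

Section limits_of_pairings.
Context {R : realType}.

Lemma bounded_sum_cvg (u : R^nat) (S : R) : (forall j, 0 <= u j) ->
  (forall J, \sum_(j < J) u j <= S) -> cvgn (series u).
Proof.
move=> u0 uS; apply: nondecreasing_is_cvgn.
  by apply/nondecreasing_seqP => n; rewrite /series /= big_nat_recr//= lerDl.
by exists S => _ [n _ <-]; rewrite /series /= big_mkord.
Qed.

(** Dominated convergence for series, with summable [l j] and bounded [c k j]. The convergence of
    [v] is a conclusion, not an assumption: it is what defines the limiting pairing. *)
Lemma series_double_limit (l : R^nat) (c : nat -> nat -> R) (c0 v : R^nat) (C S : R) :
  (forall J, \sum_(j < J) `|l j| <= S) -> (forall j k, `|c k j| <= C) ->
  (forall j, c ^~ j @ \oo --> c0 j) ->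
  (forall k, series (fun j => l j * c k j) @ \oo --> v k) ->
  exists2 w : R, series (fun j => l j * c0 j) @ \oo --> w & v @ \oo --> w.
Proof.
move=> lS cC cc0 cv.
have C0 : 0 <= C by apply: le_trans (cC 0%N 0%N).
have c0C j : `|c0 j| <= C.
  apply: (cvgr_to_le (cvg_norm (cc0 j))); apply: nearW => k; exact: cC.
have cl : cvgn (series (fun j => `|l j|)) by exact: (@bounded_sum_cvg _ S).
have dom (b : R^nat) (J0 : nat) (e : R) : (forall j, `|b j| <= C) ->
   (forall J, (J0 <= J)%N -> \sum_(J0 <= j < J) `|l j| <= e) -> forall w : R,
   series (fun j => l j * b j) @ \oo --> w ->
   `|w - series (fun j => l j * b j) J0| <= C * e.
  move=> bC tail w cw.
  have h : (fun J => `|series (fun j => l j * b j) J - series (fun j => l j * b j) J0|) @ \oo -->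
      `|w - series (fun j => l j * b j) J0|.
    by apply: cvg_norm; apply: cvgB => //; exact: cvg_cst.
  apply: (cvgr_to_le h); near=> J.
  have J0J : (J0 <= J)%N by near: J; exact: nbhs_infty_ge.
  rewrite /series /= (@big_cat_nat _ _ _ J0)//= addrAC subrr add0r.
  apply: le_trans (ler_norm_sum _ _ _) _.
  apply: (@le_trans _ _ (C * \sum_(J0 <= j < J) `|l j|)); last by rewrite ler_wpM2l// tail.
  rewrite mulr_sumr; apply: ler_sum => j _.
  by rewrite normrM mulrC ler_wpM2r.
have cw : cvgn (series (fun j => l j * c0 j)).
  apply: normed_cvg; apply: (@bounded_sum_cvg (fun j => `|l j * c0 j|) (S * C)) => // J.
  apply: (@le_trans _ _ (\sum_(j < J) `|l j| * C)).
    by apply: ler_sum => j _; rewrite normrM ler_wpM2l.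
  by rewrite -mulr_suml ler_wpM2r.
have /cvg_ex[w hw] := cw.
exists w => //; apply/cvgrPdist_le => e e0.
pose e1 := e / (3 * (C + 1)).
have C1 : 0 < C + 1 by rewrite ltr_wpDl.
have e10 : 0 < e1 by rewrite divr_gt0// mulr_gt0.
have Ce1 : C * e1 <= e / 3.
  have -> : C * e1 = C / (C + 1) * (e / 3) by rewrite /e1; field; rewrite gt_eqF.
  by rewrite ler_piMl ?divr_ge0 ?(ltW e0)// ler_pdivrMr// mul1r lerDl.
have [J0 tail] : exists J0, forall J, (J0 <= J)%N -> \sum_(J0 <= j < J) `|l j| <= e1.
  have /cvg_ex[L hL] := cl.
  have e12 : 0 < e1 / 2 by rewrite divr_gt0.
  move/cvgrPdist_le: hL => /(_ _ e12) [N _ hN]; exists N => J NJ.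
  have := hN _ NJ; have := hN _ (leqnn N).
  rewrite /= /series /= (@big_cat_nat _ _ _ N 0 J)//= !ler_distl.
  by move=> /andP[h1 h2] /andP[h3 h4]; lra.
have hJ : (fun k => series (fun j => l j * c k j) J0) @ \oo --> series (fun j => l j * c0 j) J0.
  apply: cvg_big => [|j _]; first exact: add_continuous.
  by apply: cvgMr; exact: cc0.
have e30 : 0 < e / 3 by rewrite divr_gt0.
move/cvgrPdist_le: hJ => /(_ _ e30); apply: filterS => k hk.
have h1 := dom c0 J0 e1 c0C tail w hw.
have h2 := dom (c k) J0 e1 (cC ^~ k) tail (v k) (cv k).
have -> : w - v k = (w - series (fun j => l j * c0 j) J0) +
   (series (fun j => l j * c0 j) J0 - series (fun j => l j * c k j) J0) -
   (v k - series (fun j => l j * c k j) J0) by ring.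
apply: le_trans (ler_normB _ _) _.
have -> : e = e / 3 + e / 3 + e / 3 by field.
apply: lerD; last exact: le_trans h2 Ce1.
apply: le_trans (ler_normD _ _) _; apply: lerD => //.
exact: le_trans h1 Ce1.
Unshelve. all: by end_near. Qed.

Context {d : nat}.
Local Notation V := 'rV[R]_d.
Local Notation mu := (@lebesgue_rV R d).
Hypothesis d_gt0 : (0 < d)%N.
Variables (p : R) (q : \bar R).
Hypotheses (p_gt0 : 0 < p) (p_lt1 : p < 1) (q_ge1 : (1 <= q)%E).

Definition orthant_atom (a : V -> R) : Prop :=
  atom p q a /\ forall x, ~ orthant R d x -> a x = 0.

Lemma dominated_pairing (a F : V -> R) (F_ : nat -> V -> R) (C : R) : orthant_atom a ->
  (forall k, measurable_fun setT (F_ k)) -> measurable_fun setT F ->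
  (forall k x, orthant R d x -> `|F_ k x| <= C) ->
  (forall x, orthant R d x -> F_ ^~ x @ \oo --> F x) ->
  (fun k => \int[mu]_(x in orthant R d) (a x * F_ k x)) @ \oo -->
  \int[mu]_(x in orthant R d) (a x * F x).
Proof.
move=> [aa a0] mF_ mF F_C F_F.
have [C1 _ /(_ a aa)[c [r [r0 _ ia _ _]]]] := atom_cancellation d_gt0 p_gt0 p_lt1 q_ge1.
have ma : measurable_fun setT a by have /measurable_int/measurable_EFinP := ia.
have mO := @measurable_orthant R d.
have FC x : orthant R d x -> `|F x| <= C.
  by move=> xo; apply: (cvgr_to_le (cvg_norm (F_F x xo))); apply: nearW => k; exact: F_C.
have iF : mu.-integrable (orthant R d) (EFin \o (fun x => a x * F x)).
  apply: (integrableS measurableT) => //.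
  exact: (integrable_mul_bounded ia mF a0 FC).
apply: fine_cvg; rewrite fineK ?integrable_fin_num//.
apply: (@dominated_cvg _ _ _ mu _ mO (fun k x => (a x * F_ k x)%:E) _ (fun x => `|a x|%:E * C%:E)%E).
- move=> k; apply: measurable_funTS; apply/measurable_EFinP; exact: measurable_funM.
- move=> x xo; apply: cvg_EFin; first exact: nearW.
  by rewrite /= (_ : fine \o _ = (fun k => a x * F_ k x))//; apply: cvgMr; exact: F_F.
- by move=> x _.
- apply: (integrableS measurableT mO) => //.
  apply: integrableZr => //; exact: (integrable_abse ia).
- by move=> k x xo; rewrite /= lee_fin normrM ler_wpM2l// F_C.
Qed.

(** For Schwartz functions the common value is [T phi], by the definition of a decomposition; other
    functions are reached as limits. *)
Definition well_paired (T : (V -> R) -> R) (F : V -> R) : Prop :=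
  exists v : R, forall l a, atomic_decomposition p q T l a -> atomic_sum l a F v.

Lemma schwartz_well_paired T phi : schwartz phi -> well_paired T phi.
Proof. by move=> sphi; exists (T phi) => l a [_ _ _]; apply. Qed.

Lemma coef_mass_sum_le (l : R^nat) (S : R) : (coef_mass p l <= S%:E)%E ->
  forall J, \sum_(j < J) `|l j| `^ p <= S.
Proof.
move=> h J; rewrite -lee_fin; apply: le_trans h.
rewrite -sumEFin -(big_mkord xpredT (fun j => (`|l j| `^ p)%:E)).
by apply: nneseries_lim_ge => j _ _; rewrite lee_fin powR_ge0.
Qed.

Lemma coef_sum_le (l : R^nat) (S : R) : (coef_mass p l <= S%:E)%E ->
  forall J, \sum_(j < J) `|l j| <= S `^ p^-1.
Proof.
move=> /coef_mass_sum_le lS J.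
have p'1 : 1 <= p^-1 by rewrite ltW// invf_gt1.
have := @sum_powR_le R J (fun j => `|l j| `^ p) p^-1 p'1 (fun j => powR_ge0 _ _).
under eq_bigr do rewrite powR_gt0K ?gt_eqF//.
move=> h; apply: le_trans h _; rewrite ge0_ler_powR ?nnegrE ?invr_ge0 ?(ltW p_gt0)//.
- by apply: sumr_ge0 => j _; exact: powR_ge0.
- by apply: le_trans (lS 0%N); rewrite big_ord0.
Qed.

(** Each atomic pairing converges by dominated convergence, and the bound [C'] common to all atoms
    lets the limit pass through the atomic sum. The limit value comes from the [F_ k] alone, so it
    is the same for all decompositions. *)
Lemma well_paired_limit T (F_ : nat -> V -> R) (F : V -> R) (C C' : R) :
  (forall k, measurable_fun setT (F_ k)) -> measurable_fun setT F ->
  (forall k x, orthant R d x -> `|F_ k x| <= C) ->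
  (forall x, orthant R d x -> F_ ^~ x @ \oo --> F x) ->
  (forall k a, orthant_atom a -> `|\int[mu]_(x in orthant R d) (a x * F_ k x)| <= C') ->
  (forall k, well_paired T (F_ k)) -> well_paired T F.
Proof.
move=> mF_ mF F_C F_F aF_ wp.
have {wp}v_ k : {v : R | forall l a, atomic_decomposition p q T l a -> atomic_sum l a (F_ k) v}.
  by apply: cid; exact: wp.
pose v k := sval (v_ k); exists (lim (v @ \oo)) => l a la.
have [at_ ao mass _] := la.
have at' j : orthant_atom (a j) by split; [exact: at_|exact: ao].
have massE : coef_mass p l = (fine (coef_mass p l))%:E.
  rewrite fineK// ge0_fin_numE//; apply: nneseries_ge0 => j _ _; rewrite lee_fin powR_ge0//.
have lS := coef_sum_le (eq_ind _ (fun x => (coef_mass p l <= x)%E) (lexx _) _ massE).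
have [w hw vw] := @series_double_limit l (fun k j => \int[mu]_(x in orthant R d) (a j x * F_ k x))
  (fun j => \int[mu]_(x in orthant R d) (a j x * F x)) v C' _ lS
  (fun j k => aF_ k _ (at' j)) (fun j => dominated_pairing (at' j) mF_ mF F_C F_F)
  (fun k => svalP (v_ k) l a la).
by rewrite /atomic_sum (cvg_lim _ vw).
Qed.

End limits_of_pairings.

Section laguerre_regularity.
Context {R : realType}.

Lemma measurable_laguerre1 k (a : R) : measurable_fun setT (laguerre1 k a).
Proof.
rewrite /laguerre1; apply: measurable_funM; last exact: measurable_powR.
apply: measurable_funM; last first.
  apply: measurableT_comp => //; apply: measurableT_comp => //.
  exact: measurable_funM.
apply: measurable_funM => //.
rewrite (_ : horner _ = (fun u => \sum_(j < size (laguerre_poly k a)) (laguerre_poly k a)`_j * u ^+ j)).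
  by apply: measurable_sum => j; apply: measurable_funM => //; exact: measurable_funX.
by apply/funext => u; rewrite horner_coef.
Qed.

Lemma measurable_laguerre d (n : {ffun 'I_d -> nat}) (alpha : 'I_d -> R) :
  measurable_fun setT (laguerre n alpha).
Proof.
apply: (@measurable_prod_coord R d (fun i => laguerre1 (n i) (alpha i))) => i.
exact: measurable_laguerre1.
Qed.

Lemma continuous_laguerre1 k (a u : R) : 0 < u -> {for u, continuous (laguerre1 k a)}.
Proof.
move=> u0; pose c := Num.sqrt (gamma_function (k%:R + 1) / gamma_function (k%:R + a + 1)).
have -> : laguerre1 k a = (fun v => c * lag_exp k a v * v `^ (a / 2)).
  by apply/funext => v; rewrite /laguerre1 /lag_exp /lag mulrA.
have h := is_derive_mulr (is_derive_mulrc c (is_derive_lag_exp k a u)) (is_derive1_powR (a / 2) u0).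
by apply: differentiable_continuous; apply/derivable1_diffP; have [] := h.
Qed.

(** Eliminates the radius by taking the better estimate on each side of [N r = 1]; the pairings with
    a fixed function are then bounded over all atoms. *)
Lemma balanced_bound (A C r N ka ga : R) : 0 <= C -> 0 < r -> 0 < N -> 0 <= ka -> ka <= ga ->
  A <= C * r `^ (- ka) -> A <= C * r `^ (- ka) * (N * r) `^ ga -> A <= C * N `^ ka.
Proof.
move=> C0 r0 N0 ka0 kaga h1 h2.
have Nr0 : 0 < N * r by rewrite mulr_gt0.
have E : N `^ ka = r `^ (- ka) * (N * r) `^ ka.
  by rewrite powRM ?(ltW N0) ?(ltW r0)// mulrCA -gt0_powRD// addNr powRr0 mulr1.
have [Nr1|Nr1] := leP (N * r) 1.
  apply: le_trans h2 _; rewrite -mulrA ler_wpM2l// E ler_wpM2l ?powR_ge0//.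
  by apply: ger_powR; rewrite ?Nr0.
apply: le_trans h1 _; rewrite ler_wpM2l// E ler_peMr ?powR_ge0//.
by rewrite -[leLHS](powRr0 (N * r)) ler_powR// ltW.
Qed.

End laguerre_regularity.

(** * Laguerre pairings and the upper bound *)

Section laguerre_pairing.
Context {R : realType} {d : nat}.
Local Notation V := 'rV[R]_d.
Local Notation mu := (@lebesgue_rV R d).
Variables (p : R) (q : \bar R) (alpha : 'I_d -> R).
Hypotheses (d_gt0 : (0 < d)%N) (p_gt0 : 0 < p) (p_lt1 : p < 1) (q_ge1 : (1 <= q)%E).
Let ka : R := d%:R * (p^-1 - 1).
Let P := moment_order (d := d) p.
Hypothesis alphaP : forall i : 'I_d,
      (exists2 k : nat, (k <= P)%N & alpha i = (2 * k)%:R) \/ 2 * ka < alpha i.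

Lemma kappa_gt0 : 0 < ka.
Proof. by rewrite mulr_gt0 ?ltr0n// subr_gt0 invf_gt1. Qed.

Let ka_ge0 : 0 <= ka := ltW kappa_gt0.

Let kaP : P%:R <= ka < P.+1%:R.
Proof. exact: truncn_itv. Qed.

Let alpha_ge0 i : 0 <= alpha i.
Proof.
have [[k _ ->]|h] := alphaP i; first exact: ler0n.
by apply: le_trans (ltW h); rewrite mulr_ge0.
Qed.

(** [P + th] is the least of [P + 1] and those [alpha i / 2] that exceed [ka]; as a finite minimum
    of numbers above [ka] it is strictly above [ka]. *)
Lemma common_hoelder_exponent : exists th : R, [/\ 0 < th, th <= 1, ka < P%:R + th &
  forall i, (exists2 k : nat, (k <= P)%N & alpha i = (2 * k)%:R) \/ P%:R + th <= alpha i / 2].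
Proof.
pose ga : R := \big[Order.min/P.+1%:R]_(i < d | 2 * ka < alpha i) (alpha i / 2).
have /andP[kaP1 kaP2] := kaP.
have kaga : ka < ga.
  apply/bigmin_gtP; split=> // i h; lra.
have gaP : ga <= P.+1%:R by exact: bigmin_le_id.
exists (ga - P%:R); split.
- by lra.
- by rewrite lerBlDr addrC natr1.
- by rewrite addrC subrK.
- move=> i; have [|h] := alphaP i; first by left.
  right; rewrite addrC subrK; exact: bigmin_le_cond.
Qed.

Lemma laguerre_class : exists th M : R, [/\ 0 < th, th <= 1, 0 < M, ka < P%:R + th &
  forall n : {ffun 'I_d -> nat}, exists2 g : 'I_d -> R -> R,
    forall i, hoelder_class th M P (g i) &
    forall i u, 0 < u -> laguerre1 (n i) (alpha i) u = g i ((n i).+1%:R * u)].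
Proof.
have [th [th0 th1 kath hal]] := common_hoelder_exponent; exists th.
have /fin_all_exists2[M M0 HM] : forall i, exists2 M : R, 0 < M & forall k, exists2 g,
    hoelder_class th M P g & forall u, 0 < u -> laguerre1 k (alpha i) u = g (k.+1%:R * u).
  move=> i; have := @laguerre1_class R (alpha i) (alpha_ge0 i) P th.
  rewrite th0 th1 => /(_ isT); apply.
  by have [[k kP ak]|h] := hal i; [left; exists k|right].
exists (1 + \sum_i M i); split => // [|n].
  by rewrite ltr_wpDr// sumr_ge0// => i _; exact: ltW.
have /fin_all_exists2[g h1 h2] := fun i => HM i (n i).
exists g => // i; apply: hoelder_class_le (h1 i).
by rewrite (bigD1 i)//= addrCA lerDl addr_ge0// sumr_ge0// => j _; exact: ltW.
Qed.

Lemma index_le_size (n : {ffun 'I_d -> nat}) i :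
  (0 < (n i).+1%:R :> R) && ((n i).+1%:R <= (multi_size n).+1%:R :> R).
Proof. by rewrite ltr0n ler_nat ltnS /multi_size (bigD1 i)//= leq_addr. Qed.

(** Two limits are taken. For order [0] the cutoff [exp (- e / v)] climbs from [0] to nearly [1]
    within a length of order [e], so no Hoelder bound up to the origin is uniform in [e]. The
    argument is therefore shifted by [t], and the cutoff is removed for fixed [t] before [t] tends
    to [0]; the Hoelder classes of the Laguerre functions are stable under the shift. *)
Lemma laguerre_well_paired (T : (V -> R) -> R) (n : {ffun 'I_d -> nat}) :
  well_paired p q T (laguerre n alpha).
Proof.
have [th [M [th0 th1 M0 kath /(_ n)[g hg gE]]]] := laguerre_class.
have [C C0 hC] := atom_pairing_le d_gt0 p_gt0 p_lt1 q_ge1 th0 th1 (ltW M0).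
pose t_ (m : nat) : R := m.+1%:R^-1.
have t0 m : 0 < t_ m by rewrite invr_gt0.
have tc : t_ @ \oo --> (0 : R) by exact: cvg_harmonic.
pose F m (x : V) := \prod_(i < d) laguerre1 (n i) (alpha i) (x ord0 i + t_ m).
have mF m : measurable_fun setT (F m).
  apply: (@measurable_prod_coord R d (fun i u => laguerre1 (n i) (alpha i) (u + t_ m))) => i.
  apply: measurableT_comp; first exact: measurable_laguerre1.
  exact: measurable_funD.
have n0 i : 0 < (n i).+1%:R :> R by rewrite ltr0n.
have xt m x i : orthant R d x -> 0 < x ord0 i + t_ m.
  by move=> xo; apply: addr_gt0 (t0 m); exact: xo.
have FM m x : orthant R d x -> `|F m x| <= M ^+ d.
  move=> xo; rewrite normr_prod -[d in M ^+ d]card_ord -prodr_const.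
  apply: ler_prod => i _; rewrite normr_ge0 gE ?xt//=.
  by apply: (hoelder_class_bound (hg i)); rewrite mulr_gt0// xt.
apply: (@well_paired_limit R d d_gt0 p q p_gt0 p_lt1 q_ge1 T F _ (M ^+ d)
  (C * (multi_size n).+1%:R `^ ka)) => //.
- exact: measurable_laguerre.
- move=> x xo; apply: cvg_big => [|i _]; first exact: mul_continuous.
  have h : (fun m => x ord0 i + t_ m) @ \oo --> x ord0 i.
    by rewrite -[X in _ --> X]addr0; apply: cvgD; [exact: cvg_cst|exact: tc].
  exact: (cvg_comp _ _ h (continuous_laguerre1 (xo i))).
- move=> m a [aa ao]; have [r r0 hr] := hC a aa ao.
  have [||//|x xo|h1 h2] := hr (multi_size n).+1%:R (fun i => (n i).+1%:R)
     (fun i w => g i (w + (n i).+1%:R * t_ m)) (F m).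
  + exact: index_le_size.
  + by move=> i; apply: hoelder_class_shift => //; rewrite mulr_ge0// ltW.
  + by apply: eq_bigr => i _; rewrite gE ?xt// mulrDr.
  + by apply: balanced_bound h1 h2; rewrite ?ltr0n ?(ltW C0) ?(ltW kath).
move=> m.
(* The shift [t_ m] is now fixed. The approximants [G j] are Schwartz tensors, estimated at scale
   [1], since only uniformity in [j] matters. *)
pose e_ (j : nat) : R := j.+1%:R^-1.
have e0 j : 0 < e_ j by rewrite invr_gt0.
have e1 j : e_ j <= 1 by rewrite invf_le1// ler1n.
pose D j i k u := cut_sum (e_ j) (iter k (cut_sum_derivative (e_ j)) (laguerre1_terms (n i) (alpha i))) (u + t_ m).
have sD j i : schwartz_tower (D j i).
  by apply: (@schwartz_tower_shift R (fun k => cut_sum (e_ j) (iter k _ _))); exact: schwartz_cut_sum.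
have tD j i : derivative_tower (D j i) by have [] := sD j i.
pose G j : V -> R := tensor (D j) (fun=> 0%N).
have GE j x : orthant R d x -> G j x =
    \prod_(i < d) (laguerre1 (n i) (alpha i) (x ord0 i + t_ m) * expR (- (e_ j / (x ord0 i + t_ m)))).
  by move=> xo; apply: eq_bigr => i _; rewrite /D /= laguerre1_cut_sum// xt.
have /fin_all_exists2[B B0 HB] : forall i, exists2 B : R, 0 < B & forall j, hoelder_class th B P (D j i 0%N).
  move=> i; have [B B0 hB] := cut_sum_hoelder th0 th1 (t0 m) P (laguerre1_terms (n i) (alpha i)).
  by exists B => // j; apply: hB.
pose B' := 1 + \sum_i B i.
have B'0 : 0 < B' by rewrite ltr_wpDr// sumr_ge0// => i _; exact: ltW.
have HB' j i : hoelder_class th B' P (D j i 0%N).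
  apply: hoelder_class_le (HB i j).
  by rewrite /B' (bigD1 i)//= addrCA lerDl addr_ge0// sumr_ge0// => j' _; exact: ltW.
have [C' C'0 hC'] := atom_pairing_le d_gt0 p_gt0 p_lt1 q_ge1 th0 th1 (ltW B'0).
have mG j : measurable_fun setT (G j).
  apply: (@measurable_prod_coord R d (fun i => D j i 0%N)) => i.
  apply: continuous_measurable_fun => u; apply: differentiable_continuous.
  by apply/derivable1_diffP; have [] := tD j i 0%N u.
apply: (@well_paired_limit R d d_gt0 p q p_gt0 p_lt1 q_ge1 T G _ (B' ^+ d) (C' * 1 `^ ka)) => //.
- move=> j x xo; rewrite normr_prod -[d in B' ^+ d]card_ord -prodr_const.
  apply: ler_prod => i _; rewrite normr_ge0 /=.
  by apply: (hoelder_class_bound (HB' j i)); exact: xo.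
- move=> x xo; under eq_fun do rewrite GE//.
  apply: cvg_big => [|i _]; first exact: mul_continuous.
  rewrite -[X in _ --> X]mulr1; apply: cvgMr.
  have h : (fun j => - (e_ j / (x ord0 i + t_ m))) @ \oo --> (0 : R).
    rewrite -[X in _ --> X]oppr0; apply: cvgN.
    by rewrite -[X in _ --> X](mul0r (x ord0 i + t_ m)^-1); apply: cvgMl; exact: tc.
  by have := cvg_comp _ _ h (@continuous_expR R 0); rewrite expR0.
- move=> j a [aa ao]; have [r r0 hr] := hC' a aa ao.
  have [||//|x xo|h1 h2] := hr 1 (fun i => 1) (fun i => D j i 0%N) (G j).
  + by move=> i; rewrite ltr01 lexx.
  + exact: HB'.
  + by apply: eq_bigr => i _; rewrite mul1r.
  + by apply: balanced_bound h1 h2; rewrite ?(ltW C'0) ?(ltW kath).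
- by move=> j; apply: schwartz_well_paired; exact: schwartz_tensor.
Qed.

(** [get] selects the value of some decomposition; [laguerre_well_paired] identifies it with the
    value of the given one. *)
Lemma hardy_pairing_atomic T n l a : atomic_decomposition p q T l a ->
  atomic_sum l a (laguerre n alpha) (hardy_pairing p q T (laguerre n alpha)).
Proof.
move=> la; have [v hv] := laguerre_well_paired T n.
rewrite /hardy_pairing; case: xgetP => [w _ [l' [a' [la' sum']]]|/(_ v)[]]; last first.
  by exists l, a; split=> //; exact: hv.
have <- : v = w by apply: cvg_unique sum' => //; exact: hv la'.
exact: hv.
Qed.

Lemma atom_laguerre_sum (s : R) : 0 < s -> exists2 B : R, 0 < B & forall a : V -> R,
  orthant_atom p q a -> forall A : seq {ffun 'I_d -> nat}, uniq A ->
  \sum_(n <- A) `|\int[mu]_(x in orthant R d) (a x * laguerre n alpha x)| `^ s *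
     ((multi_size n).+1%:R `^ (d%:R + s * ka))^-1 <= B.
Proof.
move=> s0; have [th [M [th0 th1 M0 kath HM]]] := laguerre_class.
have [C C0 hC] := atom_pairing_le d_gt0 p_gt0 p_lt1 q_ge1 th0 th1 (ltW M0).
(* The excess of the Hoelder order over [ka], after raising to the power [s]. *)
pose et := (P%:R + th - ka) * s; have et0 : 0 < et by rewrite mulr_gt0// subr_gt0.
have si0 : 0 < s * ka by rewrite mulr_gt0// kappa_gt0.
have [B B0 hB] := multi_sum_le d_gt0 si0 et0.
exists (C `^ s * B) => [|a [aa ao] A uA]; first by rewrite mulr_gt0// powR_gt0.
have [r r0 hr] := hC a aa ao.
pose I n := `|\int[mu]_(x in orthant R d) (a x * laguerre n alpha x)|.
have Cs0 : 0 < C `^ s by rewrite powR_gt0.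
have hI n : I n <= C * r `^ (- ka) /\ I n <= C * r `^ (- ka) * ((multi_size n).+1%:R * r) `^ (P%:R + th).
  have [g hg gE] := HM n.
  apply: (hr (multi_size n).+1%:R (fun i => (n i).+1%:R) g).
  - exact: index_le_size.
  - exact: hg.
  - exact: measurable_laguerre.
  - by move=> x xo; apply: eq_bigr => i _; rewrite gE.
have I0 n : 0 <= I n by exact: normr_ge0.
have := hB r A (fun n => I n `^ s / C `^ s) r0 uA.
rewrite -ler_pdivrMl// mulr_sumr => hB'; apply: le_trans (hB' _ _) => {hB'}.
- by apply: ler_sum => n _; rewrite mulrCA mulrA.
- move=> n; rewrite ler_pdivrMr// mulrC.
  have -> : r `^ (- (s * ka)) = (r `^ (- ka)) `^ s by rewrite -powRrM mulNr mulrC.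
  rewrite -powRM ?powR_ge0 ?(ltW C0)// ge0_ler_powR ?nnegrE ?mulr_ge0 ?powR_ge0 ?(ltW s0) ?(ltW C0)//.
  by have [] := hI n.
- move=> n; rewrite ler_pdivrMr// mulrC.
  have N0 : 0 < (multi_size n).+1%:R :> R by rewrite ltr0n.
  set N : R := (multi_size n).+1%:R in N0 *.
  have -> : r `^ et * N `^ (s * ka + et) = (r `^ (- ka) * (N * r) `^ (P%:R + th)) `^ s.
    rewrite powRM ?powR_ge0 ?mulr_ge0 ?(ltW N0) ?(ltW r0)// -!powRrM.
    rewrite (powRM ((P%:R + th) * s) (ltW N0) (ltW r0)).
    rewrite [N `^ ((P%:R + th) * s) * _]mulrC [RHS]mulrA -(gt0_powRD (- ka * s) _ r0).
    by congr (_ `^ _ * _ `^ _); rewrite /et; ring.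
  rewrite -powRM ?mulr_ge0 ?powR_ge0 ?(ltW C0)// mulrA.
  rewrite ge0_ler_powR ?nnegrE ?mulr_ge0 ?powR_ge0 ?(ltW s0) ?(ltW C0)//.
  by have [] := hI n.
Qed.

Lemma laguerre_sum_le (s : R) : p <= s -> s <= 2 -> exists2 C : R, 0 < C &
  forall T, (laguerre_sum p q s alpha (d%:R + s * ka) T <= C%:E * hardy_norm p q T `^ s)%E.
Proof.
move=> ps s2; have s0 : 0 < s by apply: lt_le_trans ps.
have [B B0 hB] := atom_laguerre_sum s0; exists B => // T.
suff H l a : atomic_decomposition p q T l a ->
    (laguerre_sum p q s alpha (d%:R + s * ka) T <= B%:E * (coef_mass p l `^ p^-1) `^ s)%E.
  have L0 : (0 <= laguerre_sum p q s alpha (d%:R + s * ka) T)%E.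
    by apply: esum_ge0 => n _; rewrite lee_fin mulr_ge0 ?invr_ge0 ?powR_ge0.
  have B'0 : (0 <= B^-1%:E)%E by rewrite lee_fin invr_ge0 ltW.
  set L := laguerre_sum _ _ _ _ _ _ in L0 H *.
  have L'0 : (0 <= B^-1%:E * L)%E by exact: mule_ge0.
  (* The bound is inverted first: the left side lies below every admissible value, hence below the
     infimum, also when no decomposition exists and the infimum is [+oo]. *)
  have h : ((B^-1%:E * L) `^ s^-1 <= hardy_norm p q T)%E.
    apply: le_ereal_inf_tmp => _ [[l a] /= la <-].
    have := H l a la; set m := (_ `^ p^-1)%E => h.
    have m0 : (0 <= m)%E by exact: poweR_ge0.
    have -> : m = ((m `^ s) `^ s^-1)%E by rewrite -poweRrM divff ?gt_eqF// poweRe1.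
    apply: gt0_ler_poweR; rewrite ?invr_ge0 ?(ltW s0)// ?in_itv/= ?leey ?andbT// ?poweR_ge0//.
    have := lee_wpmul2l B'0 h; rewrite muleA -EFinM mulVf ?gt_eqF// mul1e.
    exact.
  have LE : L = (B%:E * ((B^-1%:E * L) `^ s^-1) `^ s)%E.
    rewrite -poweRrM mulVf ?gt_eqF// poweRe1// muleA -EFinM divff ?gt_eqF// mul1e//.
  rewrite LE lee_wpmul2l ?lee_fin ?(ltW B0)//.
  have hn0 : (0 <= hardy_norm p q T)%E by apply: le_trans h; exact: poweR_ge0.
  by apply: gt0_ler_poweR; rewrite ?(ltW s0)// ?in_itv/= ?leey ?andbT// ?poweR_ge0.
move=> la; have [at_ ao mass _] := la.
have massE : coef_mass p l = (fine (coef_mass p l))%:E.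
  rewrite fineK// ge0_fin_numE//; apply: nneseries_ge0 => j _ _; rewrite lee_fin powR_ge0//.
set S := fine _ in massE.
have lS := coef_mass_sum_le (eq_ind _ (fun x => (coef_mass p l <= x)%E) (lexx _) _ massE).
rewrite massE !poweR_EFin -EFinM.
apply: ub_ereal_sup => _ [A [fA _] <-].
rewrite fsbig_finite//= sumEFin lee_fin -powRrM (mulrC p^-1).
move: (finmap.fset_uniq (fset_set A)); move: (finmap.enum_fset (fset_set A)) => A' uA'.
apply: (@superposition_sum_le R {ffun 'I_d -> nat} A'
  (fun n => ((multi_size n).+1%:R `^ (d%:R + s * ka))^-1) l
  (fun j n => \int[mu]_(x in orthant R d) (a j x * laguerre n alpha x))
  (fun n => hardy_pairing p q T (laguerre n alpha)) p s B S) => //.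
- exact: ltW.
- by move=> j; apply: hB => //; split; [exact: at_|exact: ao].
- by move=> n; exact: hardy_pairing_atomic.
Qed.

End laguerre_pairing.

(** * Sharpness *)

(* The derivatives of the logistic function are polynomials in it, and the first
   one is a positive Schwartz function: tensor powers of it serve as the kernel
   of the maximal function. *)
Section logistic.
Context {R : realType}.
Implicit Types (u : R) (k : nat) (q : {poly R}).

Lemma horner_unit_bound q : exists2 C : R, 0 < C & forall s, 0 <= s <= 1 -> `|q.[s]| <= C.
Proof.
exists (1 + \sum_(j < size q) `|q`_j|) => [|s /andP[s0 s1]]; first by rewrite ltr_pwDl// sumr_ge0.
rewrite horner_coef; apply: le_trans (ler_norm_sum _ _ _) _; apply: ler_wpDl => //.
by apply: ler_sum => j _; rewrite normrM ler_piMr// normrX exprn_ile1// ger0_norm.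
Qed.

Definition logistic u : R := (1 + expR (- u))^-1.

Lemma logistic_itv u : 0 < logistic u < 1.
Proof.
have e0 := expR_gt0 (- u).
by rewrite /logistic invr_gt0 addr_gt0//= invf_lt1 ?addr_gt0// ltrDl.
Qed.

Lemma is_derive_logistic u : is_derive u 1 logistic (logistic u * (1 - logistic u)).
Proof.
have e0 := expR_gt0 (- u).
have n0 : 1 + expR (- u) != 0 by rewrite gt_eqF// addr_gt0.
have d1 := is_derive_expr_comp (is_derive_oppr (is_derive_id u (1 : R))).
have d2 := is_derive_addr (is_derive_cst (1 : R) u (1 : R)) d1.
have d3 := is_deriveV (f := fun t => 1 + expR (- t)) n0 d2.
apply: (is_derive_eq d3).
by rewrite /logistic /GRing.scale /=; field.
Qed.

Lemma logistic_decay u : logistic u * (1 - logistic u) <= expR (- `|u|).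
Proof.
have e0 := expR_gt0 (- u); have n0 : 0 < 1 + expR (- u) by rewrite addr_gt0.
have /andP[l0 l1] := logistic_itv u.
have E : 1 - logistic u = logistic u * expR (- u) by rewrite /logistic; field; rewrite gt_eqF.
have [u0|u0] := leP 0 u.
  rewrite ger0_norm// E mulrA ler_piMl ?expR_ge0//.
  by rewrite mulr_ile1 ?ltW.
rewrite ltr0_norm// opprK; apply: (@le_trans _ _ (logistic u)); first by apply: ler_piMr; [exact: ltW|lra].
have -> : expR u = (expR (- u))^-1 by rewrite -expRN opprK.
rewrite /logistic lef_pV2 ?posrE//.
by rewrite lerDr.
Qed.

Fixpoint logistic_poly k : {poly R} :=
  if k is k'.+1 then (logistic_poly k')^`() * ('X * (1 - 'X)) else 'X.

Definition logistic_tower k u : R := (logistic_poly k).[logistic u].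

Lemma derivative_tower_logistic : derivative_tower logistic_tower.
Proof.
move=> k u; have := @is_derive1_comp R (horner (logistic_poly k)) logistic u _ _
  (is_derive_poly _ _) (is_derive_logistic u).
by rewrite /logistic_tower /= !hornerE.
Qed.

Lemma logistic_tower_decay k m : exists2 M : R, 0 < M & forall u,
  (1 + `|u|) ^+ m * `|logistic_tower k.+1 u| <= M.
Proof.
have [C C0 hC] := horner_unit_bound (logistic_poly k)^`().
exists (C * (m`!%:R * expR 1)) => [|u]; first by rewrite !mulr_gt0 ?expR_gt0// ltr0n fact_gt0.
have /andP[l0 l1] := logistic_itv u.
have -> : logistic_tower k.+1 u = (logistic_poly k)^`().[logistic u] * (logistic u * (1 - logistic u)).
  by rewrite /logistic_tower /= !hornerE ?mulrA.
have ll0 : 0 <= logistic u * (1 - logistic u) by rewrite mulr_ge0 ?subr_ge0 ?ltW.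
rewrite normrM (ger0_norm ll0) mulrCA.
have h1 : `|(logistic_poly k)^`().[logistic u]| <= C by apply: hC; rewrite !ltW.
apply: ler_pM => //; first by rewrite mulr_ge0 ?exprn_ge0 ?addr_ge0.
apply: le_trans (ler_wpM2l _ (logistic_decay u)) _; first by rewrite exprn_ge0// addr_ge0.
have h : (1 + `|u|) ^+ m <= m`!%:R * expR (1 + `|u|) by apply: exprn_le_expR; rewrite addr_ge0.
apply: le_trans (ler_wpM2r (expR_ge0 _) h) _.
by rewrite -mulrA -expRD addrK.
Qed.

(** Shifted by one because the logistic function itself does not decay, while its derivatives do. *)
Lemma schwartz_tower_logistic : schwartz_tower (fun k => logistic_tower k.+1).
Proof.
split=> [k u|k m]; first exact: derivative_tower_logistic.
by have [M _ hM] := logistic_tower_decay k m; exists M.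
Qed.

Lemma logistic_tower1 u : logistic_tower 1 u = logistic u * (1 - logistic u).
Proof. by rewrite /logistic_tower /= derivX mul1r !hornerE. Qed.

End logistic.

(** * Moments of the bump polynomial *)

Section moment_functional.
Context {R : realType}.
Implicit Types (p q : {poly R}) (b c : R).

(** The integral of [q.[y] y^b] over [[0, 1]], computed term by term; the algebraic form also allows
    the negative exponents met in repeated integration by parts. *)
Definition unit_moment b q : R := \sum_(l < size q) q`_l / (l%:R + b + 1).

Lemma unit_moment_wide b q N : (size q <= N)%N ->
  unit_moment b q = \sum_(l < N) q`_l / (l%:R + b + 1).
Proof.
move=> qN; rewrite /unit_moment (big_ord_widen N (fun l => q`_l / (l%:R + b + 1)))// big_mkcond.
apply: eq_bigr => l _; case: ltnP => // ql.
by rewrite nth_default// mul0r.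
Qed.

Lemma unit_momentB b p q : unit_moment b (p - q) = unit_moment b p - unit_moment b q.
Proof.
pose N := maxn (size p) (size q).
rewrite !(@unit_moment_wide b _ N) ?leq_maxl ?leq_maxr//.
  by rewrite -sumrB; apply: eq_bigr => l _; rewrite coefB mulrBl.
by rewrite (leq_trans (size_polyD _ _))// size_polyN.
Qed.

Lemma unit_momentMX b q : unit_moment b (q * 'X) = unit_moment (b + 1) q.
Proof.
rewrite (@unit_moment_wide b _ (size q).+1); last exact: size_polyMleq || (by rewrite (leq_trans (size_polyMleq _ _))// size_polyX addn2).
rewrite big_ord_recl coefMX eqxx mul0r add0r; apply: eq_bigr => l _.
by rewrite coefMX /= /bump /= add1n -natr1; congr (_ / _); ring.
Qed.

(** Integration by parts read on coefficients; the side condition excludes the exponent [-1] among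
    the monomials [y^(l + b - 1)] that occur. *)
Lemma unit_moment_deriv b q : (forall l, q`_l != 0 -> l%:R + b != 0) ->
  unit_moment b q^`() = q.[1] - b * unit_moment (b - 1) q.
Proof.
move=> hb; rewrite (@unit_moment_wide b _ (size q)); last first.
  by rewrite (leq_trans (size_poly _ _))// leq_pred.
rewrite horner_coef /unit_moment mulr_sumr -sumrB.
have T l : q`_l * 1 ^+ l - b * (q`_l / (l%:R + (b - 1) + 1)) = q`_l *+ l / (l%:R + b).
  rewrite -addrA subrK expr1n mulr1 -[q`_l *+ l]mulr_natr.
  have [->|q0] := eqVneq q`_l 0; first by rewrite !mul0r mulr0 subr0.
  by field; exact: hb.
under [RHS]eq_bigr do rewrite T.
case E : (size q) => [|N]; first by rewrite !big_ord0.
rewrite big_ord_recr [RHS]big_ord_recl /= coef_deriv [q`_N.+1]nth_default ?E// mul0rn !mul0r addr0 add0r.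
by apply: eq_bigr => l _; rewrite coef_deriv /bump /= add1n -(natr1 l) addrAC.
Qed.

(** The Beta integral [B (c + 1, n + 1)]; one factor [1 - y] at a time is expanded as a difference
    of the integrals for [c] and [c + 1]. *)
Lemma unit_moment_1BX c n : 0 <= c ->
  unit_moment c ((1 - 'X) ^+ n) = n`!%:R / \prod_(l < n.+1) (c + 1 + l%:R).
Proof.
elim: n c => [|n IH] c c0.
  rewrite expr0 big_ord1 fact0 addr0 (@unit_moment_wide _ _ 1) ?size_poly1//.
  by rewrite big_ord1 coef1 add0r.
have P0 (e : R) (N : nat) : 0 <= e -> 0 < \prod_(l < N) (e + 1 + l%:R).
  by move=> e0; apply: prodr_gt0 => l _; rewrite ltr_wpDr// ltr_wpDl.
rewrite exprSr mulrBr mulr1 unit_momentB unit_momentMX !IH ?addr_ge0//.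
rewrite big_ord_recl [in X in _ - X]big_ord_recr /= [in RHS]big_ord_recl [in RHS]big_ord_recr /=.
have -> : \prod_(i < n) (c + 1 + 1 + i%:R) = \prod_(i < n) (c + 1 + (lift ord0 i)%:R) :> R.
  by apply: eq_bigr => i _; rewrite lift0 -natr1; ring.
set p := \prod_(i < n) _.
have p0 : 0 < p by apply: prodr_gt0 => l _; rewrite ltr_wpDr// ltr_wpDl.
rewrite /bump /= add1n factS natrM -!natr1.
have n0 : (0 : R) <= n%:R by [].
field; rewrite !gt_eqF//; lra.
Qed.

(* The derivative of order [k < A] vanishes at [0] and [1] and is orthogonal to
   the powers less than [k]. *)
Definition bump_poly (A : nat) : {poly R} := (1 - 'X) ^+ A * 'X^A.

Lemma unit_moment_bump c A : 0 <= c + A%:R -> 0 < unit_moment c (bump_poly A).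
Proof.
move=> cA; have -> : unit_moment c (bump_poly A) = unit_moment (c + A%:R) ((1 - 'X) ^+ A).
  rewrite /bump_poly; move: ((1 - 'X) ^+ A) => q.
  clear cA; elim: A c => [|B IH] c; first by rewrite expr0 mulr1 addr0.
  by rewrite exprSr mulrA unit_momentMX IH -natr1 -addrA (addrC 1).
rewrite unit_moment_1BX// divr_gt0 ?ltr0n ?fact_gt0//.
by apply: prodr_gt0 => l _; rewrite ltr_wpDr// ltr_wpDl.
Qed.

Lemma root_bump_derivn A j (x : R) : (j < A)%N -> (x == 0) || (x == 1) ->
  (bump_poly A)^`(j).[x] = 0.
Proof.
suff H : forall j, (j <= A)%N -> exists q, (bump_poly A)^`(j) = q * ((1 - 'X) * 'X) ^+ (A - j).
  move=> jA x01; have [q ->] := H j (ltnW jA).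
  rewrite hornerM horner_exp hornerM !hornerE.
  have -> : (1 - x) * x = 0 by case/orP: x01 => /eqP ->; rewrite ?mulr0// subrr mul0r.
  by rewrite expr0n subn_eq0 leqNgt jA mulr0.
elim=> [|i IH] iA; first by exists 1; rewrite derivn0 subn0 mul1r exprMn.
have [q Eq] := IH (ltnW iA); rewrite derivnS Eq derivM.
have -> : (A - i = (A - i.+1).+1)%N by rewrite subnSK.
exists (q^`() * ((1 - 'X) * 'X) + q * (((1 - 'X) * 'X)^`() *+ (A - i.+1).+1)).
by rewrite deriv_exp /= exprS -!mulrnAr; ring.
Qed.

(** The boundary terms vanish by the choice of the bump. The product is zero exactly for
    [b = 0, ..., i - 1]: one formula gives the vanishing moments of the atom and its nonzero pairing
    with higher powers. *)
Lemma unit_moment_bump_derivn (i A : nat) b : (i <= A)%N -> i%:R < A%:R + b ->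
  unit_moment b (bump_poly A)^`(i) =
  (\prod_(j < i) (j%:R - b)) * unit_moment (b - i%:R) (bump_poly A).
Proof.
elim: i b => [|i IH] b iA ib; first by rewrite big_ord0 mul1r subr0.
rewrite derivnS unit_moment_deriv => [|l].
  rewrite root_bump_derivn ?eqxx ?orbT// sub0r IH ?(ltnW iA)//; last by rewrite -natr1 in ib; lra.
  rewrite [in RHS]big_ord_recl /= !sub0r mulrA -!mulNr; congr (_ * _ * unit_moment _ _).
    by apply: eq_bigr => j _; rewrite /bump /= add1n -natr1; ring.
  by rewrite -natr1; ring.
rewrite coef_derivn /bump_poly coefMXn; case: ltnP => [|Al _]; first by rewrite mul0rn eqxx.
have : (A%:R : R) <= i%:R + l%:R by rewrite -natrD ler_nat.
by rewrite -natr1 in ib => h; rewrite gt_eqF//; lra.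
Qed.

End moment_functional.

(** * Integrals along one edge of the cube *)

Section interval_integrals.
Context {R : realType}.
Local Notation leb := (@lebesgue_measure R).
Variable r : R.
Hypothesis r_gt0 : 0 < r.
Implicit Types (f g : R -> R) (M b t x y : R).

Lemma itv_measure : leb `[0, r] = r%:E.
Proof. by rewrite lebesgue_measure_itv/= lte_fin r_gt0 oppr0 adde0. Qed.

Lemma itv_integrable f M : measurable_fun setT f ->
  (forall y, 0 <= y <= r -> `|f y| <= M) -> leb.-integrable `[0, r] (EFin \o f).
Proof.
move=> mf fM; apply: measurable_bounded_integrable => //.
- by have := ltry r; rewrite -itv_measure.
- exact: measurable_funTS.
- exists M; split; first exact: num_real.
  move=> M' MM' y /=; rewrite in_itv/= => yr; apply: le_trans (fM y yr) (ltW MM').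
Qed.

Lemma itv_Rintegral_le f M : measurable_fun setT f ->
  (forall y, 0 <= y <= r -> `|f y| <= M) -> `|\int[leb]_(y in `[0, r]) f y| <= M * r.
Proof.
move=> mf fM; have fi := itv_integrable mf fM.
apply: le_trans (le_normr_Rintegral _ fi) _ => //.
apply: (@le_trans _ _ (\int[leb]_(y in `[0, r]) M)).
  apply: le_Rintegral => //.
  - exact: (integrable_norm fi).
  - by apply: (@itv_integrable (cst M) `|M|).
rewrite Rintegral_cst//.
by rewrite [X in M * X <= _](_ : _ = r)//; exact: (congr1 fine itv_measure).
Qed.

Lemma Rintegral_lincomb (N : nat) (c : nat -> R) (f : nat -> R -> R) :
  (forall j, leb.-integrable `[0, r] (EFin \o f j)) ->
  leb.-integrable `[0, r] (EFin \o (fun y => \sum_(j < N) c j * f j y)) /\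
  \int[leb]_(y in `[0, r]) (\sum_(j < N) c j * f j y) =
  \sum_(j < N) c j * \int[leb]_(y in `[0, r]) f j y.
Proof.
move=> fi; elim: N => [|N [IH1 IH2]].
  under [X in EFin \o X]funext => y do rewrite big_ord0.
  under eq_Rintegral => y _ do rewrite big_ord0.
  by rewrite big_ord0 Rintegral_cst// ?mul0r; split => //; exact: integrable0.
have iN : leb.-integrable `[0, r] (EFin \o (fun y => c N * f N y)).
  exact: (integrableZl _ (c N) (fi N)).
split.
  rewrite (_ : EFin \o _ = ((EFin \o (fun y => (\sum_(j < N) c j * f j y)%R)) \+ (EFin \o (fun y => (c N * f N y)%R)))%E).
    exact: integrableD.
  by apply/funext => y /=; rewrite big_ord_recr EFinD.
under eq_Rintegral => y _ do rewrite big_ord_recr /=.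
by rewrite RintegralD// IH2 RintegralZl// big_ord_recr.
Qed.

Lemma Rintegral_powR b : 0 <= b ->
  \int[leb]_(y in `[0, r]) (y `^ b) = r `^ (b + 1) / (b + 1).
Proof.
move=> b0; have b1 : 0 < b + 1 by rewrite ltr_wpDl.
pose F y := (b + 1)^-1 * y `^ (b + 1).
have dF y : 0 < y -> is_derive y 1 F (y `^ b).
  move=> y0; apply: (is_derive_eq (is_derive_mulrc (b + 1)^-1 (is_derive1_powR (b + 1) y0))).
  by rewrite addrK mulrA mulVf ?gt_eqF// mul1r.
have cp (c y : R) : 0 < y -> {for y, continuous ((@powR R)^~ c)}.
  move=> y0; apply: differentiable_continuous; apply/derivable1_diffP.
  by have [] := is_derive1_powR c y0.
rewrite /Rintegral (@continuous_FTC2 _ _ F) //=.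
- by rewrite /F powR0 ?gt_eqF// mulr0 subr0 mulrC.
- have [->|bn0] := eqVneq b 0.
    rewrite (_ : (@powR R)^~ 0 = cst 1); last by apply/funext => y; rewrite powRr0.
    by apply: continuous_subspaceT => y; exact: cvg_cst.
  have bp : 0 < b by rewrite lt_neqAle eq_sym bn0.
  apply/continuous_within_itvP => //; split.
  + by move=> y; rewrite in_itv/= => /andP[y0 _]; exact: cp.
  + by rewrite powR0//; exact: powR_cvg0.
  + exact/cvg_at_left_filter/cp.
- split.
  + by move=> y; rewrite in_itv/= => /andP[y0 _]; have [] := dF y y0.
  + by rewrite /F powR0 ?gt_eqF//; apply: cvgMr; exact: powR_cvg0.
  + by apply: cvg_at_left_filter; apply: cvgMr; exact: cp.
- move=> y; rewrite in_itv/= => /andP[y0 _]; rewrite derive1E.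
  by have [_ ->] := dF y y0.
Qed.

Lemma measurable_horner (q : {poly R}) : measurable_fun setT (horner q).
Proof. by apply: continuous_measurable_fun => x; exact: continuous_horner. Qed.

Lemma integrable_powR b : 0 <= b -> leb.-integrable `[0, r] (EFin \o ((@powR R)^~ b)).
Proof.
move=> b0; apply: (@itv_integrable _ (r `^ b)); first exact: measurable_powR.
by move=> y /andP[y0 yr]; rewrite ger0_norm ?powR_ge0// ge0_ler_powR ?nnegrE// (le_trans y0).
Qed.

Lemma Rintegral_horner_powR (q : {poly R}) b : 0 <= b ->
  \int[leb]_(y in `[0, r]) (q.[y / r] * y `^ b) = r `^ (b + 1) * unit_moment b q.
Proof.
move=> b0.
have bl l : 0 <= l%:R + b by rewrite addr_ge0.
have [_] := @Rintegral_lincomb (size q) (fun l => q`_l / r ^+ l) (fun l y => y `^ (l%:R + b))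
  (fun l => integrable_powR (bl l)).
rewrite (_ : \int[leb]_(y in _) _ = \int[leb]_(y in `[0, r]) (q.[y / r] * y `^ b)); last first.
  apply: eq_Rintegral => y; rewrite inE/= in_itv/= => /andP[y0 _].
  rewrite horner_coef mulr_suml; apply: eq_bigr => l _.
  have [->|yn0] := eqVneq y 0.
    rewrite mul0r; case: (nat_of_ord l) => [|l'].
      by rewrite !expr0 add0r divr1 mulr1.
    by rewrite expr0n /= mulr0 mul0r powR0 ?mulr0// gt_eqF// ltr_wpDr.
  rewrite gt0_powRD ?lt_neqAle ?y0 ?andbT 1?eq_sym// powR_mulrn// expr_div_n.
  by ring.
move=> ->; rewrite /unit_moment mulr_sumr; apply: eq_bigr => l _.
rewrite Rintegral_powR// -!addrA (gt0_powRD _ (b + 1) r_gt0) powR_mulrn ?(ltW r_gt0)//.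
have n1 : r ^+ l != 0 by rewrite gt_eqF// exprn_gt0.
have n2 : l%:R + (b + 1) != 0 by rewrite gt_eqF// addrA ltr_wpDl.
by field; rewrite ?n1 ?n2.
Qed.

Lemma FTC_is_derive f F : (forall x : R, is_derive x 1 F (f x)) -> continuous f ->
  \int[leb]_(y in `[0, r]) f y = F r - F 0.
Proof.
move=> dF cf; have cF : continuous F.
  by move=> x; apply: differentiable_continuous; apply/derivable1_diffP; have [] := dF x.
rewrite /Rintegral (@continuous_FTC2 _ _ F) //=.
- exact: continuous_subspaceT.
- split; [by move=> x _; have [] := dF x|exact/cvg_at_right_filter/cF|exact/cvg_at_left_filter/cF].
- by move=> x _; rewrite derive1E; have [_ ->] := dF x.
Qed.

(** Integration by parts moves derivatives between bump and kernel without boundary terms. With all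
    [k + 1] on the bump, the kernel becomes the bounded logistic function and [t^-1] is gone, which
    settles [|x| <= 2 r]. With all on the kernel, its decay turns [t^-(k + 1)] into
    [|x - y|^-(k + 1)], which settles larger [|x|]. Both bounds are uniform in [t]. *)
Lemma bump_integral_le (A k : nat) : (k < A)%N -> exists2 C : R, 0 < C &
  forall t x, 0 < t ->
  `|\int[leb]_(y in `[0, r]) ((bump_poly A)^`(k).[y / r] * (t^-1 * logistic_tower 1 ((x - y) / t)))|
     <= C * (1 + `|x|) ^- k.+1.
Proof.
move=> kA; set B := bump_poly A.
pose D := @logistic_tower R.
pose G t x j i y := (B^`(j).[y / r] / r ^+ j) * (t^-1 ^+ i * D i ((x - y) / t)).
have dD := @derivative_tower_logistic R.
have dq j (y : R) : is_derive y 1 (fun y => B^`(j).[y / r] / r ^+ j) (B^`(j.+1).[y / r] / r ^+ j.+1).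
  have h := @is_derive_affine_comp R (horner B^`(j)) y r^-1 0 _ (is_derive_poly _ _).
  have h2 := is_derive_mulrc (r ^+ j)^-1 h.
  rewrite (_ : (fun y => B^`(j).[y / r] / r ^+ j) =
    (fun y => (r ^+ j)^-1 * B^`(j).[r^-1 * y + 0])); last first.
    by apply/funext => z; rewrite addr0 mulrC (mulrC z).
  apply: (is_derive_eq h2); rewrite addr0 -derivnS (mulrC _ y) exprS invfM; ring.
have dk t x i (y : R) : is_derive y 1 (fun y => t^-1 ^+ i * D i ((x - y) / t))
     (- (t^-1 ^+ i.+1 * D i.+1 ((x - y) / t))).
  have h := @is_derive_affine_comp R (D i) y (- t^-1) (x / t) _ (dD i _).
  have h2 := is_derive_mulrc (t^-1 ^+ i) h.
  have E z : - t^-1 * z + x / t = (x - z) / t by ring.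
  rewrite (_ : (fun y => t^-1 ^+ i * D i ((x - y) / t)) =
     (fun y => t^-1 ^+ i * D i (- t^-1 * y + x / t))); last by apply/funext => z; rewrite E.
  apply: (is_derive_eq h2); rewrite E exprSr -[logistic_tower]/D; ring.
have cG t x j i : continuous (G t x j i).
  move=> y; apply: differentiable_continuous; apply/derivable1_diffP.
  by have [] := is_derive_mulr (dq j y) (dk t x i y).
have mG t x j i : measurable_fun setT (G t x j i) by exact: continuous_measurable_fun.
have iG t x j i : leb.-integrable `[0, r] (EFin \o G t x j i).
  apply: continuous_compact_integrable; first exact: segment_compact.
  exact: continuous_subspaceT.
pose I t x j i := \int[leb]_(y in `[0, r]) G t x j i y.
have shift t x j i : (j < A)%N -> I t x j.+1 i = I t x j i.+1.
  move=> jA; apply/eqP; rewrite -subr_eq0 -RintegralB//; apply/eqP.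
  have h1 y : is_derive y 1 (G t x j i) (G t x j.+1 i y - G t x j i.+1 y).
    by apply: (is_derive_eq (is_derive_mulr (dq j y) (dk t x i y))); rewrite mulrN.
  have h2 : continuous (fun y => G t x j.+1 i y - G t x j i.+1 y).
    by move=> y; apply: cvgB; exact: cG.
  rewrite (FTC_is_derive h1 h2) /G divff ?gt_eqF// mul0r !root_bump_derivn ?eqxx ?orbT//.
  by rewrite !mul0r subrr.
have shiftn t x n i j : (i + j <= A)%N -> I t x (i + j)%N n = I t x j (n + i)%N.
  elim: i n j => [|i IH] n j ijA; first by rewrite addn0.
  by rewrite addSn shift// IH ?addnS// ltnW.
have E t x : \int[leb]_(y in `[0, r]) (B^`(k).[y / r] * (t^-1 * D 1 ((x - y) / t))) =
    r ^+ k * I t x k 1%N.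
  rewrite /I -RintegralZl//; apply: eq_Rintegral => y _; rewrite /G expr1.
  by move: (t^-1 * _) => z; field; rewrite ?expf_neq0 ?gt_eqF.
have [C1 C10 hC1] := horner_unit_bound B^`(k.+1).
have [C2 C20 hC2] := horner_unit_bound B.
have [M M0 hM] := @logistic_tower_decay R k k.+1.
have ur y : 0 <= y <= r -> 0 <= y / r <= 1.
  by move=> /andP[y0 yr]; rewrite divr_ge0 ?(ltW r_gt0)//= ler_pdivrMr// mul1r.
have b1 t x : `|r ^+ k * I t x k 1%N| <= C1.
  rewrite -[1%N]/(0 + 1)%N -(shiftn t x 0 1 k)//= normrM ger0_norm ?exprn_ge0 ?(ltW r_gt0)//.
  have h : `|I t x (1 + k) 0| <= C1 / r ^+ k.+1 * r.
    apply: itv_Rintegral_le => // y yr; rewrite /G expr0 mul1r normrM normrM.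
    rewrite (ger0_norm (_ : 0 <= (r ^+ (1 + k))^-1)); last by rewrite invr_ge0 exprn_ge0// ltW.
    rewrite -[leRHS]mulr1; apply: ler_pM => //; first by rewrite mulr_ge0// invr_ge0 exprn_ge0// ltW.
      by rewrite ler_wpM2r ?hC1 ?ur// invr_ge0 exprn_ge0// ltW.
    rewrite /D /logistic_tower /= hornerX; have /andP[l0 l1] := logistic_itv ((x - y) / t).
    by rewrite ger0_norm ltW.
  apply: le_trans (ler_wpM2l _ h) _; first by rewrite exprn_ge0// ltW.
  by rewrite exprS le_eqVlt; apply/orP; left; apply/eqP; field; rewrite !gt_eqF// exprn_gt0.
have b2 t x : 0 < t -> 2 * r < `|x| -> `|r ^+ k * I t x k 1%N| <= r ^+ k * (C2 * (M * (2 / `|x|) ^+ k.+1) * r).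
  move=> t0 xr; have x0 : 0 < `|x| by apply: lt_trans xr; rewrite mulr_gt0.
  rewrite normrM ger0_norm ?exprn_ge0 ?(ltW r_gt0)// ler_wpM2l ?exprn_ge0 ?(ltW r_gt0)//.
  rewrite -[k in I t x k _]addn0 shiftn ?addn0 ?(ltnW kA)// add1n.
  apply: itv_Rintegral_le => // y yr; rewrite /G expr0 divr1 normrM.
  apply: ler_pM => //; first by rewrite derivn0; apply: hC2; exact: ur.
  have xy : `|x| / 2 <= `|x - y|.
    have := lerB_dist x y; have : `|y| <= r by case/andP: yr => y0 yr; rewrite ger0_norm.
    by lra.
  have xy0 : 0 < `|x - y| by apply: lt_le_trans xy; rewrite divr_gt0.
  rewrite normrM ger0_norm ?exprn_ge0 ?invr_ge0 ?(ltW t0)//.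
  have h := hM ((x - y) / t).
  have h' : (`|x - y| / t) ^+ k.+1 * `|D k.+1 ((x - y) / t)| <= M.
    apply: le_trans h; rewrite ler_wpM2r// lerXn2r ?nnegrE ?divr_ge0 ?addr_ge0 ?(ltW t0)//.
    by rewrite normrM normfV (gtr0_norm t0) lerDr.
  have {}h' : t^-1 ^+ k.+1 * `|D k.+1 ((x - y) / t)| <= M * `|x - y|^-1 ^+ k.+1.
    rewrite [`|x - y|^-1 ^+ _]exprVn ler_pdivlMr ?exprn_gt0//; apply: le_trans h'.
    by rewrite exprMn [leLHS]mulrC mulrA.
  apply: le_trans h' _; rewrite ler_wpM2l ?(ltW M0)// lerXn2r ?nnegrE ?invr_ge0 ?divr_ge0//.
  by rewrite -[leRHS]invrK lef_pV2 ?posrE ?invr_gt0 ?divr_gt0// invf_div.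
pose C3 := r ^+ k * (C2 * (M * 2 ^+ k.+1) * r) * (1 + (2 * r)^-1) ^+ k.+1.
have C30 : 0 < C3.
  by rewrite /C3 !mulr_gt0 ?exprn_gt0 ?addr_gt0 ?invr_gt0 ?mulr_gt0.
exists (C1 * (1 + 2 * r) ^+ k.+1 + C3) => [|t x t0].
  by rewrite addr_gt0// mulr_gt0// exprn_gt0// addr_gt0// mulr_gt0.
have x1 : 0 < 1 + `|x| by rewrite ltr_pwDl.
rewrite E ler_pdivlMr ?exprn_gt0//.
have [xr|xr] := leP `|x| (2 * r).
  apply: ler_wpDr; first exact: ltW.
  apply: ler_pM => //.
  by rewrite lerXn2r ?nnegrE ?addr_ge0 ?mulr_ge0 ?(ltW r_gt0)// lerD2l.
apply: ler_wpDl; first by rewrite mulr_ge0 ?(ltW C10)// exprn_ge0// addr_ge0// mulr_ge0// ltW.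
apply: le_trans (ler_wpM2r _ (b2 t x t0 xr)) _; first by rewrite exprn_ge0// ltW.
have xp : 0 < `|x| by apply: lt_trans xr; rewrite mulr_gt0.
rewrite exprMn exprVn /C3.
have -> : r ^+ k * (C2 * (M * (2 ^+ k.+1 / `|x| ^+ k.+1)) * r) * (1 + `|x|) ^+ k.+1 =
   r ^+ k * (C2 * (M * 2 ^+ k.+1) * r) * ((1 + `|x|) / `|x|) ^+ k.+1.
  by rewrite expr_div_n; ring.
rewrite ler_wpM2l//; first by rewrite !mulr_ge0 ?exprn_ge0 ?(ltW r_gt0) ?(ltW C20) ?(ltW M0).
rewrite lerXn2r ?nnegrE ?divr_ge0 ?addr_ge0 ?invr_ge0 ?mulr_ge0 ?(ltW r_gt0)//.
rewrite mulrDl divff ?gt_eqF// mul1r addrC lerD2l lef_pV2 ?posrE ?mulr_gt0//.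
exact: ltW.
Qed.

End interval_integrals.

(** * Lower bound for one-dimensional pairings *)

Section laguerre_lower_bound.
Context {R : realType}.
Local Notation leb := (@lebesgue_measure R).

(** Dividing by the value [rising (a + 1) k] at [0] leaves coefficients of size at most [k^j], so
    the polynomial behaves as this value times a series in [k u]. *)
Lemma laguerre_coef (k j : nat) (a : R) : 0 <= a -> (j <= k)%N -> (laguerre_poly k a)`_j =
  rising (a + 1) k * ((-1) ^+ j * (k ^_ j)%:R / (j`!%:R * \prod_(i < j) (a + i.+1%:R))).
Proof.
move=> a0 jk; rewrite /laguerre_poly coef_poly ltnS jk /rising.
have E : \prod_(l < k) (a + 1 + l%:R) = (\prod_(i < j) (a + i.+1%:R)) * \prod_(j <= i < k) (a + i.+1%:R).
  rewrite -(big_mkord xpredT (fun i => a + i.+1%:R)) -big_cat_nat//=.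
  rewrite big_mkord; apply: eq_bigr => i _; rewrite -(natr1 i); ring.
have p0 : \prod_(i < j) (a + i.+1%:R) != 0 by rewrite gt_eqF// prodr_gt0// => i _; rewrite ltr_wpDl.
have F : k`!%:R = (k ^_ j)%:R * (k - j)`!%:R :> R by rewrite -natrM ffact_fact.
have f1 : (k ^_ j)%:R != 0 :> R by rewrite pnatr_eq0 -lt0n ffact_gt0.
have [f2 f3] := (@factR_neq0 R (k - j), @factR_neq0 R j).
rewrite E F natrM; field; rewrite ?p0 ?f1 ?f2 ?f3//.
Qed.

Lemma geometric_half_le (n : nat) : \sum_(j < n) (2^-1 : R) ^+ j <= 2.
Proof.
suff -> : \sum_(j < n) (2^-1 : R) ^+ j = 2 - 2 * 2^-1 ^+ n by rewrite gerBl mulr_ge0// exprn_ge0.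
elim: n => [|n IH]; first by rewrite big_ord0 expr0; ring.
by rewrite big_ord_recr /= IH exprS; field.
Qed.

Lemma ffact_ge (k j : nat) : (2 * j <= k)%N -> (k%:R / 2) ^+ j <= (k ^_ j)%:R :> R.
Proof.
move=> jk; elim: j jk => [|j IH] jk; first by rewrite expr0.
have jk' : (2 * j <= k)%N by rewrite (leq_trans _ jk)// leq_mul2l leqnSn.
rewrite ffactnSr natrM exprSr; apply: ler_pM; rewrite ?exprn_ge0 ?divr_ge0 ?IH//.
rewrite natrB; last by rewrite (leq_trans _ jk')// leq_pmull.
have : 2 * j%:R <= k%:R :> R by rewrite -natrM ler_nat.
by lra.
Qed.

Lemma ffact_le_expn (k j : nat) : (k ^_ j <= k ^ j)%N.
Proof.
by elim: j => // j IH; rewrite ffactnSr expnSr leq_mul// leq_subr.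
Qed.

Lemma main_term_eq (J pj K r : R) (j : nat) : pj != 0 ->
  J / (2 ^+ j * pj) * (K * r) ^+ j = (K / 2) ^+ j * (pj^-1 * r ^+ j * J).
Proof. by move=> pj0; rewrite expr_div_n exprMn; field; rewrite pj0 expf_neq0. Qed.

Lemma three_terms_le (h e s c : R) : e <= h -> 2 * c <= h -> s <= c -> c <= (h + h) - e - s.
Proof. by lra. Qed.

Lemma twice_quarter (c y : R) : 2 * (c / 4 * y) = c / 2 * y.
Proof. by field. Qed.

Lemma rest_term_eq (S rk ra r : R) : S * (rk * 2 * ra) * (r / 2) * r = rk * (ra * r) * (S * r).
Proof. by field. Qed.

Variables (a : R) (Q A : nat).
Hypotheses (a_ge0 : 0 <= a) (QA : (Q.+1 < A)%N).
Let b := (bump_poly A : {poly R})^`(Q.+1).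
Let I j := unit_moment (a / 2 + j%:R) b.
Let S := 1 + \sum_(l < size b) `|b`_l|.

Let S_gt0 : 0 < S. Proof. by rewrite ltr_pwDl// sumr_ge0. Qed.

Let be_ge0 j : 0 <= a / 2 + j%:R. Proof. by rewrite addr_ge0// divr_ge0. Qed.

Let I_le j : `|I j| <= S.
Proof.
apply: ler_wpDl => //; apply: le_trans (ler_norm_sum _ _ _) _; apply: ler_sum => l _.
have h0 : 0 <= l%:R + (a / 2 + j%:R) + 1 by rewrite !addr_ge0// divr_ge0.
rewrite normrM ler_piMr// ger0_norm ?invr_ge0//.
have h : 1 <= l%:R + (a / 2 + j%:R) + 1 by rewrite lerDr; apply: addr_ge0 => //; exact: be_ge0.
by rewrite invf_le1// (lt_le_trans ltr01).
Qed.

Let b_le s : 0 <= s <= 1 -> `|b.[s]| <= S.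
Proof.
move=> /andP[s0 s1]; rewrite horner_coef; apply: le_trans (ler_norm_sum _ _ _) _; apply: ler_wpDl => //.
by apply: ler_sum => j _; rewrite normrM ler_piMr// normrX exprn_ile1// ger0_norm.
Qed.

(** The index [Q.+1] works: [a / 2 + Q.+1] exceeds all the zeros [0, ..., Q] of the product in
    [unit_moment_bump_derivn]. A smaller index may work too, and [j0] is the least. *)
Let I_neq0 : exists j, I j != 0.
Proof.
exists Q.+1; rewrite /I /b unit_moment_bump_derivn ?(ltnW QA)//; last first.
  have : (Q.+1%:R : R) < A%:R by rewrite ltr_nat.
  by have := be_ge0 Q.+1; lra.
rewrite mulf_neq0//.
  apply/prodf_neq0 => j _; rewrite subr_eq0 lt_eqF//.
  by rewrite ltr_wpDl ?divr_ge0// ltr_nat.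
rewrite gt_eqF// unit_moment_bump// addrK addr_ge0// divr_ge0//.
Qed.

Let j0 := ex_minn I_neq0.

Let Ij0 : I j0 != 0. Proof. by rewrite /j0; case: ex_minnP. Qed.

Let I_lt_j0 j : (j < j0)%N -> I j = 0.
Proof.
rewrite /j0; case: ex_minnP => m _ h jm; apply/eqP; apply: contraTT jm => /h.
by rewrite -leqNgt.
Qed.

Let ck k : R := Num.sqrt (gamma_function (k%:R + 1) / gamma_function (k%:R + a + 1)).
Let rk k : R := rising (a + 1) k.

Let rk_gt0 k : 0 < rk k. Proof. by rewrite rising_gt0// ltr_wpDl. Qed.

Let w k j : R := (-1) ^+ j * (k ^_ j)%:R / (j`!%:R * \prod_(i < j) (a + i.+1%:R)).

Let w_le k j : `|w k j| <= k%:R ^+ j.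
Proof.
have p1 : 1 <= \prod_(i < j) (a + i.+1%:R).
  by elim/big_ind : _ => // [x y x1 y1|i _]; [rewrite -[1]mulr1 ler_pM|rewrite ler_wpDl// ler1n].
have f1 : 1 <= j`!%:R :> R by rewrite ler1n fact_gt0.
have fp : 1 <= j`!%:R * \prod_(i < j) (a + i.+1%:R) by exact: mulr_ege1.
rewrite /w normrM normrM normrX normrN1 expr1n mul1r.
rewrite (ger0_norm (ler0n _ _)) ger0_norm ?invr_ge0 ?(le_trans ler01)//.
rewrite -[leRHS]mulr1; apply: ler_pM.
- exact: ler0n.
- by rewrite invr_ge0 (le_trans ler01).
- by rewrite -natrX ler_nat ffact_le_expn.
- by rewrite invf_le1// (lt_le_trans ltr01).
Qed.

Let integral_lag k r : 0 < r -> \int[leb]_(y in `[0, r]) (b.[y / r] * (lag k a y * y `^ (a / 2))) =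
  rk k * r `^ (a / 2 + 1) * \sum_(j < k.+1) w k j * r ^+ j * I j.
Proof.
move=> r0.
have fi j : leb.-integrable `[0, r] (EFin \o (fun y => b.[y / r] * y `^ (a / 2 + j%:R))).
  apply: (@itv_integrable R r r0 _ (S * r `^ (a / 2 + j%:R))).
    apply: measurable_funM; last exact: measurable_powR.
    by apply: measurableT_comp; [exact: measurable_horner|exact: measurable_funM].
  move=> y /andP[y0 yr]; rewrite normrM ler_pM ?b_le//.
    by rewrite divr_ge0 ?(ltW r0)//= ler_pdivrMr// mul1r.
  by rewrite ger0_norm ?powR_ge0// ge0_ler_powR ?nnegrE// (le_trans y0).
have [_ H] := @Rintegral_lincomb R r k.+1 (fun j => (laguerre_poly k a)`_j) _ fi.
transitivity (\int[leb]_(y in `[0, r])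
    (\sum_(j < k.+1) (laguerre_poly k a)`_j * (b.[y / r] * y `^ (a / 2 + j%:R)))).
  apply: eq_Rintegral => y; rewrite inE/= in_itv/= => /andP[y0 _].
  have -> : lag k a y = \sum_(j < k.+1) (laguerre_poly k a)`_j * y ^+ j.
    by rewrite /lag (horner_coef_wide _ (size_poly _ _)).
  rewrite mulr_suml mulr_sumr; apply: eq_bigr => j _.
  have -> : y `^ (a / 2 + j%:R) = y ^+ j * y `^ (a / 2).
    have [->|yn0] := eqVneq y 0.
      case: (nat_of_ord j) => [|j']; first by rewrite expr0 mul1r addr0.
      by rewrite expr0n /= mul0r powR0// gt_eqF// ltr_wpDl ?divr_ge0.
    have yp : 0 < y by rewrite lt_neqAle eq_sym yn0.
    by rewrite gt0_powRD// powR_mulrn// mulrC.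
  by ring.
rewrite H mulr_sumr; apply: eq_bigr => j _.
rewrite Rintegral_horner_powR// laguerre_coef// -/(w k j) -/(rk k) -/(I j); last by rewrite -ltnS.
rewrite addrAC gt0_powRD// powR_mulrn ?(ltW r0)//; ring.
Qed.

Let sum_le k r J : 0 <= r -> k%:R * r <= 2^-1 ->
  \sum_(j < k.+1 | (J <= j)%N) `|w k j * r ^+ j| <= 2 * 2 ^+ J * (k%:R * r) ^+ J.
Proof.
move=> r0 kr; have kr0 : 0 <= k%:R * r by rewrite mulr_ge0.
apply: (@le_trans _ _ (\sum_(j < k.+1) (2 ^+ J * (k%:R * r) ^+ J) * 2^-1 ^+ j)).
  rewrite big_mkcond /=; apply: ler_sum => j _; case: ifP => Jj.
    rewrite normrM [`|r ^+ j|]ger0_norm ?exprn_ge0//.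
    apply: le_trans (ler_wpM2r _ (w_le k j)) _; first exact: exprn_ge0.
    rewrite -exprMn -(subnK Jj) !exprD mulrCA mulrC -!mulrA.
    rewrite [2^-1 ^+ (j - J) * _]mulrC !mulrA -[leRHS]mulrA.
    have -> : 2 ^+ J * (k%:R * r) ^+ J * (2^-1 ^+ J * 2^-1 ^+ (j - J)) =
       (k%:R * r) ^+ J * 2^-1 ^+ (j - J).
      by rewrite exprVn; field; rewrite expf_neq0.
    by rewrite ler_wpM2l ?exprn_ge0// lerXn2r ?nnegrE.
  by rewrite !mulr_ge0 ?exprn_ge0.
rewrite -mulr_sumr; apply: le_trans (ler_wpM2l _ (geometric_half_le _)) _.
  by rewrite mulr_ge0 ?exprn_ge0.
rewrite le_eqVlt; apply/orP; left; apply/eqP; ring.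
Qed.

(** Up to a common factor and with [x = k r], the first nonzero moment contributes at least
    [c1 x^j0], the later ones at most [e1 x^(j0 + 1)], and replacing [exp (- y / 2)] by [1] costs at
    most [S r]. Small [x] controls the second, large [k] the third. Every smaller [dl] is allowed
    because all coordinates must share one. *)
Lemma laguerre1_bump_lower : exists2 d0 : R, 0 < d0 & forall dl : R, 0 < dl -> dl <= d0 ->
  exists2 c : R, 0 < c & exists k0 : nat, forall k r, (k0 <= k)%N -> 0 < r ->
  dl / 2 <= k%:R * r <= dl ->
  c * r <= `|\int[leb]_(y in `[0, r]) (b.[y / r] * laguerre1 k a y)|.
Proof.
pose pj : R := j0`!%:R * \prod_(i < j0) (a + i.+1%:R).
have pj0 : 0 < pj.
  by rewrite mulr_gt0 ?ltr0n ?fact_gt0// prodr_gt0// => i _; rewrite ltr_wpDl.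
pose c1 := `|I j0| / (2 ^+ j0 * pj).
have c10 : 0 < c1 by rewrite divr_gt0 ?normr_gt0// mulr_gt0// exprn_gt0.
pose e1 := S * (2 * 2 ^+ j0.+1).
have e10 : 0 < e1 by rewrite !mulr_gt0// exprn_gt0.
(* [2^-1] is for the geometric tail in [sum_le]; [c1 / (2 * e1)] makes the later terms at most half
   of the main one. *)
exists (Num.min 2^-1 (c1 / (2 * e1))) => [|dl dl0].
  by rewrite lt_min invr_gt0 ltr0n divr_gt0// mulr_gt0.
rewrite le_min => /andP[dl1 dl2].
have [cr [Cr [cr0 Cr0 HR]]] := @rising_asymp R a a_ge0.
have G0 : 0 < gamma_function (a + 1) by apply: gamma_gt0; rewrite lerDr.
(* Half of the main term pays for the tail and half of the rest for the exponential; [dl / 2] is the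
   least value of [x]. *)
pose c2 := (c1 / 4) * (dl / 2) ^+ j0.
have c20 : 0 < c2 by apply: mulr_gt0; [exact: divr_gt0|apply: exprn_gt0; exact: divr_gt0].
(* Bounds from below the normalising constant times [rising (a + 1) k] times [r^(a / 2)], which is
   of size [(k r)^(a / 2)]. *)
pose c3 := Num.sqrt (cr / gamma_function (a + 1)) * (dl / 2) `^ (a / 2).
have c30 : 0 < c3 by rewrite mulr_gt0 ?sqrtr_gt0 ?powR_gt0 ?divr_gt0.
exists (c3 * c2); first exact: mulr_gt0.
(* The first threshold is for [ffact_ge]; the second gives [S r <= c2]. *)
exists (maxn (2 * j0).+1 (Num.truncn (S / c2)).+1) => k r hk r0 /andP[kr1 kr2].
have kj0 : (2 * j0 < k)%N by rewrite (leq_trans _ hk)// leq_maxl.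
have kS : S / c2 < k%:R.
  by apply: lt_le_trans (truncnS_gt _) _; rewrite ler_nat (leq_trans _ hk)// leq_maxr.
have k0 : (0 : R) < k%:R by rewrite ltr0n; exact: leq_ltn_trans kj0.
have kr_half : k%:R * r <= 2^-1 by exact: le_trans kr2 dl1.
set x := k%:R * r in kr1 kr2 kr_half.
have x0 : 0 < x by rewrite mulr_gt0.
pose Main := \sum_(j < k.+1) w k j * r ^+ j * I j.
have hMain : c1 * x ^+ j0 - e1 * x ^+ j0.+1 <= `|Main|.
  have j0k : (j0 < k.+1)%N by rewrite ltnS ltnW// (leq_ltn_trans _ kj0)// leq_pmull.
  rewrite /Main (bigD1 (Ordinal j0k))//=.
  set rest := \sum_(i < k.+1 | _) _.
  have hrest : `|rest| <= e1 * x ^+ j0.+1.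
    apply: le_trans (ler_norm_sum _ _ _) _.
    apply: (@le_trans _ _ (\sum_(j < k.+1 | (j0.+1 <= j)%N) `|w k j * r ^+ j| * S)).
      rewrite big_mkcond [leRHS]big_mkcond; apply: ler_sum => j _.
      case: ifPn => [jj0|_]; last by case: ifP => // _; rewrite mulr_ge0// ltW.
      have [jl|jl|jE] := ltngtP j j0.
      - by rewrite I_lt_j0// mulr0 normr0.
      - by rewrite normrM ler_wpM2l.
      - by move/eqP: jj0; case; apply/val_inj.
    rewrite -mulr_suml mulrC /e1 -mulrA ler_wpM2l ?(ltW S_gt0)//.
    exact: (sum_le j0.+1 (ltW r0) kr_half).
  have hmain : c1 * x ^+ j0 <= `|w k j0 * r ^+ j0 * I j0|.
    rewrite /w -/pj !normrM normrX normrN1 expr1n mul1r.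
    rewrite (ger0_norm (ler0n _ _)) normfV (gtr0_norm pj0) (@ger0_norm _ (r ^+ j0)) ?exprn_ge0 ?(ltW r0)//.
    have h := ffact_ge (ltnW kj0).
    have -> : c1 * x ^+ j0 = (k%:R / 2) ^+ j0 * (pj^-1 * r ^+ j0 * `|I j0|).
      by apply: main_term_eq; rewrite gt_eqF.
    by rewrite -!mulrA ler_wpM2r// !mulr_ge0 ?invr_ge0 ?(ltW pj0) ?exprn_ge0 ?(ltW r0).
  by apply: le_trans (lerB_normD (w k j0 * r ^+ j0 * I j0) rest); exact: lerB.
pose L y := lag k a y * y `^ (a / 2).
have mL : measurable_fun setT L.
  by apply: measurable_funM; [exact: measurable_horner|exact: measurable_powR].
have mb : measurable_fun setT (fun y : R => b.[y / r]).
  by apply: measurableT_comp; [exact: measurable_horner|exact: measurable_funM].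
have me : measurable_fun setT (fun y : R => expR (- (y / 2))).
  apply: measurableT_comp => //; apply: measurableT_comp => //; exact: measurable_funM.
have yr1 y : 0 <= y <= r -> 0 <= y / r <= 1.
  by move=> /andP[y0 yr]; rewrite divr_ge0 ?(ltW r0)//= ler_pdivrMr// mul1r.
have hL y : 0 <= y <= r -> `|L y| <= rk k * 2 * r `^ (a / 2).
  move=> /andP[y0 yr]; rewrite normrM; apply: ler_pM => //; last first.
    by rewrite ger0_norm ?powR_ge0// ge0_ler_powR ?nnegrE ?divr_ge0// ltW.
  have sp : (size (laguerre_poly k a) <= k.+1)%N by exact: size_poly.
  rewrite /lag (horner_coef_wide _ sp).
  rewrite (eq_bigr (fun j : 'I_k.+1 => rk k * (w k j * y ^+ j))) => [|j _]; last first.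
    by rewrite laguerre_coef// ?mulrA// -ltnS.
  rewrite -mulr_sumr normrM (gtr0_norm (rk_gt0 k)) ler_wpM2l ?(ltW (rk_gt0 k))//.
  apply: le_trans (ler_norm_sum _ _ _) _.
  have := @sum_le k r 0 (ltW r0) kr_half; rewrite !expr0 !mulr1; apply: le_trans.
  apply: ler_sum => j _; rewrite !normrM ler_wpM2l// !normrX lerXn2r ?nnegrE//.
  by rewrite !ger0_norm// ltW.
pose rest := \int[leb]_(y in `[0, r]) (b.[y / r] * (L y * (1 - expR (- (y / 2))))).
have bE y : 0 <= y <= r -> `|b.[y / r] * (L y * (1 - expR (- (y / 2))))| <=
    S * (rk k * 2 * r `^ (a / 2)) * (r / 2).
  move=> yr; rewrite normrM normrM mulrA; apply: ler_pM => //.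
    by apply: ler_pM => //; [apply: b_le; exact: yr1|exact: hL].
  have /andP[y0 yr'] := yr.
  have h1 : 1 - expR (- (y / 2)) <= y / 2 by rewrite lerBlDr -lerBlDl; exact: expR_ge1Dx.
  rewrite ger0_norm; first by apply: le_trans h1 _; rewrite ler_wpM2r.
  by rewrite subr_ge0 -expR0 ler_expR oppr_le0 divr_ge0.
have hrest : `|rest| <= S * (rk k * 2 * r `^ (a / 2)) * (r / 2) * r.
  apply: (itv_Rintegral_le r0) bE.
  apply: measurable_funM => //; apply: measurable_funM => //.
  exact: measurable_funB.
have iL : leb.-integrable `[0, r] (EFin \o (fun y => b.[y / r] * L y)).
  apply: (@itv_integrable R r r0 _ (S * (rk k * 2 * r `^ (a / 2)))); first exact: measurable_funM.
  by move=> y yr; rewrite normrM ler_pM ?hL// b_le// yr1.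
have irest : leb.-integrable `[0, r] (EFin \o (fun y => b.[y / r] * (L y * (1 - expR (- (y / 2)))))).
  apply: (@itv_integrable R r r0 _ _ _ bE).
  apply: measurable_funM => //; apply: measurable_funM => //.
  exact: measurable_funB.
have -> : \int[leb]_(y in `[0, r]) (b.[y / r] * laguerre1 k a y) =
   ck k * (rk k * r `^ (a / 2 + 1) * Main - rest).
  rewrite -integral_lag// /rest -RintegralB// -RintegralZl//; last first.
    exact: (integrableB _ iL irest).
  by apply: eq_Rintegral => y _; rewrite /laguerre1 -/(ck k) -/(lag k a y) /L; ring.
have ck0 : 0 <= ck k by exact: sqrtr_ge0.
have ckrk : Num.sqrt (cr / gamma_function (a + 1)) * k%:R `^ (a / 2) <= ck k * rk k.
  have rkE : rk k = Num.sqrt (rk k * rk k) by rewrite -expr2 sqrtr_sqr gtr0_norm.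
  have ckE : ck k = Num.sqrt (gamma_function (a + 1) * rk k)^-1 by rewrite /ck gamma_ratio.
  have g1 : 0 <= cr / gamma_function (a + 1) by rewrite divr_ge0// ltW.
  have g2 : 0 <= (gamma_function (a + 1) * rk k)^-1.
    by rewrite invr_ge0 mulr_ge0 ?(ltW G0)// ltW// rk_gt0.
  rewrite [in leRHS]rkE.
  have -> : k%:R `^ (a / 2) = Num.sqrt (k%:R `^ a) by rewrite -powR12_sqrt ?powR_ge0// -powRrM.
  rewrite ckE -(sqrtrM _ g1) -(sqrtrM _ g2); apply: ler_wsqrtr.
  have -> : (gamma_function (a + 1) * rk k)^-1 * (rk k * rk k) = rk k / gamma_function (a + 1).
    by field; rewrite !gt_eqF// rk_gt0.
  rewrite mulrAC ler_wpM2r ?invr_ge0 ?(ltW G0)//.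
  have /andP[h _] := HR k; apply: le_trans h; rewrite ler_wpM2l ?(ltW cr0)//.
  by rewrite ge0_ler_powR ?nnegrE// ler_nat.
rewrite normrM (ger0_norm ck0).
have h1 : rk k * r `^ (a / 2 + 1) * (c1 * x ^+ j0 - e1 * x ^+ j0.+1 - S * r) <=
    `|rk k * r `^ (a / 2 + 1) * Main - rest|.
  have := lerB_dist (rk k * r `^ (a / 2 + 1) * Main) rest.
  apply: le_trans; rewrite normrM.
  have rr0 : 0 < rk k * r `^ (a / 2 + 1) by rewrite mulr_gt0 ?rk_gt0 ?powR_gt0.
  rewrite (gtr0_norm rr0) mulrBr; apply: lerB; first by rewrite ler_pM2l.
  apply: le_trans hrest _; rewrite (gt0_powRD _ _ r0) powRr1 ?(ltW r0)//.
  by rewrite rest_term_eq.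
have h2 : c2 <= c1 * x ^+ j0 - e1 * x ^+ j0.+1 - S * r.
  have e1x : e1 * x ^+ j0.+1 <= c1 / 2 * x ^+ j0.
    rewrite exprS mulrA ler_wpM2r ?exprn_ge0 ?(ltW x0)//.
    apply: (@le_trans _ _ (e1 * (c1 / (2 * e1)))); first by rewrite ler_wpM2l ?(ltW e10)// (le_trans kr2).
    by rewrite invfM mulrA mulrCA mulrA mulfK ?gt_eqF// || rewrite mulrC -mulrA invfM mulfVK ?gt_eqF.
  have c2x : 2 * c2 <= c1 / 2 * x ^+ j0.
    have -> : 2 * c2 = c1 / 2 * (dl / 2) ^+ j0 by exact: twice_quarter.
    apply: ler_wpM2l; first by apply: divr_ge0 => //; exact: ltW.
    by apply: lerXn2r => //; rewrite nnegrE ?divr_ge0// ltW.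
  have Sr : S * r <= c2.
    have : S < c2 * k%:R by rewrite mulrC -ltr_pdivrMr.
    move=> /ltW/(ler_wpM2r (ltW r0)) h; apply: le_trans h _.
    rewrite -mulrA -/x ler_piMr ?(ltW c20)//; apply: le_trans kr_half _.
    by rewrite invf_le1// ler1n.
  have -> : c1 * x ^+ j0 = c1 / 2 * x ^+ j0 + c1 / 2 * x ^+ j0.
    by rewrite -mulrDl -splitr.
  exact: three_terms_le.
apply: le_trans (ler_wpM2l ck0 h1); rewrite (mulrAC c3 c2 r) [leRHS]mulrA.
apply: ler_pM; [by apply: mulr_ge0; exact: ltW|exact: ltW| |exact: h2].
rewrite [leRHS]mulrA (gt0_powRD _ _ r0) (powRr1 (ltW r0)) [leRHS]mulrA.
apply: ler_wpM2r; first exact: ltW.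
apply: le_trans (ler_wpM2r (powR_ge0 _ _) ckrk).
rewrite /c3 -[leRHS]mulrA ler_wpM2l ?sqrtr_ge0// -powRM ?(ltW k0) ?(ltW r0)// -/x.
by rewrite ge0_ler_powR ?nnegrE ?divr_ge0 ?(ltW dl0) ?(ltW x0).
Qed.

End laguerre_lower_bound.

Section functions_on_rV.
Context {R : realType} {d : nat}.
Local Notation V := 'rV[R]_d.
Local Notation mu := (@lebesgue_rV R d).

(** Stated without measurability, for use on the maximal function, a supremum over a continuum of
    dilations. *)
Lemma le_ge0_integralT (f g : V -> \bar R) : (forall x, 0 <= f x)%E ->
  (forall x, f x <= g x)%E -> (\int[mu]_x f x <= \int[mu]_x g x)%E.
Proof.
move=> f0 fg; have g0 x : (0 <= g x)%E by apply: le_trans (fg x).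
rewrite !ge0_integralTE//; apply: ereal_sup_le => _ [h /= hf <-].
by exists h => // x; apply: le_trans (fg x); exact: hf.
Qed.

Definition floor_mesh (N : nat) (y : R) : int := Num.floor (N.+1%:R * y).

(* The sigma-algebra of ['rV[R]_d] is generated by the coordinates, so
   measurability comes from approximation by functions of a countable mesh. *)
Lemma measurable_continuous_rV (f : V -> R) : continuous f -> measurable_fun setT f.
Proof.
move=> cf.
pose z N (x : V) : 'rV[int]_d := \row_i floor_mesh N (x ord0 i).
pose h N (w : 'rV[int]_d) : R := f (\row_i (N.+1%:R^-1 * (w ord0 i)%:~R)).
apply: (@measurable_fun_cvg _ _ _ _ (fun N => h N \o z N)).
  move=> N _ Y mY; rewrite setTI.
  rewrite (_ : _ @^-1` _ = \bigcup_(w in [set: 'rV[int]_d]) ((fun x => z N x = w /\ Y (h N w)) : set V)); last first.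
    by apply/seteqP; split => x /=; [move=> hx; exists (z N x)|case=> w _ [<-]].
  apply: countable_bigcupT_measurable; first exact: countableP.
  move=> w; have [Yw|nYw] := pselect (Y (h N w)); last first.
    rewrite (_ : (fun x => _) = set0); first exact: measurable0.
    by apply/seteqP; split => x // -[].
  rewrite (_ : (fun x => _) = [set x : V | forall i,
      `[N.+1%:R^-1 * (w ord0 i)%:~R, N.+1%:R^-1 * (w ord0 i + 1)%:~R[%classic (x ord0 i)]); last first.
    have N0 : (0 : R) < N.+1%:R by rewrite ltr0n.
    apply/seteqP; split => x /=.
      move=> [<- _] i; rewrite in_itv/= mxE /floor_mesh.
      have /andP[h1 h2] := floor_itv (N.+1%:R * x ord0 i).
      by rewrite ler_pdivrMl// h1 ltr_pdivlMl.
    move=> hx; split=> //; apply/rowP => i; rewrite mxE; apply/eqP; rewrite floor_eq.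
    have := hx i; rewrite in_itv/= => /andP[h1 h2].
    by rewrite -ler_pdivrMl// h1 -ltr_pdivlMl.
  exact: (@measurable_box R d (fun i => `[N.+1%:R^-1 * (w ord0 i)%:~R, N.+1%:R^-1 * (w ord0 i + 1)%:~R[%classic)
    (fun=> measurable_itv _)).
move=> x _; rewrite /comp /h.
have hc : (fun N => \row_i (N.+1%:R^-1 * (z N x ord0 i)%:~R) : V) @ \oo --> x.
  apply/cvgrPdist_le => e e0.
  have := @cvg_harmonic R => /cvgrPdist_le/(_ e e0); apply: filterS => N hN.
  rewrite [`|x - _|]mx_normrE; apply/bigmax_leP; split => [|[i j] _ /=]; first exact: ltW.
  rewrite !mxE (ord1 i) /floor_mesh.
  have N0 : (0 : R) < N.+1%:R by rewrite ltr0n.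
  have /andP[h1 h2] := floor_itv (N.+1%:R * x ord0 j).
  apply: le_trans hN; rewrite sub0r normrN [leRHS]ger0_norm ?invr_ge0//.
  have -> : x ord0 j - N.+1%:R^-1 * (Num.floor (N.+1%:R * x ord0 j))%:~R =
     N.+1%:R^-1 * (N.+1%:R * x ord0 j - (Num.floor (N.+1%:R * x ord0 j))%:~R).
    by rewrite mulrBr mulKf// gt_eqF.
  rewrite normrM ger0_norm ?invr_ge0// ler_piMr ?invr_ge0//.
  rewrite ger0_norm ?subr_ge0// lerBlDr -(intrD _ 1) addrC; exact: ltW.
exact: (cvg_comp _ _ hc (cf x)).
Qed.

Lemma schwartz_continuous (phi : V -> R) : schwartz phi -> continuous phi.
Proof. by move=> [sm _] x; apply: differentiable_continuous; exact: (sm [::] x). Qed.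

Lemma schwartz_measurable (phi : V -> R) : schwartz phi -> measurable_fun setT phi.
Proof. by move=> /schwartz_continuous; exact: measurable_continuous_rV. Qed.

Lemma schwartz_bounded (phi : V -> R) : schwartz phi -> exists M, forall x, `|phi x| <= M.
Proof.
move=> [_ dec]; have [M hM] := dec 0%N [::]; exists M => x.
by have := hM x; rewrite expr0 mul1r.
Qed.

Lemma Lnorm_le_sup (q : \bar R) (a : V -> R) (B : set V) (M m : R) :
  (1 <= q)%E -> measurable_fun setT a -> measurable B -> mu B = m%:E -> 0 < m ->
  (forall x, ~ B x -> a x = 0) -> 0 <= M -> (forall x, `|a x| <= M) ->
  ('N[mu]_q[EFin \o a] <= (M * m `^ (fine q)^-1)%:E)%E.
Proof.
move=> q1 ma mB mBE m0 a0 M0 aM; rewrite unlock /Lnorm.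
case: q q1 => [q| |]// q1; last first.
  rewrite /= invr0 powRr0 mulr1; case: ifP => // _.
  apply/ess_supP; apply: aeW => x /=.
  by rewrite lee_fin.
rewrite lee_fin in q1; have q0 : 0 < q by apply: lt_le_trans q1.
have h : (\int[mu]_x `|(EFin \o a) x| `^ q <= (M `^ q * m)%:E)%E.
  apply: (@le_trans _ _ (\int[mu]_x ((M `^ q)%:E * (\1_B x)%:E))%E).
    apply: le_ge0_integralT => x; first exact: poweR_ge0.
    rewrite /= -EFinM lee_fin indicE.
    have [xB|/negP xB] := boolP (x \in B).
      by rewrite mulr1 ge0_ler_powR ?nnegrE ?(ltW q0).
    by rewrite a0 ?normr0 ?powR0 ?gt_eqF ?mulr0// => /mem_set.
  have E : (\int[mu]_x (\1_B x)%:E)%E = m%:E by rewrite integral_indic// setIT.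
  rewrite ge0_integralZl//; first by rewrite E.
  - by apply/measurable_EFinP.
  - by rewrite lee_fin powR_ge0.
apply: (@le_trans _ _ ((M `^ q * m)%:E `^ q^-1)%E).
  apply: gt0_ler_poweR; rewrite ?invr_ge0 ?(ltW q0)// ?in_itv/= ?leey ?andbT//.
    by apply: integral_ge0 => x _; rewrite /= ?lee_fin ?powR_ge0.
  by rewrite lee_fin mulr_ge0 ?powR_ge0// ltW.
rewrite poweR_EFin lee_fin powRM ?powR_ge0 ?(ltW m0)// powR_gt0K ?gt_eqF//.
Qed.

End functions_on_rV.

Section orthant_functional.
Context {R : realType} {d : nat}.
Local Notation V := 'rV[R]_d.
Local Notation mu := (@lebesgue_rV R d).
Variables (a : V -> R) (M : R).
Hypotheses (ia : mu.-integrable setT (EFin \o a))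
  (a0 : forall x, ~ orthant R d x -> a x = 0).

Definition atom_functional (phi : V -> R) : R :=
  \int[mu]_(x in orthant R d) (a x * phi x).

Let pairing_integrable (phi : V -> R) : schwartz phi ->
  mu.-integrable setT (EFin \o (fun x => a x * phi x)).
Proof.
move=> sphi; have [C hC] := schwartz_bounded sphi.
exact: (@integrable_mul_bounded R d setT a phi C ia (schwartz_measurable sphi) (fun x nx => False_ind _ (nx I)) (fun x _ => hC x)).
Qed.

Lemma tempered_atom_functional : tempered atom_functional.
Proof.
split=> [c phi psi sphi spsi|].
  rewrite /atom_functional !orthant_Rintegral//.
  rewrite -RintegralZl//; last exact: pairing_integrable.
  rewrite -RintegralD//; last 2 first.
  - exact: (integrableZl measurableT c (pairing_integrable sphi)).
  - exact: pairing_integrable.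
  by apply: eq_Rintegral => x _; ring.
exists 0%N, (\int[mu]_x `|a x|) => phi B sphi hB.
rewrite /atom_functional orthant_Rintegral// mulrC.
apply: (@le_Rintegral_mul R d setT a phi B ia (schwartz_measurable sphi)) => // [x nx|x _].
  by case: (nx I).
by have := hB 0%N [::] x isT isT; rewrite expr0 mul1r.
Qed.

Lemma supported_atom_functional : supported_in (closure (orthant R d)) atom_functional.
Proof.
move=> phi _ _ disj; rewrite /atom_functional /Rintegral integral0_eq// => x xo.
have [->|px] := eqVneq (phi x) 0; first by rewrite mulr0.
suff : (closure [set x | phi x != 0] `&` closure (orthant R d)) x by rewrite disj.
by split; apply: subset_closure.
Qed.

Lemma coef_mass_delta (p : R) : 0 < p -> coef_mass p (fun j => (j == 0%N)%:R : R) = 1%E.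
Proof.
move=> p0; apply/cvg_lim => //; apply: cvg_near_cst; exists 1%N => // n /= n1.
rewrite big_ltn//= normr1 powR1 big_nat_cond big1 ?adde0// => j /andP[/andP[j1 _] _].
by rewrite gtn_eqF// normr0 powR0// gt_eqF.
Qed.

Lemma atomic_decomposition_atom_functional (p : R) (q : \bar R) : 0 < p -> atom p q a ->
  atomic_decomposition p q atom_functional (fun j => (j == 0%N)%:R) (fun=> a).
Proof.
move=> p0 aa; split => // [|phi _]; first by rewrite coef_mass_delta// ltry.
apply: cvg_near_cst; exists 1%N => // n /= n1.
rewrite /series /= big_ltn//= mul1r big_nat_cond big1 ?addr0// => j /andP[/andP[j1 _] _].
by rewrite gtn_eqF// mul0r.
Qed.

Lemma hardy_norm_atom_functional (p : R) (q : \bar R) : 0 < p -> atom p q a ->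
  (hardy_norm p q atom_functional <= 1)%E.
Proof.
move=> p0 aa; apply: ge_ereal_inf; exists 1%E => //.
exists ((fun j => (j == 0%N)%:R), (fun=> a)); first exact: atomic_decomposition_atom_functional.
by rewrite /= coef_mass_delta// poweR1r.
Qed.

End orthant_functional.

Lemma one_sqr_le (R : realType) (u : R) : 1 + u ^+ 2 <= (1 + `|u|) ^+ 2.
Proof.
by rewrite sqrrD expr1n mul1r -[u ^+ 2]real_normK ?num_real// lerD2r lerDl mulrn_wge0.
Qed.

(** * The tensor bump atom and its maximal function *)

Section bump_atom.
Context {R : realType} {d : nat}.
Local Notation V := 'rV[R]_d.
Local Notation mu := (@lebesgue_rV R d).
Local Notation leb := (@lebesgue_measure R).
Variables (p : R) (q : \bar R) (Q : nat).
Hypotheses (d_gt0 : (0 < d)%N) (p_gt0 : 0 < p) (p_lt1 : p < 1) (q_ge1 : (1 <= q)%E).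
Hypotheses (PQ : (moment_order (d := d) p <= Q)%N) (Qp : 2 <= Q.+2%:R * p).

Let b := (bump_poly Q.+2 : {poly R})^`(Q.+1).

Definition bump_slice (r y : R) : R := ((fun y => b.[y / r]) \_ `[0, r]) y.

Lemma bump_sliceE r y : bump_slice r y = if (0 <= y <= r) then b.[y / r] else 0.
Proof. by rewrite /bump_slice patchE mem_setE in_itv. Qed.

Lemma bump_slice_bound : exists2 S : R, 0 < S & forall r y, 0 < r -> `|bump_slice r y| <= S.
Proof.
have [S S0 hS] := horner_unit_bound b; exists S => // r y r0; rewrite bump_sliceE.
case: ifP => [/andP[y0 yr]|_]; last by rewrite normr0 ltW.
by apply: hS; rewrite divr_ge0 ?(ltW r0)//= ler_pdivrMr// mul1r.
Qed.

Let S : R := s2val (cid2 bump_slice_bound).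

Let S_gt0 : 0 < S := s2valP (cid2 bump_slice_bound).

Let slice_le r y : 0 < r -> `|bump_slice r y| <= S.
Proof. exact: (s2valP' (cid2 bump_slice_bound)). Qed.

Lemma measurable_bump_slice r : measurable_fun setT (bump_slice r).
Proof.
rewrite (_ : bump_slice r = (fun y => b.[y / r] * \1_(`[0, r] : set R) y)).
  apply: measurable_funM => //; apply: measurableT_comp; first exact: measurable_horner.
  exact: measurable_funM.
apply/funext => y; rewrite bump_sliceE indicE mem_setE in_itv/=.
by case: ifP; rewrite ?mulr1 ?mulr0.
Qed.

Lemma bump_slice_integral r (f : R -> R) (M : R) : 0 < r -> measurable_fun setT f ->
  (forall y, 0 <= y <= r -> `|f y| <= M) ->
  leb.-integrable setT (EFin \o (fun y => bump_slice r y * f y)) /\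
  \int[leb]_y (bump_slice r y * f y) = \int[leb]_(y in `[0, r]) (b.[y / r] * f y).
Proof.
move=> r0 mf fM.
have E : (fun y => bump_slice r y * f y) = (fun y => b.[y / r] * f y) \_ `[0, r].
  apply/funext => y; rewrite bump_sliceE patchE mem_setE in_itv/=.
  by case: ifP => // _; rewrite mul0r.
split; last by rewrite [RHS]Rintegral_mkcond -E.
have I : leb.-integrable `[0, r] (EFin \o (fun y => b.[y / r] * f y)).
  apply: (@itv_integrable R r r0 _ (S * M)).
    apply: measurable_funM => //; apply: measurableT_comp; first exact: measurable_horner.
    exact: measurable_funM.
  move=> y yr; rewrite normrM ler_pM ?fM//.
  by have := slice_le y r0; rewrite bump_sliceE yr.
by have := (@integrable_mkcond _ _ _ leb _ _ (measurable_itv _)).1 I; rewrite restrict_EFin E.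
Qed.

Let ball_measure r : 0 < r -> {m : R | mu (euclidean_ball 0 (2 * d%:R * r)) = m%:E /\
  0 < m <= (4 * d%:R * r) ^+ d}.
Proof.
move=> r0; apply: cid.
have dR : 0 < d%:R :> R by rewrite ltr0n.
have r'0 : 0 < 2 * d%:R * r by rewrite !mulr_gt0.
have [m mE /andP[m1 m2]] := euclidean_ball_measure d_gt0 (0 : V) r'0.
exists m; split => //; apply/andP; split.
  by apply: lt_le_trans m1; rewrite exprn_gt0// mulr_gt0// divr_gt0.
by rewrite (_ : 4 * d%:R * r = 2 * (2 * d%:R * r))//; ring.
Qed.

(** The ball of radius [2 d r] about the origin contains the cube [[0, r]^d]; [S ^ d] bounds the
    product of the slices, so the remaining factor is the size allowed to an atom on this ball. *)
Definition bump_atom (r : R) : V -> R := fun x =>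
  (S ^+ d)^-1 * (fine (mu (euclidean_ball 0 (2 * d%:R * r)))) `^ (- p^-1) *
    \prod_(i < d) bump_slice r (x ord0 i).

Let lam (r : R) := (S ^+ d)^-1 * (fine (mu (euclidean_ball 0 (2 * d%:R * r)))) `^ (- p^-1).

Let lam_gt0 r : 0 < r -> 0 < lam r.
Proof.
move=> r0; have [m [mE /andP[m0 _]]] := ball_measure r0.
by rewrite /lam mE mulr_gt0 ?invr_gt0 ?exprn_gt0// powR_gt0.
Qed.

Lemma bump_atom_pairing r (f : 'I_d -> R -> R) (M : R) : 0 < r ->
  (forall i, measurable_fun setT (f i)) ->
  (forall i y, 0 <= y <= r -> `|f i y| <= M) ->
  mu.-integrable setT (EFin \o (fun x => bump_atom r x * \prod_(i < d) f i (x ord0 i))) /\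
  \int[mu]_x (bump_atom r x * \prod_(i < d) f i (x ord0 i)) =
  lam r * \prod_(i < d) \int[leb]_(y in `[0, r]) (b.[y / r] * f i y).
Proof.
move=> r0 mf fM.
have H i := bump_slice_integral r0 (mf i) (fM i).
have I := integrable_prod_rV (fun i => (H i).1).
have E x : bump_atom r x * \prod_(i < d) f i (x ord0 i) =
    lam r * \prod_(i < d) (bump_slice r (x ord0 i) * f i (x ord0 i)).
  by rewrite /bump_atom -/(lam r) big_split /= mulrA.
rewrite (_ : (fun x => _) = (fun x : V => lam r * \prod_(i < d) (bump_slice r (x ord0 i) * f i (x ord0 i)))); last first.
  by apply/funext => x; exact: E.
split; first exact: (integrableZl measurableT (lam r) I).
rewrite RintegralZl//; congr (_ * _).
have := Rintegral_prod_rV (fun i => (H i).1) => /= ->.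
by apply: eq_bigr => i _; rewrite (H i).2.
Qed.

Lemma bump_atom_eq0 r (x : V) : 0 < r -> (exists i, ~~ (0 < x ord0 i <= r)) -> bump_atom r x = 0.
Proof.
move=> r0 [i hi]; rewrite /bump_atom (bigD1 i)//= bump_sliceE.
case: ifP => [/andP[y0 yr]|_]; last by rewrite mul0r mulr0.
(* The closed edge is harmless: [b] vanishes at [0], so the atom is supported in the open
   orthant. *)
have xi : x ord0 i = 0.
  by apply/eqP; rewrite eq_le y0 andbT leNgt; apply: contra hi => ->.
by rewrite xi mul0r root_bump_derivn ?eqxx// mul0r mulr0.
Qed.

Lemma bump_atom_orthant r (x : V) : 0 < r -> ~ orthant R d x -> bump_atom r x = 0.
Proof.
move=> r0 /existsNP[i /negP hi]; apply: bump_atom_eq0 => //; exists i.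
by apply: contra hi => /andP[].
Qed.

Lemma atom_bump_atom r : 0 < r -> orthant_atom p q (bump_atom r).
Proof.
move=> r0; split; last by move=> x; exact: bump_atom_orthant.
have dR : 0 < d%:R :> R by rewrite ltr0n.
have [m [mE /andP[m0 mr]]] := ball_measure r0.
have r'0 : 0 < 2 * d%:R * r by rewrite !mulr_gt0.
have ma : measurable_fun setT (bump_atom r).
  apply: measurable_funM => //; apply: (@measurable_prod_coord R d (fun=> bump_slice r)) => i.
  exact: measurable_bump_slice.
have a0 x : ~ euclidean_ball 0 (2 * d%:R * r) x -> bump_atom r x = 0.
  move=> nB; apply: bump_atom_eq0 => //; apply: contrapT => /forallNP h; apply: nB.
  apply: euclidean_ball_of_coord => // i; have /negP/negPn/andP[x0 xr] := h i.
  rewrite mxE subr0 gtr0_norm// (le_lt_trans xr)// mulrAC mulrK ?unitfE ?gt_eqF//.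
  by rewrite ltr_pMl// ltr1n.
split=> //; exists 0, (2 * d%:R * r); split => //.
  have h x : `|bump_atom r x| <= m `^ (- p^-1).
    rewrite /bump_atom mE /= normrM ger0_norm ?mulr_ge0 ?invr_ge0 ?exprn_ge0 ?(ltW S_gt0) ?powR_ge0//.
    rewrite mulrAC ler_piMl ?powR_ge0// ler_pdivrMl ?exprn_gt0// mulr1 normr_prod.
    rewrite -[d in S ^+ d]card_ord -prodr_const; apply: ler_prod => i _.
    by rewrite normr_ge0 slice_le.
  have := Lnorm_le_sup q_ge1 ma (measurable_euclidean_ball _ _) mE m0 a0 (powR_ge0 _ _) h.
  by rewrite mE poweR_EFin addrC (gt0_powRD _ _ m0).
move=> n nP.
transitivity (\int[mu]_x (bump_atom r x * \prod_(i < d) x ord0 i ^+ n i)).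
  rewrite /Rintegral integral_mkcond; congr fine.
  apply: eq_integral => x _; rewrite patchE; case: ifPn => // /negP h.
  by rewrite a0 ?mul0r// => /mem_set.
have [||_ ->] := @bump_atom_pairing r (fun i y => y ^+ n i) (\sum_i r ^+ n i) r0.
- by move=> i; exact: measurable_funX.
- move=> i y /andP[y0 yr]; rewrite normrX ger0_norm//.
  apply: (@le_trans _ _ (r ^+ n i)); first by rewrite lerXn2r ?nnegrE// (le_trans y0).
  by rewrite (bigD1 i)//= lerDl sumr_ge0// => j _; rewrite exprn_ge0// ltW.
(* One vanishing factor is enough: in the first coordinate the exponent is at most [Q], hence a zero
   of the product in [unit_moment_bump_derivn]. *)
rewrite (bigD1 (Ordinal d_gt0))//= (_ : \int[_]_(y in _) _ = 0) ?mul0r ?mulr0//.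
set i := Ordinal d_gt0.
have niQ : (n i <= Q)%N.
  by apply: leq_trans PQ; apply: leq_trans nP; rewrite /multi_size (bigD1 i)//= leq_addr.
have := @Rintegral_horner_powR R r r0 b (n i)%:R (ler0n _ _).
rewrite unit_moment_bump_derivn//; last first.
  by rewrite ltr_wpDr// ltr_nat.
rewrite (bigD1 (Ordinal (leq_ltn_trans niQ (ltnSn Q))))//= subrr mul0r mul0r mulr0.
move=> E; rewrite -[RHS]E; apply: eq_Rintegral => y; rewrite inE/= in_itv/= => /andP[y0 _].
by rewrite powR_mulrn.
Qed.

Lemma integrable_bump_atom r : 0 < r -> mu.-integrable setT (EFin \o bump_atom r).
Proof.
move=> r0; have [C _ hC] := atom_cancellation d_gt0 p_gt0 p_lt1 q_ge1.
by have [c [r' [_ _ ia _ _]]] := hC _ (atom_bump_atom r0).1.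
Qed.

Lemma integrable_inv_square : leb.-integrable setT (EFin \o (fun x : R => (1 + x ^+ 2)^-1)).
Proof.
have cont : continuous (fun x : R => (1 + x ^+ 2)^-1).
  by move=> x; exact: continuous_oneDsqrV.
apply/integrableP; split.
  by apply/measurable_EFinP; exact: continuous_measurable_fun.
have pos (x : R) : 0 <= (1 + x ^+ 2)^-1 by rewrite invr_ge0 addr_ge0// sqr_ge0.
under eq_integral => x _ do rewrite /= ger0_norm//.
rewrite ge0_symfun_integralT//; last by move=> x /=; rewrite sqrrN.
have := @integral0y_oneDsqr R.
rewrite (_ : [set x : R | 0 <= x] = `[0%R, +oo[%classic); last first.
  by apply/seteqP; split => x /=; rewrite in_itv/= andbT.
rewrite /oneDsqr => ->; rewrite -EFinM ltry//.
Qed.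

Lemma one_abs_powR_le (x : R) : ((1 + `|x|) ^- Q.+2) `^ p <= (1 + x ^+ 2)^-1.
Proof.
have x1 : 1 <= 1 + `|x| by rewrite lerDl.
have x0 : 0 < 1 + `|x| by apply: lt_le_trans x1.
rewrite -(powR_invn _ (ltW x0)) -powRrM mulNr.
apply: (@le_trans _ _ ((1 + `|x|) `^ (- 2))).
  by apply: ler_powR => //; rewrite lerN2.
rewrite (powR_invn 2 (ltW x0)) lef_pV2 ?posrE ?exprn_gt0//; last by rewrite ltr_pwDl// sqr_ge0.
exact: one_sqr_le.
Qed.

Let kernel : V -> R := tensor (fun (_ : 'I_d) k => @logistic_tower R k.+1) (fun=> 0%N).

Let schwartz_kernel : schwartz kernel.
Proof.
apply: schwartz_tensor => i; last exact: schwartz_tower_logistic.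
by have [] := @schwartz_tower_logistic R.
Qed.

Let logistic1_gt0 (u : R) : 0 < logistic_tower 1 u.
Proof.
have /andP[l0 l1] := logistic_itv u.
by rewrite logistic_tower1 mulr_gt0// subr_gt0.
Qed.

Let continuous_logistic1 : continuous (@logistic_tower R 1).
Proof.
move=> u; apply: differentiable_continuous; apply/derivable1_diffP.
by have [] := @derivative_tower_logistic R 1%N u.
Qed.

Let integrable_logistic1 : leb.-integrable setT (EFin \o @logistic_tower R 1).
Proof.
have [M M0 hM] := @logistic_tower_decay R 0 2.
apply: (le_integrable measurableT _ _ (integrableZl measurableT M integrable_inv_square)).
  by apply/measurable_EFinP; exact: continuous_measurable_fun.
move=> u _ /=; have u1 : 0 < 1 + u ^+ 2 by rewrite ltr_pwDl// sqr_ge0.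
rewrite lee_fin normrM (gtr0_norm M0) (gtr0_norm (_ : 0 < (1 + u ^+ 2)^-1)) ?invr_gt0//.
rewrite ler_pdivlMr//; apply: le_trans (hM u); rewrite mulrC ler_wpM2r//.
exact: one_sqr_le.
Qed.

Let integral_kernel : \int[mu]_x kernel x != 0.
Proof.
rewrite /kernel /tensor (Rintegral_prod_rV (fun i => integrable_logistic1)).
apply/prodf_neq0 => i _; rewrite gt_eqF//.
pose c := \int[leb]_(u in `[(0 : R), 1]) (logistic_tower 1 u).
have : 0 < c.
  rewrite /c (FTC_is_derive ltr01 (@derivative_tower_logistic R 0) continuous_logistic1).
  rewrite /logistic_tower /= !hornerX subr_gt0 /logistic ltf_pV2 ?posrE ?addr_gt0 ?expR_gt0//.
  by rewrite ltrD2l ltr_expR ltrN2.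
move=> /lt_le_trans; apply; rewrite /c Rintegral_mkcond.
apply: le_Rintegral => //.
- have I : leb.-integrable `[(0 : R), 1] (EFin \o logistic_tower 1).
    by apply: (integrableS measurableT) => //; exact: integrable_logistic1.
  by have := (@integrable_mkcond _ _ _ leb _ _ (measurable_itv _)).1 I; rewrite restrict_EFin.
- by move=> u _; rewrite patchE; case: ifP => // _; exact/ltW.
Qed.

(** The kernel is a tensor product, so the convolution factors, and [bump_integral_le] bounds the
    maximal function by a multiple of the product of the [(1 + |x_i|)^-(Q + 2)]. By [Qp] its [p]-th
    power is at most a multiple of the product of the [1 / (1 + x_i^2)]. *)
Lemma hardy_bump_atom r : 0 < r -> hardy_orthant p (atom_functional (bump_atom r)).
Proof.
move=> r0; have ia := integrable_bump_atom r0.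
have ao x := @bump_atom_orthant r x r0.
split; last exact: supported_atom_functional.
split; first exact: tempered_atom_functional.
exists kernel; split; [exact: schwartz_kernel|exact: integral_kernel|].
have [C C0 hC] := bump_integral_le r0 (ltnSn Q.+1).
have conv t x : 0 < t -> `|dilated_convolution (atom_functional (bump_atom r)) kernel t x| <=
    lam r * \prod_(i < d) (C * (1 + `|x ord0 i|) ^- Q.+2).
  move=> t0; rewrite /dilated_convolution /atom_functional orthant_Rintegral//.
  pose f i y := t^-1 * logistic_tower 1 ((x ord0 i - y) / t).
  have fE y : t ^- d * kernel (t^-1 *: (x - y)) = \prod_(i < d) f i (y ord0 i).
    rewrite /kernel /tensor /f big_split /= prodr_const card_ord exprVn; congr (_ * _).
    by apply: eq_bigr => i _; rewrite !mxE mulrC.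
  have [M M0 hM] := @logistic_tower_decay R 0 0.
  have [||_ E] := @bump_atom_pairing r f (t^-1 * M) r0.
  - move=> i; apply: measurable_funM => //.
    apply: (measurableT_comp (continuous_measurable_fun continuous_logistic1)).
    by apply: measurable_funM => //; exact: measurable_funB.
  - move=> i y _; rewrite normrM ger0_norm ?invr_ge0 ?(ltW t0)// ler_wpM2l ?invr_ge0 ?(ltW t0)//.
    by have := hM ((x ord0 i - y) / t); rewrite expr0 mul1r.
  under eq_Rintegral do rewrite fE.
  rewrite E normrM (gtr0_norm (lam_gt0 r0)) ler_wpM2l ?(ltW (lam_gt0 r0))//.
  rewrite normr_prod; apply: ler_prod => i _; rewrite normr_ge0 /=.
  exact: hC.
pose G (x : V) := lam r * \prod_(i < d) (C * (1 + `|x ord0 i|) ^- Q.+2).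
have G0 x : 0 <= G x.
  rewrite mulr_ge0 ?(ltW (lam_gt0 r0))// prodr_ge0// => i _.
  by rewrite mulr_ge0 ?(ltW C0)// invr_ge0 exprn_ge0// addr_ge0.
have maxG x : (`|maximal_function (atom_functional (bump_atom r)) kernel x| <= (G x)%:E)%E.
  rewrite gee0_abs.
    apply: ub_ereal_sup => _ [t /= t0 <-]; rewrite lee_fin; exact: conv.
  apply: le_ereal_sup_tmp.
  exists (`|dilated_convolution (atom_functional (bump_atom r)) kernel 1 x|)%:E; last by rewrite lee_fin.
  by exists 1 => //=.
rewrite unlock /Lnorm; apply: poweR_lty.
apply: (@le_lt_trans _ _ (\int[mu]_x (((lam r * C ^+ d) `^ p)%:E *
    (\prod_(i < d) (1 + (x ord0 i) ^+ 2)^-1)%:E))%E).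
  apply: le_ge0_integralT => x; first exact: poweR_ge0.
  apply: (@le_trans _ _ ((G x)%:E `^ p)%E).
    apply: gt0_ler_poweR; rewrite ?(ltW p_gt0)// ?in_itv/= ?leey ?andbT// ?abse_ge0//.
    by rewrite lee_fin.
  rewrite poweR_EFin -EFinM lee_fin /G big_split /= prodr_const card_ord mulrA.
  have P0 : 0 <= \prod_(i < d) (1 + `|x ord0 i|) ^- Q.+2.
    by rewrite prodr_ge0// => i _; rewrite invr_ge0 exprn_ge0// addr_ge0.
  have h1 : 0 <= lam r * C ^+ d by rewrite mulr_ge0 ?exprn_ge0 ?(ltW C0) ?(ltW (lam_gt0 r0)).
  rewrite (powRM p h1 P0) ler_wpM2l ?powR_ge0//.
  have powR_prod (F : 'I_d -> R) : (forall i, 0 <= F i) ->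
      (\prod_(i < d) F i) `^ p = \prod_(i < d) F i `^ p.
    move=> F0; elim: (index_enum _) => [|i s IH]; first by rewrite !big_nil powR1.
    by rewrite !big_cons powRM ?IH// prodr_ge0.
  rewrite powR_prod => [|i]; last by rewrite invr_ge0 exprn_ge0// addr_ge0.
  by apply: ler_prod => i _; rewrite powR_ge0 one_abs_powR_le.
have I := integrable_prod_rV (fun i : 'I_d => integrable_inv_square).
rewrite ge0_integralZl//.
- rewrite lte_mul_pinfty ?lee_fin ?powR_ge0//.
  have /integrableP[_] := I; apply: le_lt_trans.
  apply: le_ge0_integralT => x; last by rewrite lee_fin ler_norm.
  by rewrite lee_fin prodr_ge0// => i _; rewrite invr_ge0 addr_ge0// sqr_ge0.
- by have /measurable_int := I.
- by move=> x _; rewrite lee_fin prodr_ge0// => i _; rewrite invr_ge0 addr_ge0// sqr_ge0.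
- by rewrite lee_fin powR_ge0.
Qed.

Lemma bump_atom_pairing_lower : exists2 c : R, 0 < c &
  forall r (f : 'I_d -> R -> R) (M : R), 0 < r -> (forall i, measurable_fun setT (f i)) ->
  (forall i y, 0 <= y <= r -> `|f i y| <= M) ->
  c * r `^ (- (d%:R * p^-1)) * \prod_(i < d) `|\int[leb]_(y in `[0, r]) (b.[y / r] * f i y)| <=
  `|\int[mu]_x (bump_atom r x * \prod_(i < d) f i (x ord0 i))|.
Proof.
have dR : 0 < 4 * d%:R :> R by rewrite mulr_gt0// ltr0n.
exists ((S ^+ d)^-1 * (4 * d%:R) `^ (- (d%:R * p^-1))) => [|r f M r0 mf fM].
  by rewrite mulr_gt0 ?invr_gt0 ?exprn_gt0// powR_gt0.
have [_ ->] := bump_atom_pairing r0 mf fM.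
rewrite normrM normr_prod (gtr0_norm (lam_gt0 r0)) ler_wpM2r ?prodr_ge0//.
have [m [mE /andP[m0 mr]]] := ball_measure r0.
rewrite /lam mE /= -mulrA -(powRM _ (ltW dR) (ltW r0)).
rewrite ler_wpM2l ?invr_ge0 ?exprn_ge0 ?(ltW S_gt0)//.
have dr0 : 0 < 4 * d%:R * r by rewrite mulr_gt0.
rewrite -mulrN powRrM powR_mulrn ?(ltW dr0)// !powRN lef_pV2 ?posrE ?powR_gt0 ?exprn_gt0//.
by rewrite ge0_ler_powR ?invr_ge0 ?(ltW p_gt0) ?nnegrE ?(ltW m0) ?exprn_ge0 ?(ltW dr0).
Qed.

End bump_atom.

Lemma sum_le_esum (R : realType) (U : finType) (T : choiceType) (h : U -> T) (f : T -> R) :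
  injective h -> ((\sum_(u : U) f (h u))%:E <= \esum_(i in [set: T]) (f i)%:E)%E.
Proof.
move=> hi; apply: esum_ge; exists [set` [seq h u | u <- index_enum U]]; first by split.
rewrite -fsbig_seq; first by rewrite big_map sumEFin.
by rewrite map_inj_uniq// index_enum_uniq.
Qed.

Lemma finite_lower_bound (R : realType) (d : nat) (D : 'I_d -> R) :
  (forall i, 0 < D i) -> exists2 m : R, 0 < m & forall i, m <= D i.
Proof.
move=> D0; have S0 : 0 < 1 + \sum_i (D i)^-1.
  by rewrite ltr_pwDl// sumr_ge0// => i _; rewrite invr_ge0 ltW.
exists (1 + \sum_i (D i)^-1)^-1 => [|i]; first by rewrite invr_gt0.
rewrite -[leRHS]invrK lef_pV2 ?posrE ?invr_gt0// (bigD1 i)//= addrCA lerDl.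
by rewrite addr_ge0// sumr_ge0// => j _; rewrite invr_ge0 ltW.
Qed.

Lemma exists_powR_gt (R : realType) (e A : R) (N : nat) : 0 < e ->
  exists2 m : nat, (N <= m)%N & A < m%:R `^ e.
Proof.
move=> e0; pose m := maxn N (Num.truncn (`|A| `^ e^-1)).+1; exists m; first exact: leq_maxl.
have h : `|A| `^ e^-1 < m%:R.
  by apply: lt_le_trans (truncnS_gt _) _; rewrite ler_nat leq_maxr.
apply: le_lt_trans (ler_norm _) _.
have := gt0_ltr_powR e0 _ _ h; rewrite !nnegrE powR_ge0 ler0n => /(_ isT isT).
by rewrite /= -powRrM mulVf ?gt_eqF// powRr1.
Qed.

(** * Failure of smaller exponents *)

Section sharpness.
Context {R : realType} {d : nat}.
Local Notation V := 'rV[R]_d.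
Local Notation mu := (@lebesgue_rV R d).
Variables (p : R) (q : \bar R) (alpha : 'I_d -> R).
Hypotheses (d_gt0 : (0 < d)%N) (p_gt0 : 0 < p) (p_lt1 : p < 1) (q_ge1 : (1 <= q)%E).
Let ka : R := d%:R * (p^-1 - 1).
Hypothesis alphaP : forall i : 'I_d,
  (exists2 k : nat, (k <= moment_order (d := d) p)%N & alpha i = (2 * k)%:R) \/ 2 * ka < alpha i.

(** The first summand provides the cancellation of an atom, the second the inequality
    [(Q + 2) p >= 2] that puts the maximal function in [L^p]. *)
Let Q := (moment_order (d := d) p + (Num.truncn (2 * p^-1)).+1)%N.

Let PQ : (moment_order (d := d) p <= Q)%N.
Proof. exact: leq_addr. Qed.

Let Qp : 2 <= Q.+2%:R * p.
Proof.
rewrite -ler_pdivrMr//; apply: le_trans (ltW (truncnS_gt _)) _.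
by rewrite ler_nat /Q; apply: leq_trans (leq_addl _ _) _; rewrite ltnW// ltnW.
Qed.

Let ka_gt0 : 0 < ka.
Proof. exact: kappa_gt0. Qed.

Let alpha_ge0 i : 0 <= alpha i.
Proof.
have [[k _ ->]|h] := alphaP i; first exact: ler0n.
by apply: le_trans (ltW h); rewrite mulr_ge0// ltW.
Qed.

Let T r := atom_functional (@bump_atom R d p Q r).

Let pairingE r n : 0 < r ->
  hardy_pairing p q (T r) (laguerre n alpha) = \int[mu]_x (bump_atom p Q r x * laguerre n alpha x).
Proof.
move=> r0; have aa := atom_bump_atom d_gt0 q_ge1 PQ r0.
have H := hardy_pairing_atomic d_gt0 p_gt0 p_lt1 q_ge1 alphaP (n := n)
  (atomic_decomposition_atom_functional aa.2 p_gt0 aa.1).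
rewrite -(orthant_Rintegral _ aa.2); apply: (cvg_unique _ H) => //.
apply: cvg_near_cst; exists 1%N => // k /= k1.
rewrite /series /= big_ltn//= mul1r big_nat_cond big1 ?addr0// => j /andP[/andP[j1 _] _].
by rewrite gtn_eqF// mul0r.
Qed.

Let laguerre_bounded (n : {ffun 'I_d -> nat}) : exists M : R, forall i y, 0 <= y ->
  `|laguerre1 (n i) (alpha i) y| <= M.
Proof.
have [th [M [_ _ M0 _ hM]]] := laguerre_class d_gt0 p_gt0 p_lt1 alphaP.
have [g g1 g2] := hM n.
exists (M + \sum_i `|laguerre1 (n i) (alpha i) 0|) => i y; rewrite le_eqVlt => /orP[/eqP<-|y0].
  by rewrite (bigD1 i)//= addrCA lerDl addr_ge0 ?sumr_ge0// ltW.
rewrite g2//; apply: le_trans (hoelder_class_bound (g1 i) _) _; first by rewrite mulr_gt0.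
by rewrite lerDl sumr_ge0.
Qed.

(** The one-dimensional bounds multiply to [r^d] and the normalisation of the atom contributes
    [r^(- d / p)], together [r^(- ka)]. *)
Lemma bump_atom_laguerre_lower : exists dl c : R, exists k0 : nat, [/\ 0 < dl, 0 < c &
  forall r (n : {ffun 'I_d -> nat}), 0 < r -> (forall i, (k0 <= n i)%N) ->
  (forall i, dl / 2 <= (n i)%:R * r <= dl) ->
  c * r `^ (- ka) <= `|hardy_pairing p q (T r) (laguerre n alpha)|].
Proof.
have /fin_all_exists2[D D0 hD] := fun i => laguerre1_bump_lower (alpha_ge0 i) (ltnSn Q.+1).
have [dl dl0 dlD] := finite_lower_bound D0.
have /fin_all_exists2[c c0 /fin_all_exists[k hk]] := fun i => hD i dl dl0 (dlD i).
have [c' c'0 cc] := finite_lower_bound c0.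
have [c2 c20 hc2] := bump_atom_pairing_lower Q d_gt0 p_gt0.
exists dl, (c2 * c' ^+ d), (\sum_i k i)%N; split=> // [|r n r0 kn nr].
  by rewrite mulr_gt0// exprn_gt0.
have [M hM] := laguerre_bounded n.
rewrite (pairingE _ r0).
have := hc2 r (fun i => laguerre1 (n i) (alpha i)) M r0 (fun i => measurable_laguerre1 _ _).
move=> /(_ (fun i y yr => hM i y (andP yr).1)); apply: le_trans.
have -> : c2 * c' ^+ d * r `^ (- ka) = c2 * r `^ (- (d%:R / p)) * \prod_(i < d) (c' * r).
  rewrite prodr_const card_ord exprMn -[r ^+ d]powR_mulrn ?(ltW r0)//.
  rewrite (_ : - ka = - (d%:R / p) + d%:R); last by rewrite /ka; ring.
  by rewrite (gt0_powRD _ _ r0); ring.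
rewrite ler_wpM2l ?mulr_ge0 ?(ltW c20) ?powR_ge0//.
apply: ler_prod => i _; rewrite mulr_ge0 ?(ltW c'0) ?(ltW r0)//=.
apply: le_trans (hk i (n i) r _ r0 (nr i)); first by rewrite ler_wpM2r ?(ltW r0).
by apply: leq_trans (kn i); rewrite (bigD1 i)//= leq_addr.
Qed.

Lemma laguerre_sum_lower (s E : R) : 0 < s -> exists2 K : R, 0 < K & exists m0 : nat,
  forall m, (m0 <= m)%N -> exists r : R, 0 < r /\
  ((K * m%:R `^ (d%:R + s * ka - Num.max E 0))%:E <= laguerre_sum p q s alpha E (T r))%E.
Proof.
move=> s0; have [dl [c [k0 [dl0 c0 H]]]] := bump_atom_laguerre_lower.
(* Passing to the positive part only enlarges the denominators, as [|n| + 1 >= 1], and makes them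
   monotone in [|n| + 1 <= 2 d m]; the final exponent of [m] stays positive because
   [d + s ka > 0]. *)
pose E1 := Num.max E 0; have E10 : 0 <= E1 by rewrite le_max lexx orbT.
have d2 : 0 < 2 * d%:R :> R by rewrite mulr_gt0// ltr0n.
pose K := (c * (dl / 2) `^ (- ka)) `^ s * (2 * d%:R) `^ (- E1).
exists K; first by rewrite mulr_gt0 ?powR_gt0// mulr_gt0// powR_gt0// divr_gt0.
exists k0.+1 => m km; have m0 : (0 < m)%N by apply: leq_trans km.
have mR : 0 < m%:R :> R by rewrite ltr0n.
exists (dl / 2 / m%:R); split; first by rewrite !divr_gt0.
pose h (g : {ffun 'I_d -> 'I_m}) : {ffun 'I_d -> nat} := [ffun i => (m + g i)%N].
have hi : injective h.
  move=> g g' /ffunP gg; apply/ffunP => i; apply/val_inj.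
  by have := gg i; rewrite !ffunE => /addnI.
apply: (le_trans _ (sum_le_esum _ hi)); rewrite lee_fin.
have r0 : 0 < dl / 2 / m%:R by rewrite !divr_gt0.
have low g : c * (dl / 2 / m%:R) `^ (- ka) <= `|hardy_pairing p q (T (dl / 2 / m%:R)) (laguerre (h g) alpha)|.
  apply: H => // i; rewrite ffunE.
    by apply: leq_trans (leq_addr _ _); apply: leq_trans km.
  rewrite mulrA ler_pdivlMr// ler_pdivrMr// mulrC; apply/andP; split.
    by rewrite ler_wpM2r ?divr_ge0 ?(ltW dl0)// ler_nat leq_addr.
  apply: (@le_trans _ _ ((m + m)%:R * (dl / 2))).
    by rewrite ler_wpM2r ?divr_ge0 ?(ltW dl0)// ler_nat leq_add2l ltnW.
  by rewrite natrD le_eqVlt; apply/orP; left; apply/eqP; field.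
have term g : K * m%:R `^ (s * ka - E1) <= 
   `|hardy_pairing p q (T (dl / 2 / m%:R)) (laguerre (h g) alpha)| `^ s / ((multi_size (h g)).+1%:R `^ E).
  have -> : K * m%:R `^ (s * ka - E1) =
     (c * (dl / 2 / m%:R) `^ (- ka)) `^ s * (2 * d%:R * m%:R) `^ (- E1).
    have dl2 : 0 <= dl / 2 by rewrite divr_ge0 ?(ltW dl0).
    rewrite (powRM _ dl2); last by rewrite invr_ge0 ltW.
    have -> : m%:R^-1 `^ (- ka) = m%:R `^ ka :> R.
      by rewrite -(powR_inv1 (ltW mR)) -powRrM mulN1r opprK.
    rewrite mulrA.
    rewrite (powRM s (x := c * (dl / 2) `^ (- ka))); last 2 first.
      by rewrite mulr_ge0 ?(ltW c0) ?powR_ge0.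
      exact: powR_ge0.
    rewrite (powRM _ (ltW d2) (ltW mR)) -powRrM (gt0_powRD _ _ mR) [ka * s]mulrC /K; ring.
  rewrite [_ `^ (- E1)]powRN ler_pM ?invr_ge0 ?powR_ge0//.
    apply: ge0_ler_powR; rewrite ?nnegrE ?(ltW s0)//.
    by rewrite mulr_ge0 ?(ltW c0) ?powR_ge0.
  have N0 : 0 < (multi_size (h g)).+1%:R :> R by rewrite ltr0n.
  rewrite lef_pV2 ?posrE ?powR_gt0//; last by rewrite mulr_gt0.
  apply: (@le_trans _ _ ((multi_size (h g)).+1%:R `^ E1)).
    by apply: ler_powR; [rewrite ler1n|rewrite le_max lexx].
  apply: ge0_ler_powR; rewrite ?nnegrE ?(ltW N0)//.
  rewrite -!natrM ler_nat.
  have hs : (multi_size (h g) + d <= 2 * d * m)%N.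
    rewrite /multi_size -[X in (_ + X <= _)%N]card_ord -sum1_card -big_split /=.
    apply: (@leq_trans (\sum_(i < d) (2 * m))%N); last first.
      by rewrite sum_nat_const card_ord mulnA [(d * 2)%N]mulnC.
    by apply: leq_sum => i _; rewrite ffunE -addnA addn1 mul2n -addnn leq_add2l ltn_ord.
  by apply: leq_trans hs; rewrite -addn1 leq_add2l.
apply: le_trans (ler_sum _ (fun g _ => term g)).
rewrite sumr_const card_ffun !card_ord -[leRHS]mulr_natl natrX -addrA (gt0_powRD _ _ mR).
rewrite powR_mulrn ?(ltW mR)// le_eqVlt; apply/orP; left; apply/eqP; ring.
Qed.

Lemma laguerre_sum_sharp (s E C : R) : 0 < s -> E < d%:R + s * ka ->
  exists f, hardy_orthant p f /\ (C%:E * hardy_norm p q f `^ s < laguerre_sum p q s alpha E f)%E.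
Proof.
move=> s0 EE; have [K K0 [m0 hm]] := laguerre_sum_lower E s0.
have e0 : 0 < d%:R + s * ka - Num.max E 0.
  rewrite subr_gt0 gt_max EE /=.
  by rewrite ltr_wpDl// mulr_gt0.
have [m mm mC] := exists_powR_gt (`|C| / K) m0 e0.
have [r [r0 hr]] := hm m mm.
exists (T r); split; first exact: (hardy_bump_atom d_gt0 p_gt0 p_lt1 q_ge1 PQ Qp r0).
apply: lt_le_trans hr; rewrite ltr_pdivrMr// mulrC -lte_fin in mC.
apply: le_lt_trans mC.
have aa := atom_bump_atom d_gt0 q_ge1 PQ r0.
have N1 : (hardy_norm p q (T r) `^ s <= 1)%E.
  rewrite -(poweR1r s); apply: gt0_ler_poweR; rewrite ?in_itv/= ?leey ?lee01 ?andbT//.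
  - exact: ltW.
  - apply: le_ereal_inf_tmp => _ [la _ <-]; exact: poweR_ge0.
  - exact: (hardy_norm_atom_functional aa.2 p_gt0 aa.1).
(* [C] may be negative, so it is replaced by [|C|] before the norm is bounded by [1]. *)
apply: (@le_trans _ _ (`|C|%:E * hardy_norm p q (T r) `^ s)%E).
  by rewrite lee_wpmul2r ?poweR_ge0// lee_fin ler_norm.
rewrite -[leRHS]mule1 lee_wpmul2l// lee_fin//.
Qed.

End sharpness.

Theorem theorem3p5 (R : realType) (d : nat) (p s : R) (q : \bar R)
    (alpha : 'I_d -> R)
    (d_ge1 : (1 <= d)%N) (p_gt0 : 0 < p) (p_lt1 : p < 1)
    (p_le_s : p <= s) (s_le2 : s <= 2) (q_ge1 : (1 <= q)%E)
    (alphaP : forall i : 'I_d,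
      (exists2 k : nat, (k <= Num.truncn (d%:R * (p^-1 - 1)))%N
                      & alpha i = (2 * k)%:R)
      \/ 2 * d%:R * (p^-1 - 1) < alpha i) :
  let E : R := d%:R + s * d%:R * (p^-1 - 1) in
  (exists C : R, forall f : ('rV[R]_d -> R) -> R, hardy_orthant p f ->
     (laguerre_sum p q s alpha E f <= C%:E * hardy_norm p q f `^ s)%E)
  /\
  (forall E' : R, E' < E ->
     ~ exists C : R, forall f : ('rV[R]_d -> R) -> R, hardy_orthant p f ->
         (laguerre_sum p q s alpha E' f <= C%:E * hardy_norm p q f `^ s)%E).
Proof.
move=> E; have s0 : 0 < s by apply: lt_le_trans p_le_s.
have al i : (exists2 k, (k <= moment_order (d := d) p)%N & alpha i = (2 * k)%:R) \/
    2 * (d%:R * (p^-1 - 1)) < alpha i.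
  by rewrite mulrA; exact: alphaP.
have EE : E = d%:R + s * (d%:R * (p^-1 - 1)) by rewrite mulrA.
rewrite EE; split.
  have [C _ hC] := laguerre_sum_le d_ge1 p_gt0 p_lt1 q_ge1 al p_le_s s_le2.
  by exists C => f _; exact: hC.
move=> E' E'E [C hC].
have [f [hf]] := laguerre_sum_sharp d_ge1 p_gt0 p_lt1 q_ge1 al C s0 E'E.
by rewrite ltNge hC.
Qed.
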